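(* Let $\mathsf A$ be the Cartan matrix of type $B_n$, with nodes labelled so that $\alpha_1$ is the short simple root and $\Lambda_1$ is the minuscule (spin) fundamental weight. Let $b\in B(\Lambda_1)$, $\xi=\mathrm{wt}(b)$, and let $\lambda_b$, $\mathsf{ST}(\lambda_b)$, $\mathcal S(b)$, $c_{T,S}$ be as defined in the context. Then: (1) $\mathcal S(b)$ (with the action given in the context) is a homogeneous simple $R^{\Lambda_1}(\xi)$-module. (2) If $\lambda_b=(\lambda_1,\dots,\lambda_\ell)$, then $$\mathcal S(b)\simeq\mathrm{hd}\big(\mathcal S(\lambda_\ell)\circ\cdots\circ\mathcal S(\lambda_2)\circ\mathcal S(\lambda_1)\big),$$ where $\mathrm{hd}(M)$ denotes the head of a module $M$. (3) Let $m=\mathrm{ht}(\Lambda_1-\xi)$. Then $$\mathrm{Ind}_m^{m+1}\mathcal S(b)\simeq\bigoplus_{i\in I,\ \tilde f_ib\ne0}\mathcal S(\tilde f_ib),\qquad \mathrm{Res}^m_{m-1}\mathcal S(b)\simeq\bigoplus_{i\in I,\ \tilde e_ib\neq0}\mathcal S(\tilde e_ib).$$ (4) For $T,S\in\mathsf{ST}(\lambda_b)$, the element $c_{T,S}$ of $R^{\Lambda_1}(\xi)$ does not depend on the choice of the reduced expression of $w_{T,S}$. Moreover, the algebra $R^{\Lambda_1}(\xi)$ has a $\mathbf k$-basis $$\mathcal C(b):=\{c_{T,S}\mid T,S\in\mathsf{ST}(\lambda_b)\}.$$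
   Context: Setting. $\mathbf k$ is a field, $I=\{1,\dots,n\}$, and $\mathsf A=(a_{ij})$ is the Cartan matrix of type $B_n$ with Dynkin diagram the chain $1-2-\cdots-n$, double bond between $1$ and $2$ with arrow from $2$ to $1$ ($\alpha_1$ short, $a_{12}=-2$, $a_{21}=-1$, all other adjacent entries $-1$). Simple roots $\alpha_i$, coroots $h_i$, fundamental weights $\Lambda_i$, with $\langle h_i,\alpha_j\rangle=a_{ij}$, $\langle h_j,\Lambda_i\rangle=\delta_{ij}$; Weyl group $\mathsf W$ generated by $s_i(\lambda)=\lambda-\langle h_i,\lambda\rangle\alpha_i$; $(\alpha_i,\alpha_j)=\mathsf d_ia_{ij}$ with $\mathsf d_i$ relatively prime positive integers making this symmetric; $\mathsf Q_+=\sum_i\mathbb Z_{\ge0}\alpha_i$, $\mathrm{ht}(\sum k_i\alpha_i)=\sum k_i$. Crystal. The crystal $B(\Lambda_1)$ of the irreducible highest weight $U_q(\mathfrak g)$-module $V(\Lambda_1)$ is identified with the orbit $\mathsf W\cdot\Lambda_1$, each element being its own weight, with $\tilde f_j(\mu)=\mu-\alpha_j$ if $\langle h_j,\mu\rangle=1$ and $0$ otherwise, $\tilde e_j(\mu)=\mu+\alpha_j$ if $\langle h_j,\mu\rangle=-1$ and $0$ otherwise. Quiver Hecke algebra. Fix polynomials $Q_{i,j}(u,v)=(1-\delta_{i,j})\sum t_{i,j;p,q}u^pv^q\in\mathbf k[u,v]$, the sum over $(p,q)\in\mathbb Z_{\ge0}^2$ with $(\alpha_i,\alpha_i)p+(\alpha_j,\alpha_j)q=-2(\alpha_i,\alpha_j)$,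 where $t_{i,j;p,q}=t_{j,i;q,p}$ and $t_{i,j;-a_{ij},0}\in\mathbf k^\times$; assume $Q_{i,j}=1$ whenever $(\alpha_i,\alpha_j)=0$. For $\beta\in\mathsf Q_+$ with $\mathrm{ht}(\beta)=N$, let $I^\beta=\{\nu\in I^N\mid\sum_k\alpha_{\nu_k}=\beta\}$, with $\mathfrak S_N=\langle s_1,\dots,s_{N-1}\rangle$ acting by place permutation, $(w\nu)_k=\nu_{w^{-1}(k)}$. $R(\beta)$ is the $\mathbf k$-algebra generated by $e(\nu)$ ($\nu\in I^\beta$), $x_k$ ($1\le k\le N$), $\tau_m$ ($1\le m\le N-1$) with relations: $e(\nu)e(\nu')=\delta_{\nu,\nu'}e(\nu)$, $\sum_\nu e(\nu)=1$; $x_kx_m=x_mx_k$, $x_ke(\nu)=e(\nu)x_k$; $\tau_me(\nu)=e(s_m\nu)\tau_m$; $\tau_k\tau_m=\tau_m\tau_k$ if $|k-m|>1$; $\tau_k^2e(\nu)=Q_{\nu_k,\nu_{k+1}}(x_k,x_{k+1})e(\nu)$; $(\tau_kx_m-x_{s_k(m)}\tau_k)e(\nu)$ equals $-e(\nu)$ if $m=k,\nu_k=\nu_{k+1}$, equals $e(\nu)$ if $m=k+1,\nu_k=\nu_{k+1}$, and $0$ otherwise; $(\tau_{k+1}\tau_k\tau_{k+1}-\tau_k\tau_{k+1}\tau_k)e(\nu)$ equals $\frac{Q_{\nu_k,\nu_{k+1}}(x_k,x_{k+1})-Q_{\nu_k,\nu_{k+1}}(x_{k+2},x_{k+1})}{x_k-x_{k+2}}e(\nu)$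 if $\nu_k=\nu_{k+2}$, and $0$ otherwise. It is $\mathbb Z$-graded by $\deg e(\nu)=0$, $\deg x_ke(\nu)=(\alpha_{\nu_k},\alpha_{\nu_k})$, $\deg\tau_le(\nu)=-(\alpha_{\nu_l},\alpha_{\nu_{l+1}})$. For $w=s_{k_1}\cdots s_{k_r}\in\mathfrak S_N$ a chosen reduced expression, $\tau_w=\tau_{k_1}\cdots\tau_{k_r}$. For a dominant integral weight $\Lambda$, the cyclotomic quiver Hecke algebra is $R^\Lambda(\Lambda-\beta)=R(\beta)/I^\Lambda_\beta$, where $I^\Lambda_\beta$ is the two-sided ideal generated by $x_N^{\langle h_{\nu_N},\Lambda\rangle}e(\nu)$, $\nu\in I^\beta$; $R^\Lambda(m)=\bigoplus_{\mathrm{ht}(\beta)=m}R^\Lambda(\Lambda-\beta)$. A graded module is homogeneous if it is concentrated in a single degree. Functors. For $M\in R(\beta)$-Mod, $N\in R(\gamma)$-Mod, $M\circ N=R(\beta+\gamma)e(\beta,\gamma)\otimes_{R(\beta)\otimes R(\gamma)}(M\boxtimes N)$, where $e(\beta,\gamma)=\sum_{\nu\in I^\beta,\nu'\in I^\gamma}e(\nu*\nu')$ ($*$ is concatenation). For an $R^\Lambda(\mu)$-module $M$ with $\beta=\Lambda-\mu$: $F_i^\Lambda M=R^\Lambda(\mu-\alpha_i)e(\alpha_i,\beta)\otimes_{R^\Lambda(\mu)}M$ and $E_i^\Lambda M=e(\alpha_i,\beta-\alpha_i)M$, an $R^\Lambda(\mu+\alpha_i)$-module (generators acting with indices shifted by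 one: $x_k\mapsto x_{k+1}$, $\tau_k\mapsto\tau_{k+1}$). $\mathrm{Ind}_m^{m+1}=\bigoplus_{i\in I}F_i^\Lambda$ on $R^\Lambda(m)$-modules and $\mathrm{Res}^{m}_{m-1}=\bigoplus_{i\in I}E_i^\Lambda$ on $R^\Lambda(m)$-modules (here with $\Lambda=\Lambda_1$). Shifted tableaux. A strict partition $\lambda=(\lambda_1>\cdots>\lambda_\ell>0)$ is identified with its shifted Young diagram, with boxes $(i,j)$, $1\le i\le\ell$, $i\le j\le\lambda_i+i-1$ (row $i$, column $j$); $|\lambda|=\sum\lambda_i$. $\mathfrak P_n$ is the set of strict partitions (including $\emptyset$) with $\lambda_1\le n$. $\mathsf{ST}(\lambda)$ is the set of standard tableaux: fillings of the boxes by $1,\dots,N=|\lambda|$, each used once, increasing along rows (left to right) and columns (top to bottom). The residue of a box is $\mathsf{res}(i,j)=j-i+1$. For $T\in\mathsf{ST}(\lambda)$, $\mathsf{res}(T)=(\mathsf{res}(i_N,j_N),\dots,\mathsf{res}(i_2,j_2),\mathsf{res}(i_1,j_1))$, where $(i_k,j_k)$ is the box containing $k$. Set $\mathrm{wt}(\lambda)=\Lambda_1-\sum_{b\in\lambda}\alpha_{\mathsf{res}(b)}$; the map $\lambda\mapsto\mathrm{wt}(\lambda)$ is a bijection $\mathfrak P_n\to\mathsf W\cdot\Lambda_1=B(\Lambda_1)$, and $\lambda_b$ denotes the strict partition corresponding to $b$. $\mathfrak S_N$ acts on fillings of $\lambda$ by $1,\dots,N$ compatibly with residue sequences: $s_jT$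 is obtained from $T$ by exchanging the entries $N+1-j$ and $N-j$ (the entries recorded at positions $j$ and $j+1$ of $\mathsf{res}(T)$), so $\mathsf{res}(s_jT)=s_j\mathsf{res}(T)$. With $\beta=\Lambda_1-\mathrm{wt}(b)$, $\mathcal S(b)=\bigoplus_{T\in\mathsf{ST}(\lambda_b)}\mathbf kT$ (placed in degree $0$) with $R(\beta)$-action: $e(\nu)T=\delta_{\nu,\mathsf{res}(T)}T$; $x_ke(\nu)T=0$; $\tau_je(\nu)T=s_jT$ if $\nu=\mathsf{res}(T)$ and $s_jT\in\mathsf{ST}(\lambda_b)$, and $0$ otherwise. For $0\le k\le n$, $\mathcal S(k)$ denotes $\mathcal S(b)$ for the $b$ with $\lambda_b=(k)$. For $S,T\in\mathsf{ST}(\lambda_b)$, $w_{T,S}\in\mathfrak S_{|\lambda_b|}$ is the element with $T=w_{T,S}S$, and $c_{T,S}:=e(\mathsf{res}(T))\,\tau_{w_{T,S}}\,e(\mathsf{res}(S))$ (its image in $R^{\Lambda_1}(\xi)$). *)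

(* Defs.v *)
From HB Require Import structures.
From mathcomp Require Import all_boot all_order all_fingroup all_algebra.
From mathcomp Require Import generic_quotient boolp.
From mathcomp Require classical_sets.
From mathcomp Require Import finmap monalg.

Set Implicit Arguments.
Unset Strict Implicit.
Unset Printing Implicit Defensive.

Import GRing.Theory.
Local Open Scope ring_scope.
Local Open Scope quotient_scope.

Record zsub (Z : zmodType) := ZSub {
  zsub_pred :> Z -> Prop;
  zsub0 : zsub_pred 0;
  zsubB : forall x y, zsub_pred x -> zsub_pred y -> zsub_pred (x - y) }.

Section QuotZmod.
Variables (Z : zmodType) (I : zsub Z).

Lemma zsubN x : I x -> I (- x).
Proof. by move=> Ix; rewrite -sub0r; apply: zsubB => //; apply: zsub0. Qed.

Lemma zsubD x y : I x -> I y -> I (x + y).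
Proof. by move=> Ix Iy; rewrite -[y]opprK; apply: zsubB => //; apply: zsubN. Qed.

Definition quotz_eq (x y : Z) : bool := `[< I (x - y) >].

Lemma quotz_eq_refl : reflexive quotz_eq.
Proof. by move=> x; apply/asboolP; rewrite subrr; apply: zsub0. Qed.

Lemma quotz_eq_sym : symmetric quotz_eq.
Proof.
by move=> x y; apply/asboolP/asboolP => h; rewrite -opprB; apply: zsubN.
Qed.

Lemma quotz_eq_trans : transitive quotz_eq.
Proof.
move=> y x z /asboolP hxy /asboolP hyz; apply/asboolP.
by rewrite -[x](subrK y) -addrA; apply: zsubD.
Qed.

Canonical quotz_equiv :=
  EquivRel quotz_eq quotz_eq_refl quotz_eq_sym quotz_eq_trans.

Definition quotz : Type := {eq_quot quotz_equiv}.
HB.instance Definition _ := Choice.on quotz.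

Definition piz (x : Z) : quotz := \pi_({eq_quot quotz_equiv}) x.
Definition reprz (u : quotz) : Z := repr (u : {eq_quot quotz_equiv}).

Lemma reprzK u : piz (reprz u) = u.
Proof. exact: reprK. Qed.

Lemma piz_eq x y : (piz x = piz y) <-> I (x - y).
Proof.
split=> [h|h]; last by apply/eqmodP/asboolP.
by apply/asboolP; apply/(eqmodP quotz_equiv).
Qed.

Lemma piz_reprz x : I (reprz (piz x) - x).
Proof. by apply/piz_eq; rewrite reprzK. Qed.

Definition addz u v := piz (reprz u + reprz v).
Definition oppz u := piz (- reprz u).

Lemma pizD x y : piz (x + y) = addz (piz x) (piz y).
Proof.
apply/esym/piz_eq; rewrite opprD addrACA.
by apply: zsubD; apply: piz_reprz.
Qed.

Lemma pizN x : piz (- x) = oppz (piz x).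
Proof. by apply/esym/piz_eq; rewrite -opprD; apply: zsubN; apply: piz_reprz. Qed.

Lemma addzA : associative addz.
Proof.
move=> u v w; rewrite -[u]reprzK -[v]reprzK -[w]reprzK.
by rewrite -!pizD addrA.
Qed.

Lemma addzC : commutative addz.
Proof. by move=> u v; rewrite -[u]reprzK -[v]reprzK -!pizD addrC. Qed.

Lemma add0z : left_id (piz 0) addz.
Proof. by move=> u; rewrite -[u]reprzK -!pizD add0r. Qed.

Lemma addNz : left_inverse (piz 0) oppz addz.
Proof. by move=> u; rewrite -[u]reprzK -pizN -!pizD addNr. Qed.

HB.instance Definition _ := GRing.isZmodule.Build quotz addzA addzC add0z addNz.

End QuotZmod.

Inductive submod_gen (A : pzRingType) (M : lmodType A) (X : M -> Prop) :
    M -> Prop :=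
| SubmodIn x of X x : submod_gen X x
| Submod0 : submod_gen X 0
| SubmodD x y of submod_gen X x & submod_gen X y : submod_gen X (x + y)
| SubmodZ a x of submod_gen X x : submod_gen X (a *: x).

Section QuotMod.
Variables (A : pzRingType) (M : lmodType A) (X : M -> Prop).

Lemma submod_genB x y :
  submod_gen X x -> submod_gen X y -> submod_gen X (x - y).
Proof.
by move=> hx hy; apply: SubmodD => //; rewrite -scaleN1r; apply: SubmodZ.
Qed.

Definition quotm : Type := quotz (ZSub (Submod0 X) submod_genB).
HB.instance Definition _ := GRing.Zmodule.on quotm.

Definition pim (x : M) : quotm := piz _ x.

Definition scalem (a : A) (u : quotm) : quotm := pim (a *: reprz u).

Lemma pimZ a x : pim (a *: x) = scalem a (pim x).
Proof.
apply/esym/piz_eq => /=; rewrite -scalerBr.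
by apply: SubmodZ; apply: (piz_reprz (ZSub (Submod0 X) submod_genB)).
Qed.

Lemma pimD x y : pim (x + y) = pim x + pim y.
Proof. exact: pizD. Qed.

Lemma reprmK u : pim (reprz u) = u.
Proof. exact: reprzK. Qed.

Lemma scalemA a b u : scalem a (scalem b u) = scalem (a * b) u.
Proof. by rewrite -[u]reprmK -!pimZ scalerA. Qed.

Lemma scale1m : left_id 1 scalem.
Proof. by move=> u; rewrite -[u]reprmK -!pimZ scale1r. Qed.

Lemma scalemDr : right_distributive scalem +%R.
Proof.
move=> a u v; rewrite -[u]reprmK -[v]reprmK.
by rewrite -pimD -!pimZ -pimD scalerDr.
Qed.

Lemma scalemDl u : {morph scalem^~ u : a b / a + b}.
Proof. by move=> a b; rewrite -[u]reprmK -!pimZ -pimD scalerDl. Qed.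

HB.instance Definition _ :=
  GRing.Zmodule_isLmodule.Build A quotm scalemA scale1m scalemDr scalemDl.

End QuotMod.

Inductive ideal_gen (A : pzRingType) (X : A -> Prop) : A -> Prop :=
| IdealIn x of X x : ideal_gen X x
| Ideal0 : ideal_gen X 0
| IdealD x y of ideal_gen X x & ideal_gen X y : ideal_gen X (x + y)
| IdealMl a x of ideal_gen X x : ideal_gen X (a * x)
| IdealMr a x of ideal_gen X x : ideal_gen X (x * a).

(* The quotient may be the zero ring, hence [pzRingType]. *)
Section QuotRing.
Variables (A : pzRingType) (X : A -> Prop).

Lemma ideal_genB x y : ideal_gen X x -> ideal_gen X y -> ideal_gen X (x - y).
Proof.
by move=> hx hy; apply: IdealD => //; rewrite -mulN1r; apply: IdealMl.
Qed.

Definition quotr : Type := quotz (ZSub (Ideal0 X) ideal_genB).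
HB.instance Definition _ := GRing.Zmodule.on quotr.

Definition pir (x : A) : quotr := piz _ x.

Definition mulq (u v : quotr) : quotr := pir (reprz u * reprz v).

Lemma pirD x y : pir (x + y) = pir x + pir y.
Proof. exact: pizD. Qed.

Lemma reprrK u : pir (reprz u) = u.
Proof. exact: reprzK. Qed.

Lemma pirM x y : pir (x * y) = mulq (pir x) (pir y).
Proof.
have h z : ideal_gen X (reprz (pir z) - z).
  exact: (piz_reprz (ZSub (Ideal0 X) ideal_genB)).
apply/esym/piz_eq => /=; set a := reprz (pir x); set b := reprz (pir y).
have -> : a * b - x * y = (a - x) * b + x * (b - y).
  by rewrite mulrBl mulrBr addrA subrK.
by apply: IdealD; [apply: IdealMr | apply: IdealMl]; apply: h.
Qed.

Lemma mulqA : associative mulq.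
Proof.
move=> u v w; rewrite -[u]reprrK -[v]reprrK -[w]reprrK.
by rewrite -!pirM mulrA.
Qed.

Lemma mul1q : left_id (pir 1) mulq.
Proof. by move=> u; rewrite -[u]reprrK -!pirM mul1r. Qed.

Lemma mulq1 : right_id (pir 1) mulq.
Proof. by move=> u; rewrite -[u]reprrK -!pirM mulr1. Qed.

Lemma mulqDl : left_distributive mulq +%R.
Proof.
move=> u v w; rewrite -[u]reprrK -[v]reprrK -[w]reprrK.
by rewrite -pirD -!pirM -pirD mulrDl.
Qed.

Lemma mulqDr : right_distributive mulq +%R.
Proof.
move=> u v w; rewrite -[u]reprrK -[v]reprrK -[w]reprrK.
by rewrite -pirD -!pirM -pirD mulrDr.
Qed.

HB.instance Definition _ :=
  GRing.Zmodule_isPzRing.Build quotr mulqA mul1q mulq1 mulqDl mulqDr.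

End QuotRing.

Section DirectSum.
Variables (A : pzRingType) (J : finType) (M : J -> lmodType A).

Definition dsum : Type := {dffun forall j, M j}.
HB.instance Definition _ := Choice.on dsum.

Definition dsum_add (u v : dsum) : dsum := [ffun j => u j + v j].
Definition dsum_opp (u : dsum) : dsum := [ffun j => - u j].
Definition dsum_zero : dsum := [ffun j => 0].
Definition dsum_scale a (u : dsum) : dsum := [ffun j => a *: u j].

Lemma dsum_addA : associative dsum_add.
Proof. by move=> u v w; apply/ffunP => j; rewrite !ffunE addrA. Qed.

Lemma dsum_addC : commutative dsum_add.
Proof. by move=> u v; apply/ffunP => j; rewrite !ffunE addrC. Qed.

Lemma dsum_add0 : left_id dsum_zero dsum_add.
Proof. by move=> u; apply/ffunP => j; rewrite !ffunE add0r. Qed.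

Lemma dsum_addN : left_inverse dsum_zero dsum_opp dsum_add.
Proof. by move=> u; apply/ffunP => j; rewrite !ffunE addNr. Qed.

HB.instance Definition _ :=
  GRing.isZmodule.Build dsum dsum_addA dsum_addC dsum_add0 dsum_addN.

Lemma dsum_scaleA a b u : dsum_scale a (dsum_scale b u) = dsum_scale (a * b) u.
Proof. by apply/ffunP => j; rewrite !ffunE scalerA. Qed.

Lemma dsum_scale1 : left_id 1 dsum_scale.
Proof. by move=> u; apply/ffunP => j; rewrite !ffunE scale1r. Qed.

Lemma dsum_scaleDr : right_distributive dsum_scale +%R.
Proof. by move=> a u v; apply/ffunP => j; rewrite !ffunE scalerDr. Qed.

Lemma dsum_scaleDl u : {morph dsum_scale^~ u : a b / a + b}.
Proof. by move=> a b; apply/ffunP => j; rewrite !ffunE scalerDl. Qed.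

HB.instance Definition _ := GRing.Zmodule_isLmodule.Build A dsum
  dsum_scaleA dsum_scale1 dsum_scaleDr dsum_scaleDl.

End DirectSum.

Section ModuleTheory.
Variables (A : pzRingType).
Implicit Types M N : lmodType A.

Definition lmod_iso M N : Prop := exists f : {linear M -> N}, bijective f.

Definition is_submod M (N : M -> Prop) : Prop :=
  [/\ N 0, (forall x y, N x -> N y -> N (x + y))
         & (forall a x, N x -> N (a *: x))].

Definition simple_mod M : Prop :=
  (exists v : M, v != 0) /\
  forall N : M -> Prop, is_submod N ->
    (forall v, N v -> v = 0) \/ (forall v, N v).

Definition maximal_submod M (N : M -> Prop) : Prop :=
  [/\ is_submod N, (exists v, ~ N v) &
      forall N' : M -> Prop, is_submod N' -> (forall v, N v -> N' v) ->
        (forall v, N' v -> N v) \/ (forall v, N' v)].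

Definition radical M (v : M) : Prop :=
  forall N : M -> Prop, maximal_submod N -> N v.

(* [radical M] is a submodule, so the submodule it generates is itself. *)
Definition mod_head M : lmodType A := quotm (@radical M).

End ModuleTheory.

Notation free_alg k G := {malg k[{fmonom G}]}.

Definition free_gen (k : fieldType) (G : choiceType) (g : G) : free_alg k G :=
  mkmalgU (fmu g) 1.

Definition free_map (k : fieldType) (G : choiceType) (h : G -> free_alg k G)
    (f : free_alg k G) : free_alg k G :=
  mmap (fun c : k => c%:A) (fun w : {fmonom G} => \prod_(g <- w) h g) f.

Lemma free_scale_comm (k : fieldType) (G : choiceType) (c : k)
  (f : free_alg k G) : c%:A * f = f * c%:A.
Proof.
have cE : c%:A = malgC c :> free_alg k G by rewrite -mul_malgC mulr1.
rewrite mulr_algl cE [in LHS](monalgE f) scaler_sumr malgM_def fgmulgU.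
apply: eq_bigr => w _; rewrite mulm1; apply/malgP => w'.
by rewrite mcoeffZ !mcoeffU mulrnAr mulrC.
Qed.

Section GenMod.
Variables (k : fieldType) (G : choiceType) (V : lmodType k).
Variable rho : G -> {linear V -> V}.

Local Notation F := (free_alg k G).

Definition word_op (w : {fmonom G}) (v : V) : V :=
  foldr (fun g u => rho g u) v (w : seq G).

Definition free_act (f : F) (v : V) : V :=
  \sum_(w <- msupp f) f@_w *: word_op w v.

Lemma word_opD w : {morph word_op w : u v / u + v}.
Proof.
rewrite /word_op; case: w => s /=; elim: s => [|g s IHs] //= u v.
by rewrite IHs linearD.
Qed.

Lemma word_opZ w c v : word_op w (c *: v) = c *: word_op w v.
Proof.
rewrite /word_op; case: w => s /=; elim: s => [|g s IHs] //=.
by rewrite IHs linearZ.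
Qed.

Lemma free_actE (d : {fset {fmonom G}}) f v : (msupp f `<=` d)%fset ->
  free_act f v = \sum_(w <- d) f@_w *: word_op w v.
Proof.
move=> le; rewrite /free_act (big_fset_incl _ le) => //= w _ /mcoeff_outdom ->.
by rewrite scale0r.
Qed.

Lemma free_actDl v : {morph free_act^~ v : f g / f + g}.
Proof.
move=> f g; rewrite (free_actE _ (msuppD_le f g)).
rewrite (free_actE _ (fsubsetUl (msupp f) (msupp g))).
rewrite (free_actE _ (fsubsetUr (msupp f) (msupp g))).
by rewrite -big_split /=; apply: eq_bigr => w _; rewrite mcoeffD scalerDl.
Qed.

Lemma free_act0l v : free_act 0 v = 0.
Proof. by rewrite /free_act msupp0 big_seq_fset0. Qed.

Lemma free_actDr : right_distributive free_act +%R.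
Proof.
move=> f u v; rewrite /free_act -big_split /=.
by apply: eq_bigr => w _; rewrite word_opD scalerDr.
Qed.

Lemma free_act0r f : free_act f 0 = 0.
Proof. by apply: (addIr (free_act f 0)); rewrite -free_actDr !add0r. Qed.

Lemma free_actU c w v : free_act (mkmalgU w c) v = c *: word_op w v.
Proof. by rewrite (free_actE _ msuppU_le) big_seq_fset1 mcoeffUU. Qed.

Lemma free_actA f g v : free_act f (free_act g v) = free_act (f * g) v.
Proof.
rewrite malgME (big_morph _ (free_actDl v) (free_act0l v)).
apply: eq_bigr => w1 _; rewrite (big_morph _ (free_actDl v) (free_act0l v)).
rewrite [in LHS]/free_act (big_morph _ (@word_opD w1) (_ : _ = 0)); last first.
  by rewrite -[0 in LHS](scale0r 0) word_opZ scale0r.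
rewrite scaler_sumr; apply: eq_bigr => w2 _.
rewrite free_actU word_opZ scalerA; congr (_ *: _).
by rewrite /word_op fmM foldr_cat.
Qed.

Lemma free_act1 : left_id 1 free_act.
Proof. by move=> v; rewrite free_actU /word_op fm1 scale1r. Qed.

Definition genmod of (G -> {linear V -> V}) : Type := V.
HB.instance Definition _ := GRing.Zmodule.on (genmod rho).
HB.instance Definition _ := GRing.Zmodule_isLmodule.Build F (genmod rho)
  free_actA free_act1 free_actDr free_actDl.

End GenMod.

Section Corner.
Variables (k : fieldType) (G : choiceType).
Local Notation F := (free_alg k G).
Variable (M : lmodType F).

Definition kspace : Type := M.
HB.instance Definition _ := GRing.Zmodule.on kspace.

Definition kspace_scale (c : k) (v : kspace) : kspace := c%:A *: (v : M).

Lemma kspace_scaleA a b v :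
  kspace_scale a (kspace_scale b v) = kspace_scale (a * b) v.
Proof. by rewrite /kspace_scale scalerA mulr_algl scalerA. Qed.

Lemma kspace_scale1 : left_id 1 kspace_scale.
Proof. by move=> v; rewrite /kspace_scale scale1r scale1r. Qed.

Lemma kspace_scaleDr : right_distributive kspace_scale +%R.
Proof. by move=> a u v; rewrite /kspace_scale scalerDr. Qed.

Lemma kspace_scaleDl v : {morph kspace_scale^~ v : a b / a + b}.
Proof. by move=> a b; rewrite /kspace_scale scalerDl scalerDl. Qed.

HB.instance Definition _ := GRing.Zmodule_isLmodule.Build k kspace
  kspace_scaleA kspace_scale1 kspace_scaleDr kspace_scaleDl.

Variables (e : F) (h : G -> F).

Definition corner_pred : {pred kspace} :=
  fun v => `[< exists u : M, v = e *: u >].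

Lemma corner_closed : submod_closed corner_pred.
Proof.
split; first by apply/asboolP; exists 0; rewrite scaler0.
move=> c u v /asboolP[u' ->] /asboolP[v' ->]; apply/asboolP.
exists (c%:A *: u' + v'); rewrite scalerDr scalerA -free_scale_comm.
by rewrite -scalerA.
Qed.

HB.instance Definition _ :=
  GRing.isSubmodClosed.Build k kspace corner_pred corner_closed.

Record corner := Corner { corner_val :> kspace; _ : corner_pred corner_val }.
HB.instance Definition _ := [isSub for corner_val].
HB.instance Definition _ := [Choice of corner by <:].
HB.instance Definition _ := [SubChoice_isSubLmodule of corner by <:].

Lemma corner_opP (f : F) (u : M) : corner_pred (e *: (f *: u)).
Proof. by apply/asboolP; exists (f *: u). Qed.

(* On modules for which [e] is an idempotent commuting with the elements [h g],
   the factor [e] below is superfluous. *)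
Definition corner_op (g : G) (v : corner) : corner :=
  Corner (corner_opP (h g) (corner_val v)).

Lemma corner_valP (c : k) (u v : corner) :
  corner_val (c *: u + v) = c *: corner_val u + corner_val v.
Proof. by []. Qed.

Lemma kspace_valP (c : k) (u v : kspace) :
  c *: u + v = c%:A *: (u : M) + (v : M).
Proof. by []. Qed.

Lemma corner_op_linear g : linear (corner_op g).
Proof.
have inj : injective (corner_val) by exact: val_inj.
move=> c u v; apply: (inj); rewrite corner_valP.
have opE w : corner_val (corner_op g w) = e *: (h g *: (corner_val w : M)).
  by [].
by rewrite !opE corner_valP !kspace_valP 2!scalerDr !scalerA free_scale_comm.
Qed.

HB.instance Definition _ g :=
  GRing.isLinear.Build k corner corner _ (corner_op g) (corner_op_linear g).

(* [e M], each generator [g] acting through the element [h g]. *)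
Definition corner_mod : lmodType F :=
  genmod (fun g => corner_op g : {linear corner -> corner}).

End Corner.

(* The node [i] of the Dynkin diagram is the ordinal of value [i - 1]; in
   particular the short root is the one of index [0]. *)
Section RootDatum.
Variable n : nat.
Implicit Types i j : 'I_n.

Definition cartan i j : int :=
  if i == j then 2
  else if (val i == 0%N) && (val j == 1%N) then - 2
  else if (val i == (val j).+1) || (val j == (val i).+1) then - 1
  else 0.

Definition symmetrizer i : int := if val i == 0%N then 1 else 2.

Definition root_form i j : int := symmetrizer i * cartan i j.

(* A weight is given by its coordinates in the basis of fundamental weights,
   i.e., [mu i] is the pairing of [mu] with the coroot [h_i]. *)
Definition weight : Type := {ffun 'I_n -> int}.
HB.instance Definition _ := GRing.Zmodule.on weight.

Definition root j : weight := [ffun i => cartan i j].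

Definition Lambda1 : weight := [ffun i => (val i == 0%N)%:Z].

Definition reflection i (mu : weight) : weight := mu - root i *~ mu i.

Definition weyl_orbit (Lam mu : weight) : Prop :=
  exists w : seq 'I_n, mu = foldr reflection Lam w.

(* [None] stands for the zero of the crystal. *)
Definition ftilde j (mu : weight) : option weight :=
  if mu j == 1 then Some (mu - root j) else None.

Definition etilde j (mu : weight) : option weight :=
  if mu j == - 1 then Some (mu + root j) else None.

(* The positive cone of the root lattice, by coordinates on simple roots. *)
Definition Qplus : Type := {ffun 'I_n -> nat}.
HB.instance Definition _ := GRing.Nmodule.on Qplus.

Definition alpha i : Qplus := [ffun j => nat_of_bool (i == j)].

Definition height (beta : Qplus) : nat := (\sum_i beta i)%N.

Definition seq_content (nu : seq 'I_n) : Qplus := \sum_(i <- nu) alpha i.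

End RootDatum.

(* Transposition of the entries of positions m and m+1 (counted from 0). *)
Fixpoint swap_adj (T : Type) (m : nat) (s : seq T) : seq T :=
  match m, s with
  | 0, a :: b :: s' => b :: a :: s'
  | m'.+1, a :: s' => a :: swap_adj m' s'
  | _, _ => s
  end.

Definition transp (m k : nat) : nat :=
  if k == m then m.+1 else if k == m.+1 then m else k.

(* The symbols e(nu), x_l, tau_m, for all sequences nu and all l, m; those that
   are not generators of R(beta) vanish there (see [klr_rel]), so that all the
   R(beta) are quotients of a single free algebra [F]. Positions are counted
   from 0: [xF l] and [tauF m] stand for x_(l+1) and tau_(m+1). *)
Notation klr_gen n := (seq 'I_n + (nat + nat))%type.

Section KLR.
Variables (k : fieldType) (n : nat).

Record klr_datum (t : 'I_n -> 'I_n -> nat -> nat -> k) : Prop := KlrDatum {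
  klr_sym : forall i j p q, t i j p q = t j i q p;
  klr_unit : forall i j, i != j -> t i j `|cartan i j|%N 0%N != 0;
  (* here p = q = 0 is the only term of [Q_{i,j}] *)
  klr_orth : forall i j, root_form i j = 0 -> t i j 0%N 0%N = 1 }.

Variable t : 'I_n -> 'I_n -> nat -> nat -> k.

Local Notation F := (free_alg k (klr_gen n)).

Definition eF (nu : seq 'I_n) : F := free_gen k (inl nu : klr_gen n).
Definition xF (l : nat) : F := free_gen k (inr (inl l) : klr_gen n).
Definition tauF (m : nat) : F := free_gen k (inr (inr m) : klr_gen n).

Definition Qadm (i j : 'I_n) (p q : nat) : bool :=
  root_form i i * p%:Z + root_form j j * q%:Z == - 2 * root_form i j.

(* [Qadm i j p q] forces p and q to be at most the absolute value of
   (alpha_i, alpha_j), because (alpha_i, alpha_i) >= 2. *)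
Definition Qbound (i j : 'I_n) : nat := `|root_form i j|%N.+1.

Definition Qval (i j : 'I_n) (u v : F) : F :=
  if i == j then 0 else
  \sum_(p < Qbound i j) \sum_(q < Qbound i j | Qadm i j p q)
    t i j p q *: (u ^+ p * v ^+ q).

(* (Q_{i,j}(u, v) - Q_{i,j}(w, v)) / (u - w), expanded by means of
   u^p - w^p = (u - w) \sum_(a < p) u^(p - 1 - a) w^a. *)
Definition Qdiff (i j : 'I_n) (u v w : F) : F :=
  if i == j then 0 else
  \sum_(p < Qbound i j) \sum_(q < Qbound i j | Qadm i j p q)
    t i j p q *: ((\sum_(a < p) u ^+ (p.-1 - a) * w ^+ a) * v ^+ q).

Section Relations.
Variable beta : Qplus n.

Definition in_Ibeta (nu : seq 'I_n) : bool := seq_content nu == beta.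

Inductive klr_rel : F -> Prop :=
| KlrE_out nu of ~~ in_Ibeta nu : klr_rel (eF nu)
| KlrX_out l of (height beta <= l)%N : klr_rel (xF l)
| KlrT_out m of (height beta <= m.+1)%N : klr_rel (tauF m)
| KlrEE nu nu' of in_Ibeta nu & in_Ibeta nu' :
    klr_rel (eF nu * eF nu' - (nu == nu')%:R * eF nu)
| KlrE1 :
    klr_rel (\sum_(nu : (height beta).-tuple 'I_n | in_Ibeta nu) eF nu - 1)
| KlrXX l m of (l < height beta)%N & (m < height beta)%N :
    klr_rel (xF l * xF m - xF m * xF l)
| KlrXE l nu of (l < height beta)%N & in_Ibeta nu :
    klr_rel (xF l * eF nu - eF nu * xF l)
| KlrTE m nu of (m.+1 < height beta)%N & in_Ibeta nu :
    klr_rel (tauF m * eF nu - eF (swap_adj m nu) * tauF m)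
| KlrTT l m of (l.+1 < height beta)%N & (m.+1 < height beta)%N
    & (l.+1 < m)%N || (m.+1 < l)%N :
    klr_rel (tauF l * tauF m - tauF m * tauF l)
| KlrT2 l nu i j of in_Ibeta nu & onth nu l = Some i & onth nu l.+1 = Some j :
    klr_rel (tauF l ^+ 2 * eF nu - Qval i j (xF l) (xF l.+1) * eF nu)
| KlrTX l m nu i j of in_Ibeta nu & onth nu l = Some i
    & onth nu l.+1 = Some j & (m < height beta)%N :
    klr_rel ((tauF l * xF m - xF (transp l m) * tauF l) * eF nu
             - (if (m == l) && (i == j) then - eF nu
                else if (m == l.+1) && (i == j) then eF nu else 0))
| KlrTTT l nu i j i' of in_Ibeta nu & onth nu l = Some i
    & onth nu l.+1 = Some j & onth nu l.+2 = Some i' :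
    klr_rel ((tauF l.+1 * tauF l * tauF l.+1 - tauF l * tauF l.+1 * tauF l)
               * eF nu
             - (if i == i' then Qdiff i j (xF l) (xF l.+1) (xF l.+2) * eF nu
                else 0)).

Definition klr : pzRingType := quotr klr_rel.
Definition klr_pi (f : F) : klr := pir klr_rel f.

Variable Lam : weight n.

Inductive cyclo_rel : klr -> Prop :=
| CycloRel nu i of in_Ibeta nu & onth nu (height beta).-1 = Some i :
    cyclo_rel (klr_pi (xF (height beta).-1 ^+ `|Lam i|%N * eF nu)).

(* The cyclotomic quotient of R(beta) of highest weight [Lam]. *)
Definition cyclo : pzRingType := quotr cyclo_rel.
Definition cyclo_pi (f : F) : cyclo := pir cyclo_rel (klr_pi f).

End Relations.

(* [klr_pi] and [cyclo_pi] are surjective, so the modules over [klr beta] (resp.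
   [cyclo beta Lam]) are the modules over [F] killed by the kernel of [klr_pi]
   (resp. [cyclo_pi]), with the same submodules and the same morphisms. All
   modules below are modules over [F]. *)

Definition is_cyclo_mod Lam beta (M : lmodType F) : Prop :=
  forall f : F, cyclo_pi beta Lam f = 0 -> forall v : M, f *: v = 0.

(* The elements of [F] whose images form the homogeneous component of degree
   [d] of R(beta). *)
Inductive klr_deg beta : int -> F -> Prop :=
| Deg0 d : klr_deg beta d 0
| DegD d f g of klr_deg beta d f & klr_deg beta d g : klr_deg beta d (f + g)
| DegZ d (c : k) f of klr_deg beta d f : klr_deg beta d (c *: f)
| DegM d d' f g of klr_deg beta d f & klr_deg beta d' g :
    klr_deg beta (d + d') (f * g)
| DegE nu of in_Ibeta beta nu : klr_deg beta 0 (eF nu)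
| DegX l nu i of in_Ibeta beta nu & onth nu l = Some i :
    klr_deg beta (root_form i i) (xF l * eF nu)
| DegT l nu i j of in_Ibeta beta nu & onth nu l = Some i
    & onth nu l.+1 = Some j :
    klr_deg beta (- root_form i j) (tauF l * eF nu).

(* [gr d] is the homogeneous component of degree [d]. *)
Record graded_mod beta (M : lmodType F) (gr : int -> M -> Prop) : Prop :=
  GradedMod {
    gr_zero : forall d, gr d 0;
    gr_add : forall d u v, gr d u -> gr d v -> gr d (u + v);
    gr_scale : forall d (c : k) v, gr d v -> gr d (c%:A *: v);
    gr_span : forall v, exists (ds : seq int) (vs : int -> M),
      (forall d, gr d (vs d)) /\ v = \sum_(d <- ds) vs d;
    gr_direct : forall (ds : seq int) (vs : int -> M), uniq ds ->
      (forall d, gr d (vs d)) -> \sum_(d <- ds) vs d = 0 ->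
      forall d, d \in ds -> vs d = 0;
    gr_act : forall d d' f v, klr_deg beta d f -> gr d' v ->
      gr (d + d') (f *: v) }.

Definition homogeneous_gr (M : lmodType F) (gr : int -> M -> Prop) : Prop :=
  exists d, forall d', d' != d -> forall v, gr d' v -> v = 0.

(* e(beta, gamma) *)
Definition e_pair (beta gamma : Qplus n) : F :=
  \sum_(nu : (height beta).-tuple 'I_n | in_Ibeta beta nu)
  \sum_(nu' : (height gamma).-tuple 'I_n | in_Ibeta gamma nu') eF (nu ++ nu').

(* Lifts to [F] of the two components
   R(beta) -> R(beta + gamma) <- R(gamma)
   of the map R(beta) (x) R(gamma) -> R(beta + gamma). *)
Definition conv_left (beta gamma : Qplus n) : F -> F :=
  free_map (fun g : klr_gen n => match g with
    | inl nu =>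
        \sum_(nu' : (height gamma).-tuple 'I_n | in_Ibeta gamma nu')
          eF (nu ++ nu')
    | inr (inl l) => if (l < height beta)%N then xF l else 0
    | inr (inr m) => if (m.+1 < height beta)%N then tauF m else 0
    end).

Definition conv_right (beta gamma : Qplus n) : F -> F :=
  free_map (fun g : klr_gen n => match g with
    | inl nu' =>
        \sum_(nu : (height beta).-tuple 'I_n | in_Ibeta beta nu)
          eF (nu ++ nu')
    | inr (inl l) => xF (height beta + l)
    | inr (inr m) => tauF (height beta + m)
    end).

(* R(beta + gamma) e(beta, gamma) (x)_(R(beta) (x) R(gamma)) (M (x) N) is the
   R(beta + gamma)-module generated by the elements
   [e(beta, gamma) (x) u (x) v], written << (u, v) >> below, subject to
   additivity in u and v, to e(beta, gamma) << (u, v) >> = << (u, v) >>, and to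
   the balancing relations over R(beta) and R(gamma). *)
Section Convolution.
Variables (beta gamma : Qplus n) (M N : lmodType F).

Definition tens2 (u : M) (v : N) : {malg F[(M * N)%type]} := << (u, v) >>.

Inductive conv_rel : {malg F[(M * N)%type]} -> Prop :=
| ConvKlr r y of klr_pi (beta + gamma) r = 0 : conv_rel (r *: y)
| ConvDl u u' v : conv_rel (tens2 (u + u') v - tens2 u v - tens2 u' v)
| ConvDr u v v' : conv_rel (tens2 u (v + v') - tens2 u v - tens2 u v')
| ConvE u v : conv_rel (e_pair beta gamma *: tens2 u v - tens2 u v)
| ConvL f u v :
    conv_rel (conv_left beta gamma f *: tens2 u v - tens2 (f *: u) v)
| ConvR f u v :
    conv_rel (conv_right beta gamma f *: tens2 u v - tens2 u (f *: v)).

Definition conv : lmodType F := quotm conv_rel.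

End Convolution.

(* x_l |-> x_(l+1), tau_m |-> tau_(m+1), e(nu) |-> e(i * nu) *)
Definition shift_gen (i : 'I_n) (g : klr_gen n) : F :=
  match g with
  | inl nu => eF (i :: nu)
  | inr (inl l) => xF l.+1
  | inr (inr m) => tauF m.+1
  end.

(* Presentation of the module induced from M along the lift [shift_gen i] of
   the map from the algebra of [beta] to the one of [alpha i + beta], in the
   same way as for the convolution product; << u >> stands for
   e(alpha_i, beta) (x) u. *)
Section Induction.
Variables (Lam : weight n) (beta : Qplus n) (i : 'I_n) (M : lmodType F).

Definition tens1 (u : M) : {malg F[M : choiceType]} := << u >>.

Inductive ind_rel : {malg F[M : choiceType]} -> Prop :=
| IndCyclo r y of cyclo_pi (alpha i + beta) Lam r = 0 : ind_rel (r *: y)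
| IndD u u' : ind_rel (tens1 (u + u') - tens1 u - tens1 u')
| IndE u : ind_rel (e_pair (alpha i) beta *: tens1 u - tens1 u)
| IndS f u : ind_rel (free_map (shift_gen i) f *: tens1 u - tens1 (f *: u)).

Definition Fcyclo : lmodType F := quotm ind_rel.

End Induction.

(* If alpha_i is not a summand of beta, then e(alpha_i, beta - alpha_i) = 0. *)
Definition e_res (beta : Qplus n) (i : 'I_n) : F :=
  if (0 < beta i)%N
  then e_pair (alpha i) [ffun j => (beta j - alpha i j)%N] else 0.

Definition Ecyclo (beta : Qplus n) (i : 'I_n) (M : lmodType F) : lmodType F :=
  corner_mod M (e_res beta i) (shift_gen i).

(* The algebra R^Lam(m), the direct sum of the [cyclo beta Lam] for beta of height
   m, is again a quotient of [F]: the e(nu) with nu in I^beta sum up to the unit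
   of the component beta. Hence [Ind] and [Res], applied to a module over
   [cyclo beta Lam], are modules over R^Lam(m + 1) and R^Lam(m - 1), and
   isomorphisms over these algebras are isomorphisms over [F]. *)
Definition Ind Lam beta (M : lmodType F) : lmodType F :=
  dsum (fun i : 'I_n => Fcyclo Lam beta i M).

Definition Res beta (M : lmodType F) : lmodType F :=
  dsum (fun i : 'I_n => Ecyclo beta i M).

End KLR.

Section Strict.
Variable n : nat.

Definition is_strict (s : seq nat) : bool :=
  sorted gtn s && all (fun p => 0 < p <= n)%N s.

Record strict_part := StrictPart { parts :> seq nat; _ : is_strict parts }.
HB.instance Definition _ := [isSub for parts].
HB.instance Definition _ := [Choice of strict_part by <:].

Definition empty_part : strict_part := @StrictPart [::] isT.

(* The partition (p), which is empty for p = 0. *)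
Definition row_part (p : nat) : strict_part := insubd empty_part [:: p].

Implicit Type lam : strict_part.

(* Rows and columns are counted from 0, hence run over ['I_n]. *)
Definition in_diagram lam (x : 'I_n * 'I_n) : bool :=
  (x.1 <= x.2 < nth 0 lam x.1 + x.1)%N.

Definition box lam : Type := {x : 'I_n * 'I_n | in_diagram lam x}.
HB.instance Definition _ lam := Finite.on (box lam).

Definition row_of lam (b : box lam) : nat := (val b).1.
Definition col_of lam (b : box lam) : nat := (val b).2.

Lemma residue_subproof lam (b : box lam) : (col_of b - row_of b < n)%N.
Proof. by rewrite (leq_ltn_trans (leq_subr _ _)) ?ltn_ord. Qed.

(* The node j - i + 1, of index j - i. *)
Definition residue lam (b : box lam) : 'I_n := Ordinal (residue_subproof b).

Definition content lam : Qplus n := \sum_(b : box lam) alpha (residue b).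

Definition wt lam : weight n := Lambda1 n - \sum_(b : box lam) root (residue b).

(* [wt] is a bijection from [strict_part] to the Weyl orbit of [Lambda1 n]. *)
Definition lambda_of (b : weight n) : strict_part :=
  classical_sets.xget empty_part (fun lam => wt lam = b).

(* The entry v of a filling stands for v + 1. *)
Definition filling lam : Type := {ffun box lam -> 'I_(sumn lam)}.
HB.instance Definition _ lam := Finite.on (filling lam).

Definition is_standard lam (T : filling lam) : bool :=
  [&& [forall v, #|[pred b | T b == v]| == 1%N],
      [forall b, forall c,
         (row_of b == row_of c) && (col_of b < col_of c)%N ==> (T b < T c)%N]
    & [forall b, forall c,
         (col_of b == col_of c) && (row_of b < row_of c)%N ==> (T b < T c)%N]].

Definition ST lam : Type := {T : filling lam | is_standard T}.
HB.instance Definition _ lam := Finite.on (ST lam).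

(* Residues of the boxes by decreasing entries. *)
Definition res_seq lam (T : filling lam) : seq 'I_n :=
  [seq residue b | b <- sort (fun b c => T c <= T b)%N (enum {: box lam})].

(* The entry v is recorded at the position [rev_ord v] of [res_seq T]. *)
Definition perm_act lam (w : 'S_(sumn lam)) (T : filling lam) : filling lam :=
  [ffun b => rev_ord (w (rev_ord (T b)))].

End Strict.

(* The simple transposition of the positions m and m+1 (counted from 0). *)
Definition simple_transp (N m : nat) : 'S_N :=
  match insub m, insub m.+1 with
  | Some a, Some b => tperm a b
  | _, _ => 1%g
  end.

(* The composite s_(k_1) o ... o s_(k_r); the product of ['S_N] is the opposite
   of composition. *)
Definition word_perm (N : nat) (ks : seq nat) : 'S_N :=
  foldr (fun m w => (w * simple_transp N m)%g) 1%g ks.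

Definition is_word (N : nat) (ks : seq nat) : bool :=
  all (fun m => m.+1 < N)%N ks.

Definition reduced_expr (N : nat) (w : 'S_N) (ks : seq nat) : Prop :=
  [/\ is_word N ks, word_perm N ks = w &
      forall ks', is_word N ks' -> word_perm N ks' = w ->
        (size ks <= size ks')%N].

(* The permutation w_{T,S}, i.e., the only w such that T = w S. *)
Definition tab_perm n (lam : strict_part n) (T S : ST lam) : 'S_(sumn lam) :=
  odflt 1%g [pick w | perm_act w (val S) == val T].

Section Specht.
Variables (k : fieldType) (n : nat) (lam : strict_part n).

Definition specht_space : Type := {ffun ST lam -> k^o}.
HB.instance Definition _ := GRing.Lmodule.on specht_space.

Definition tab_vec (T : ST lam) : specht_space := [ffun T' => (T' == T)%:R].

Definition specht_gen (g : klr_gen n) (T : ST lam) : specht_space :=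
  match g with
  | inl nu => if nu == res_seq (val T) then tab_vec T else 0
  | inr (inl l) => 0
  | inr (inr m) =>
      if (m.+1 < sumn lam)%N then
        oapp tab_vec 0 (insub (perm_act (simple_transp (sumn lam) m) (val T)))
      else 0
  end.

Definition specht_op (g : klr_gen n) (v : specht_space) : specht_space :=
  \sum_(T : ST lam) (v T : k) *: specht_gen g T.

Lemma specht_op_linear g : linear (specht_op g).
Proof.
move=> c u v; rewrite /specht_op scaler_sumr -big_split /=.
by apply: eq_bigr => T _; rewrite !ffunE scalerDl scalerA.
Qed.

HB.instance Definition _ g :=
  GRing.isLinear.Build k specht_space specht_space _ (specht_op g)
    (specht_op_linear g).

Definition specht : lmodType (free_alg k (klr_gen n)) :=
  genmod (fun g => specht_op g : {linear specht_space -> specht_space}).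

(* S(b) is placed in degree 0. *)
Definition specht_grading (d : int) (v : specht) : Prop := d = 0 \/ v = 0.

End Specht.
Section Rows.
Variables (k : fieldType) (n : nat) (t : 'I_n -> 'I_n -> nat -> nat -> k).
Local Notation F := (free_alg k (klr_gen n)).

(* S(p), together with the beta such that it is an R(beta)-module. *)
Definition row_mod (p : nat) : {beta : Qplus n & lmodType F} :=
  existT _ (content (row_part n p)) (specht k (row_part n p)).

Definition conv_tagged (M N : {beta : Qplus n & lmodType F}) :
    {beta : Qplus n & lmodType F} :=
  existT _ (projT1 M + projT1 N)
    (conv t (projT1 M) (projT1 N) (projT2 M) (projT2 N)).

(* S(p_l) o ( ... o (S(p_2) o S(p_1))) for s = [:: p_1; p_2; ...; p_l]. The
   empty product is S(0), the unit object: the field k as a module over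
   R(0) = k. *)
Definition conv_rows (s : seq nat) : lmodType F :=
  if s is p :: s' then
    projT2 (foldl (fun M q => conv_tagged (row_mod q) M) (row_mod p) s')
  else projT2 (row_mod 0).

Definition Qroot (beta : Qplus n) : weight n := \sum_i root i *+ beta i.

Section Basis.
Variables (beta : Qplus n) (Lam : weight n) (lam : strict_part n).

Definition c_elt (T S : ST lam) (ks : seq nat) : cyclo t beta Lam :=
  cyclo_pi t beta Lam
    (eF k (res_seq (val T)) * (\prod_(m <- ks) tauF k n m)
       * eF k (res_seq (val S))).

(* The field k acts on [cyclo] through the scalars of the free algebra. *)
Definition cyclo_basis (J : finType) (v : J -> cyclo t beta Lam) : Prop :=
  forall y, exists! a : {ffun J -> k},
    y = \sum_(j : J) cyclo_pi t beta Lam (a j)%:A * v j.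

End Basis.

End Rows.

(* Main.v *)
(** The words res(T), for T standard of shape [lambda_b], are the words i_1 ... i_N
    along which the crystal operators lead from [Lambda_1] to b (the last letter
    acting first). By induction on N, a vector of weight i_1 ... i_N in a module
    over the cyclotomic algebra is killed by all x_l, and is zero unless the word
    is a crystal word: the quadratic relation at the first two letters, and the
    braid relation at three letters i j i, leave no other possibility. Any two
    crystal words of the same content are related by exchanges of orthogonal
    neighbours, on which tau squares to 1, and the braid relations make the
    resulting transport of weight vectors independent of the chosen exchanges.
    So every vector of weight res(T) in a cyclotomic module is the image of T
    under a morphism from S(b). Applied to the induced module and to the regular
    module, this gives the branching rules and the basis, since S(b) is simple
    with one-dimensional weight spaces.

    For the convolution product, let nu be the reading word of the rows, the last
    row first. A shuffle of the letters of a row of length a with a word that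
    starts with a letter >= a can start with the letters of that row only if it is
    the trivial shuffle; so the weight space of nu in the product is a line, which
    generates the product and maps onto a weight space of S(b). Hence the kernel
    of this map is the largest proper submodule. *)

(* The obstacle is the double bond. At adjacent letters i j i the braid relation leaves a unit when
   a_ij = -1, but only x_p + x_(p+2) when a_ij = -2, and there the quadratic relation gives no more
   than x_p^2 = 0. So the vanishing of the x and the vanishing at words outside the crystal are
   proved in one induction on the suffixes of a word, from the cyclotomic condition at the last
   letter leftwards. The case -2 closes because Lambda_1 is minuscule: the weights of its orbit are
   sign vectors, their pairings with coroots lie in {-1, 0, 1}, and the pairing with the short
   coroot is never 0.

   In the product of the rows, the weight space of the reading word is bounded from above by the
   sets [clos j], closed under the e, the x and the tau_q with q >= j, and from below by an explicit
   map to S(b).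

   All modules are modules over one free algebra; the relations are isolated in [klr_rep], over an
   abstract ring, and induced modules and products are handled through their presentations. *)
From HB Require Import structures.
Require Import Defs.
From mathcomp Require Import all_boot all_order all_fingroup all_algebra.
From mathcomp Require Import generic_quotient boolp finmap monalg zify.

Set Implicit Arguments.
Unset Strict Implicit.
Unset Printing Implicit Defensive.

Import GRing.Theory.
Local Open Scope ring_scope.
Local Open Scope quotient_scope.

Local Notation quotm := Defs.quotm.
Local Notation root := Defs.root.

(** * Modules, heads and free algebras *)

Section ModuleLemmas.
Variable A : pzRingType.
Implicit Types M N : lmodType A.

Lemma lmod_iso_sym M N : lmod_iso M N -> lmod_iso N M.
Proof.
case=> f [g fK gK].
have gl : linear g by move=> a u v; apply: (can_inj fK); rewrite linearP !gK.
by exists (HB.pack_for {linear N -> M} g (GRing.isLinear.Build A N M _ g gl)); exists f.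
Qed.

Lemma mk_linear M N (f : M -> N) : (forall a u v, f (a *: u + v) = a *: f u + f v) ->
  exists g : {linear M -> N}, g =1 f.
Proof.
by move=> fl; exists (HB.pack_for {linear M -> N} f (GRing.isLinear.Build A M N _ f fl)).
Qed.

Lemma linear_iso M N (f : {linear M -> N}) :
  (forall v, f v = 0 -> v = 0) -> (forall w, exists v, f v = w) -> lmod_iso M N.
Proof.
move=> f0 fs; exists f.
have fi : injective f.
  by move=> u v uv; apply/eqP; rewrite -subr_eq0; apply/eqP/f0; rewrite linearB uv subrr.
have [g gK] := choice fs.
by exists g => // v; apply: fi; rewrite gK.
Qed.

Lemma pim_eq0 M (X : M -> Prop) (u : M) : pim X u = 0 <-> submod_gen X u.
Proof.
have -> : (0 : quotm X) = pim X 0 by [].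
split=> [/piz_eq|h]; first by rewrite subr0.
by apply/piz_eq; rewrite subr0.
Qed.

Lemma pim_linear M (X : M -> Prop) a u v :
  pim X (a *: u + v) = a *: pim X u + pim X v.
Proof. by rewrite pimD pimZ. Qed.

Lemma pim_scale M (X : M -> Prop) a u : pim X (a *: u) = a *: pim X u.
Proof. exact: pimZ. Qed.

Lemma additive0 (V W : zmodType) (f : V -> W) : {morph f : x y / x + y} -> f 0 = 0.
Proof. by move=> fD; apply: (addrI (f 0)); rewrite -fD !addr0. Qed.

Lemma additiveB (V W : zmodType) (f : V -> W) : {morph f : x y / x + y} ->
  {morph f : x y / x - y}.
Proof. by move=> fD x y; apply/eqP; rewrite eq_sym subr_eq -fD subrK. Qed.

Lemma quotm_lift M N (X : M -> Prop) (f : {linear M -> N}) :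
  (forall x, X x -> f x = 0) ->
  exists g : {linear quotm X -> N}, forall x, g (pim X x) = f x.
Proof.
move=> f0.
have fK x : submod_gen X x -> f x = 0.
  elim=> [|| u v _ hu _ hv | a u _ hu]; first exact: f0.
  - exact: linear0.
  - by rewrite linearD hu hv addr0.
  - by rewrite linearZZ hu scaler0.
have hf x : f (reprz (pim X x)) = f x.
  apply/eqP; rewrite -subr_eq0 -linearB; apply/eqP/fK.
  exact: (piz_reprz (ZSub (Submod0 X) (@submod_genB _ _ X))).
have [|g gE] := @mk_linear (quotm X) N (fun u => f (reprz u)).
  move=> a u v; rewrite -[u]reprmK -[v]reprmK -pim_linear !hf.
  by rewrite linearP.
by exists g => x; rewrite gE hf.
Qed.

Lemma is_submod_gen M (X : M -> Prop) : is_submod (submod_gen X).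
Proof.
split; [exact: Submod0 | by move=> *; apply: SubmodD | by move=> *; apply: SubmodZ].
Qed.

Lemma submod_gen_min M (X N : M -> Prop) : is_submod N ->
  (forall x, X x -> N x) -> forall x, submod_gen X x -> N x.
Proof.
case=> N0 ND NZ h x; elim=> [y|| u v _ hu _ hv|a u _ hu].
- exact: h.
- exact: N0.
- exact: ND.
- exact: NZ.
Qed.

Lemma is_submod_sum M (N : M -> Prop) (J : Type) (r : seq J) (P : pred J) (f : J -> M) :
  is_submod N -> (forall j, P j -> N (f j)) -> N (\sum_(j <- r | P j) f j).
Proof. by case=> N0 ND _ h; elim/big_ind: _. Qed.

Lemma is_submod_ker M N (f : {linear M -> N}) : is_submod (fun v => f v = 0).
Proof.
split; first exact: linear0.
  by move=> x y hx hy; rewrite linearD hx hy addr0.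
by move=> a x hx; rewrite linearZZ hx scaler0.
Qed.

Lemma simple_surj M N (f : {linear M -> N}) u : simple_mod N -> f u != 0 ->
  forall w, exists v, f v = w.
Proof.
case=> _ /(_ (fun w => exists v, f v = w)) h fu; case: h => //.
- split; first by exists 0; rewrite linear0.
    by move=> _ _ [v <-] [w <-]; exists (v + w); rewrite linearD.
  by move=> a _ [v <-]; exists (a *: v); rewrite linearZ.
- by move=> h; case/eqP: fu; apply: h; exists u.
Qed.

(* A submodule not contained in [ker f] contains [v], hence is everything: so
   [ker f] is the largest proper submodule. *)
Lemma head_iso M (S : lmodType A) (f : {linear M -> S}) (v : M) : simple_mod S ->
  f v != 0 ->
  (forall w, submod_gen (fun x => x = v) w) ->
  (forall N : M -> Prop, is_submod N -> (exists u, N u /\ f u = f v) -> N v) ->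
  lmod_iso S (mod_head M).
Proof.
move=> Ss fv gen hv.
have fs := simple_surj Ss fv.
have max_in (N : M -> Prop) : is_submod N -> (exists u, N u /\ f u != 0) -> forall w, N w.
  move=> hN [u [Nu fu]] w.
  have Nv : N v.
    apply: hv => //.
    case: Ss => _ /(_ (fun y => exists u, N u /\ f u = y)) [].
    - case: (hN) => N0 ND NZ; split; first by exists 0; rewrite linear0.
        by move=> _ _ [x [Nx <-]] [y [Ny <-]]; exists (x + y); rewrite linearD; split=> //; apply: ND.
      by move=> a _ [x [Nx <-]]; exists (a *: x); rewrite linearZ; split=> //; apply: NZ.
    - by move=> /(_ (f u)) h; case/eqP: fu; apply: h; exists u.
    - exact.
  by apply: (submod_gen_min hN) (gen w) => x ->.
have kmax : maximal_submod (fun w => f w = 0).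
  split; first exact: is_submod_ker.
    by exists v; apply/eqP.
  move=> N' hN' _; have [h|/existsNP [u]] := pselect (forall u, N' u -> f u = 0).
    by left.
  by move=> /not_implyP [Nu fu]; right; apply: max_in => //; exists u; split=> //; apply/eqP.
have radE w : radical w <-> f w = 0.
  split=> [h|fw N [hN [y Ny] maxN]]; first exact: (h _ kmax).
  have sN u : N u -> f u = 0.
    move=> Nu; apply/eqP/negP => /negP fu; apply: Ny.
    by apply: max_in => //; exists u.
  have [h|h] := maxN (fun z => f z = 0) (is_submod_ker f) sN; first exact: (h _ fw).
  by case/eqP: fv; apply: h.
apply: lmod_iso_sym.
have [g gE] := quotm_lift (fun x hx => (radE x).1 hx : f x = 0).
apply: (@linear_iso _ _ g).
  by move=> u; rewrite -[u]reprmK gE => /radE h; apply/pim_eq0/SubmodIn.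
by move=> w; have [u <-] := fs w; exists (pim _ u); rewrite gE.
Qed.

End ModuleLemmas.

(** [Ind] and [Res] are sums over all nodes, the crystal side only over the nodes with an arrow; the
    components without an arrow vanish. *)
Lemma dsum_iso (A : pzRingType) (J : finType) (P : pred J) (M : J -> lmodType A)
    (N : {j | P j} -> lmodType A) :
  (forall j : {j | P j}, lmod_iso (M (val j)) (N j)) ->
  (forall j, ~~ P j -> forall v : M j, v = 0) ->
  lmod_iso (dsum M) (dsum N).
Proof.
move=> iso triv; pose ex j Pj : {j | P j} := exist _ j Pj.
pose f j := projT1 (cid (iso j)).
have fb j : bijective (f j) := projT2 (cid (iso j)).
have [|F FE] := @mk_linear A (dsum M) (dsum N)
  (fun u : dsum M => [ffun j => f j (u (val j))] : dsum N).
  move=> a u v; apply/ffunP => j; rewrite [LHS]ffunE [in LHS](ffunE _ (val j)) [in LHS](ffunE _ (val j)) linearP.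
  by rewrite [RHS]ffunE (ffunE _ j) !(ffunE _ j).
have FE' u j : (F u : {dffun forall j, N j}) j = f j (u (val j)).
  by rewrite FE; apply: ffunE.
apply: (@linear_iso _ _ _ F).
  move=> u Fu0; apply/ffunP => j; rewrite [RHS]ffunE.
  have [Pj|/triv h] := boolP (P j); last exact: h.
  case: (fb (ex j Pj)) => g gK _.
  have := FE' u (ex j Pj); rewrite Fu0 ffunE /= => h.
  by apply: (can_inj gK); rewrite linear0 /= -h.
move=> w.
(* Quantifying over the proof of [P j] makes 0 a valid choice at the indices outside [P]. *)
have gw j : exists v : M j, forall Pj : P j, f (ex j Pj) v = w (ex j Pj).
  have [Pj|nPj] := pselect (P j); last by exists 0 => Pj; case: (nPj Pj).
  case: (fb (ex j Pj)) => g _ gK; exists (g (w (ex j Pj))) => Pj'.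
  by rewrite (bool_irrelevance Pj' Pj) gK.
exists ([ffun j => projT1 (cid (gw j))] : dsum M).
apply/ffunP => -[j Pj]; rewrite FE' ffunE /=.
exact: (projT2 (cid (gw j))).
Qed.

Lemma malgU_scale (A : nzRingType) (C : choiceType) (a : A) (c : C) :
  << a *g c >> = a *: (<< c >> : {malg A[C]}).
Proof. by apply/malgP => c'; rewrite mcoeffZ !mcoeffU mulrnAr mulr1. Qed.

Section FreeAlgebra.
Variables (k : fieldType) (G : choiceType).
Local Notation F := (free_alg k G).

Lemma free_scaleE (c : k) (f : F) : c *: f = c%:A * f.
Proof. by rewrite mulr_algl. Qed.

Lemma free_genM (w : {fmonom G}) : (<< w >> : F) = \prod_(g <- w) free_gen k g.
Proof.
case: w => s /=; elim: s => [|g s IHs].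
  by rewrite big_nil; congr (<< _ >>); apply/eqP; rewrite fmP /= fm1.
rewrite big_cons -IHs /free_gen malgM_def fgmulUU mulr1; congr (<< _ >>).
by apply/eqP; rewrite fmP fmM fmU.
Qed.

Lemma free_ind (P : F -> Prop) :
  P 1 -> (forall g f, P f -> P (free_gen k g * f)) ->
  (forall f h, P f -> P h -> P (f + h)) -> (forall (c : k) f, P f -> P (c *: f)) ->
  forall f, P f.
Proof.
move=> P1 PM PD PZ f; rewrite (monalgE f).
have P0 : P 0 by rewrite -(scale0r 1); apply: PZ.
elim/big_ind: _ => // w _.
rewrite malgU_scale; apply: PZ; rewrite free_genM; elim: (fmonom_val w) => [|g s IHs].
  by rewrite big_nil.
by rewrite big_cons; apply: PM.
Qed.

Implicit Types M N : lmodType F.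

Lemma scale_algC M (c : k) (f : F) (v : M) : f *: (c%:A *: v) = c%:A *: (f *: v).
Proof. by rewrite !scalerA free_scale_comm. Qed.

Lemma free_linear M N (f : M -> N) :
  {morph f : u v / u + v} -> (forall (c : k) v, f (c%:A *: v) = c%:A *: f v) ->
  (forall g v, f (free_gen k g *: v) = free_gen k g *: f v) ->
  exists h : {linear M -> N}, h =1 f.
Proof.
move=> fD fZ fG; apply: mk_linear => a u v; rewrite fD; congr (_ + _).
elim/free_ind: a u => [u|g a IH u|a b IHa IHb u|c a IH u].
- by rewrite !scale1r.
- by rewrite -!scalerA fG IH.
- by rewrite !scalerDl fD IHa IHb.
- by rewrite free_scaleE -!scalerA fZ IH.
Qed.

Lemma free_submod M (P : M -> Prop) : P 0 -> (forall u v, P u -> P v -> P (u + v)) ->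
  (forall (c : k) v, P v -> P (c%:A *: v)) ->
  (forall g v, P v -> P (free_gen k g *: v)) -> is_submod P.
Proof.
move=> P0 PD PZ PG; split=> // a; elim/free_ind: a => [|g a IH|a b IHa IHb|c a IH] v Pv.
- by rewrite scale1r.
- by rewrite -scalerA; apply/PG/IH.
- by rewrite scalerDl; apply: PD; [apply: IHa | apply: IHb].
- by rewrite free_scaleE -scalerA; apply/PZ/IH.
Qed.

Variable h : G -> F.

Definition word_mor (w : {fmonom G}) : F := \prod_(g <- w) h g.

Lemma word_mor_mmorphism : mmorphism word_mor.
Proof.
by split=> [w w'|]; rewrite /word_mor ?fm1 ?big_nil // fmM big_cat.
Qed.

Lemma free_map_mult : multiplicative (free_map h).
Proof.
pose wm := HB.pack_for {mmorphism {fmonom G} -> F} word_mor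
  (isMultiplicative.Build _ _ word_mor word_mor_mmorphism).
apply: (@commr_mmap_is_multiplicative _ _ _ (in_alg F) wm) => f m m'.
exact: free_scale_comm.
Qed.

Lemma free_map1 : free_map h 1 = 1.
Proof. exact: free_map_mult.2. Qed.

Lemma free_mapM : {morph free_map h : x y / x * y}.
Proof. exact: free_map_mult.1. Qed.

Lemma free_mapD : {morph free_map h : x y / x + y}.
Proof. exact: (@mmapD _ _ _ (in_alg F) word_mor). Qed.

Lemma free_mapZ c f : free_map h (c *: f) = c *: free_map h f.
Proof.
have -> : c *: f = malgC c * f by rewrite mul_malgC.
rewrite free_mapM [free_map h _](@mmapU _ _ _ (in_alg F)) /word_mor fm1 big_nil.
by rewrite mulr1 mulr_algl.
Qed.

Lemma free_map_gen g : free_map h (free_gen k g) = h g.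
Proof.
rewrite /free_gen [LHS](@mmapU _ _ _ (in_alg F)) fmU big_seq1 /=.
by rewrite scale1r mul1r.
Qed.

End FreeAlgebra.

(** * Words of the crystal *)

Section CrystalWords.
Variable n : nat.
Implicit Types (i j : 'I_n) (nu mu : seq 'I_n).

(** The weight with coordinates (1 - 2 e x)/2 in the orthonormal basis of type B_n, where alpha_1 is
    the first basis vector and the other simple roots are differences of neighbours; [e x] marks the
    negative coordinates. *)
Definition sgn_wt (e : nat -> bool) : weight n :=
  [ffun i : 'I_n => if val i == 0%N then 1 - (e 0%N)%:Z *+ 2
                    else (e (val i).-1)%:Z - (e (val i))%:Z].

Lemma reflectionE i (m : weight n) j : reflection i m j = m j - cartan j i * m i.
Proof.
rewrite /reflection 2!ffunE; congr (_ - _).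
case: (m i) => k; rewrite ?NegzE ?mulrNz ?ffunE -pmulrn ffunMnE ffunE -[_ *+ _]mulr_natr natz.
  by [].
by rewrite mulrN.
Qed.

(** The reflection at the short root changes the sign of coordinate 0; the others exchange two
    neighbouring coordinates. *)
Lemma reflection_sgn (e : nat -> bool) i :
  exists e', reflection i (sgn_wt e) = sgn_wt e'.
Proof.
exists (fun x => if val i == 0%N then if x == 0%N then ~~ e 0%N else e x
         else if x == val i then e (val i).-1
         else if x == (val i).-1 then e (val i) else e x).
apply/ffunP => j; rewrite reflectionE !ffunE /cartan -val_eqE /=.
case: i j => [[|a] /= Ha] [[|b] /= Hb]; rewrite ?eqxx ?eqSS /=.
- by case: (e 0%N).
- case: b Hb => [|b] Hb /=; first by case: (e 0%N) (e 1%N) => [] [].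
  by rewrite mul0r subr0.
- case: a Ha => [|a] Ha /=; first by case: (e 0%N) (e 1%N) => [] [].
  by rewrite mul0r subr0.
have [->|ab] := eqVneq b a.
  { repeat first [lia | progress simpl | case: eqP => ?]. }
have [->|ab1] := eqVneq b a.+1.
  { repeat first [lia | progress simpl | case: eqP => ?]. }
have [->|ab2] := eqVneq a b.+1.
  { repeat first [lia | progress simpl | case: eqP => ?]. }
{ repeat first [lia | progress simpl | case: eqP => ?]. }
Qed.

Lemma Lambda1_sgn : Lambda1 n = sgn_wt (fun=> false).
Proof. by apply/ffunP => i; rewrite !ffunE; case: eqP. Qed.

Lemma orbit_sgn (b : weight n) : weyl_orbit (Lambda1 n) b -> exists e, b = sgn_wt e.
Proof.
case=> w ->; elim: w => [|i w [e IH]] /=; first by exists (fun=> false); apply: Lambda1_sgn.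
by rewrite IH; apply: reflection_sgn.
Qed.

Definition wtw nu : weight n := foldr (fun i m => m - root i) (Lambda1 n) nu.

Lemma wtwS i nu j : wtw (i :: nu) j = wtw nu j - cartan j i.
Proof. by rewrite /= !ffunE. Qed.

Fixpoint cpath nu : bool :=
  if nu is i :: nu' then cpath nu' && (wtw nu' i == 1) else true.

Lemma cpath_orbit nu : cpath nu -> weyl_orbit (Lambda1 n) (wtw nu).
Proof.
elim: nu => [|i nu IH] /=; first by exists [::].
case/andP => /IH [w ->] /eqP h; exists (i :: w) => /=.
by rewrite /reflection h mulr1z.
Qed.

Lemma cpath_sgn nu : cpath nu -> exists e, wtw nu = sgn_wt e.
Proof. by move/cpath_orbit/orbit_sgn. Qed.

Lemma sgn_bound e i : -1 <= sgn_wt e i <= 1.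
Proof. by rewrite ffunE; case: ifP => _; case: (e _) => //; case: (e _). Qed.

Lemma cpath_bound nu i : cpath nu -> (-1 <= wtw nu i <= 1).
Proof. by case/cpath_sgn => e ->; apply: sgn_bound. Qed.

(** The pairing with the short coroot is a sign. This excludes the weight 0 at the node where the
    Cartan entry -2 occurs. *)
Lemma cpath_neq0 nu i : cpath nu -> val i = 0%N -> wtw nu i != 0.
Proof. by case/cpath_sgn => e -> i0; rewrite ffunE i0 eqxx; case: (e _). Qed.

Lemma cartan_le0 i j : i != j -> cartan i j <= 0.
Proof. by rewrite /cartan => /negbTE ->; do 2?case: ifP. Qed.

Lemma cartan_diag i : cartan i i = 2.
Proof. by rewrite /cartan eqxx. Qed.

Lemma cartan_eq0C i j : (cartan i j == 0) = (cartan j i == 0).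
Proof.
rewrite /cartan (eq_sym j); have [//|_] := eqVneq i j.
by rewrite orbC; repeat (case: ifP => //); lia.
Qed.

Lemma root_form_eq0 i j : (root_form i j == 0) = (cartan i j == 0).
Proof. by rewrite /root_form mulf_eq0 /symmetrizer; case: ifP. Qed.

(** After f_j the pairing with h_i is 1 - a_ij, which exceeds the bound 1 if a_ij < 0. *)
Lemma addable_cartan nu i j : cpath nu -> wtw nu i = 1 -> wtw nu j = 1 ->
  i != j -> cartan i j = 0.
Proof.
move=> pn hi hj ij; have pj : cpath (j :: nu) by rewrite /= pn hj.
have := cpath_bound i pj; rewrite wtwS hi; have := cartan_le0 ij; lia.
Qed.

Lemma cpath_cat nu mu : cpath (nu ++ mu) -> cpath mu.
Proof. by elim: nu => //= i nu IH /andP[/IH]. Qed.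

Lemma cpath_neq i j nu : cpath [:: i, j & nu] -> i != j.
Proof.
case/andP=> /andP[_ /eqP h] /eqP; rewrite wtwS => h'; apply/eqP => ij.
by move: h'; rewrite ij h cartan_diag.
Qed.

(* A letter [i] with weight -1 is removable: its last-added occurrence commutes
   past everything added after it. *)
Lemma cpath_removable nu i : cpath nu -> wtw nu i = -1 ->
  exists nu1 nu2, nu = nu1 ++ i :: nu2 /\ all (fun j => cartan i j == 0) nu1.
Proof.
elim: nu => [|j nu IH] pn.
  by rewrite /= ffunE; case: eqP.
have [<-|ij] := eqVneq i j; first by exists [::], nu.
rewrite wtwS => h; have pn' : cpath nu by case/andP: pn.
have cij : cartan i j = 0.
  have := cpath_bound i pn'; have := cartan_le0 ij; lia.
have [|nu1 [nu2 [-> h1]]] := IH pn'; first by rewrite cij subr0 in h.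
by exists (j :: nu1), nu2; rewrite /= cij eqxx.
Qed.

Lemma wtw_perm nu mu : perm_eq nu mu -> wtw nu = wtw mu.
Proof.
move=> h; rewrite /wtw.
have E s : foldr (fun i m => m - root i) (Lambda1 n) s = Lambda1 n - \sum_(i <- s) root i.
  elim: s => [|i s IH] /=; first by rewrite big_nil subr0.
  by rewrite IH big_cons opprD addrAC addrA.
by rewrite !E (perm_big _ h).
Qed.

Lemma wtw_commute i nu1 nu2 : all (fun j => cartan i j == 0) nu1 ->
  wtw (nu1 ++ nu2) i = wtw nu2 i.
Proof.
elim: nu1 => //= j nu1 IH /andP[/eqP cij /IH h].
by rewrite -[LHS]/(wtw (j :: nu1 ++ nu2) i) wtwS h cij subr0.
Qed.

Lemma cpath_commute i nu1 nu2 : all (fun j => cartan i j == 0) nu1 ->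
  cpath (nu1 ++ i :: nu2) -> cpath (nu1 ++ nu2) /\ wtw (nu1 ++ nu2) i = 1.
Proof.
move=> h p; split; last by rewrite wtw_commute //; case/andP: (cpath_cat p) => _ /eqP.
elim: nu1 h p => [_ /andP[]//|j nu1 IH /= /andP[cij h] /andP[p /eqP pj]].
rewrite IH //=; apply/eqP; rewrite -pj.
rewrite (@wtw_perm (nu1 ++ i :: nu2) (i :: (nu1 ++ nu2))); last by rewrite -cat1s perm_catCA.
by rewrite wtwS; move: cij; rewrite cartan_eq0C => /eqP ->; rewrite subr0.
Qed.

End CrystalWords.

(** * Contents and adjacent exchanges of words *)

Section Content.
Variable n : nat.
Implicit Types (nu mu : seq 'I_n) (beta gamma : Qplus n).

Lemma seq_contentE nu i : seq_content nu i = count_mem i nu.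
Proof.
rewrite /seq_content; elim: nu => [|j nu IH]; first by rewrite big_nil ffunE.
by rewrite big_cons ffunE IH ffunE.
Qed.

Lemma seq_content_perm nu mu : perm_eq nu mu -> seq_content nu = seq_content mu.
Proof. by move=> h; apply: perm_big. Qed.

Lemma seq_content_cat nu mu : seq_content (nu ++ mu) = seq_content nu + seq_content mu.
Proof. exact: big_cat. Qed.

Lemma seq_content_cons i nu : seq_content (i :: nu) = alpha i + seq_content nu.
Proof. exact: big_cons. Qed.

Lemma perm_seq_content nu mu : seq_content nu = seq_content mu -> perm_eq nu mu.
Proof.
move=> h; apply/allP => i _ /=; apply/eqP.
by rewrite -!seq_contentE h.
Qed.

Lemma heightD beta gamma : @height n (beta + gamma) = (height beta + height gamma)%N.
Proof. by rewrite -big_split; apply: eq_bigr => i _; rewrite ffunE. Qed.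

Lemma height_alpha i : @height n (alpha i) = 1%N.
Proof.
rewrite /height (bigD1 i) //= ffunE eqxx big1 // => j ji.
by rewrite ffunE eq_sym (negbTE ji).
Qed.

Lemma height_content nu : @height n (seq_content nu) = size nu.
Proof.
elim: nu => [|i nu IH]; last by rewrite seq_content_cons heightD IH height_alpha.
by rewrite /seq_content big_nil /height big1 // => i _; rewrite ffunE.
Qed.

Lemma size_in_Ibeta beta nu : in_Ibeta beta nu -> size nu = height beta.
Proof. by move=> /eqP <-; rewrite height_content. Qed.

Lemma perm_swap_adj m nu : perm_eq (swap_adj m nu) nu.
Proof.
elim: m nu => [|m IH] [|a [|b nu]] //=; last by rewrite perm_cons IH.
  by rewrite -[a :: _]cat1s -[b :: _]cat1s perm_catCA.
by rewrite perm_cons; case: m IH.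
Qed.

Lemma size_swap_adj m nu : size (swap_adj m nu) = size nu.
Proof. exact: perm_size (perm_swap_adj m nu). Qed.

Lemma seq_content_swap m nu : seq_content (swap_adj m nu) = seq_content nu.
Proof. exact: seq_content_perm (perm_swap_adj m nu). Qed.

Lemma swap_adj_cat m pi nu : swap_adj (size pi + m) (pi ++ nu) = pi ++ swap_adj m nu.
Proof. by elim: pi => //= a pi ->. Qed.

Lemma swap_adj_cat0 pi a b nu : swap_adj (size pi) (pi ++ [:: a, b & nu]) = pi ++ [:: b, a & nu].
Proof. by rewrite -[size pi]addn0 swap_adj_cat. Qed.

Lemma onth_cat0 (pi nu : seq 'I_n) a : onth (pi ++ a :: nu) (size pi) = Some a.
Proof. by rewrite onth_cat ltnn subnn. Qed.

Lemma onth_catS (pi nu : seq 'I_n) m : onth (pi ++ nu) (size pi + m) = onth nu m.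
Proof. by rewrite onth_cat ltnNge leq_addr /= addKn. Qed.

End Content.

(** * The polynomials Q and their divided differences *)

Section QuadraticSums.
Variables (k : fieldType) (L : lalgType k) (c : nat -> nat -> k).

(** The sums of [Qval] and [Qdiff] at adjacent nodes, over an abstract algebra: there (alpha_i,
    alpha_j) = -2, so that [Qbound] is 3. [P] stands for [Qadm]. *)
Definition Qsum (P : nat -> nat -> bool) (u v : L) : L :=
  \sum_(p < 3) \sum_(q < 3 | P p q) c p q *: (u ^+ p * v ^+ q).

Definition Qdsum (P : nat -> nat -> bool) (u v w : L) : L :=
  \sum_(p < 3) \sum_(q < 3 | P p q)
    c p q *: ((\sum_(a < p) u ^+ (p.-1 - a) * w ^+ a) * v ^+ q).

Lemma sum33 (f : nat -> nat -> L) (P Q : nat -> nat -> bool) : (forall p q, P p q = Q p q) ->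
  \sum_(p < 3) \sum_(q < 3 | P p q) f p q =
  \sum_(p <- [:: 0; 1; 2]%N) \sum_(q <- [:: 0; 1; 2]%N) if Q p q then f p q else 0.
Proof.
move=> PQ; rewrite -(big_mkord xpredT (fun p => \sum_(q < 3 | P p q) f p q)).
apply: eq_bigr => p _; rewrite -(big_mkord (P p) (f p)) big_mkcond.
by apply: eq_bigr => q _; rewrite PQ.
Qed.

Lemma Qsum20 P u v : (forall p q, P p q = (p + q.*2 == 2)%N) ->
  Qsum P u v = c 2 0 *: u ^+ 2 + c 0 1 *: v ^+ 1.
Proof.
move=> PQ; rewrite /Qsum (sum33 (fun p q => c p q *: (u ^+ p * v ^+ q)) PQ).
by rewrite !big_cons !big_nil /= !(addr0, add0r) expr0 expr0 mulr1 mul1r addrC.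
Qed.

(** The term in u^2 has divided difference u + w, the term in v has none. The suffixes 20, 11 and 12
    name the three degree conditions: i short, both long, j short. *)
Lemma Qdsum20 P u v w : (forall p q, P p q = (p + q.*2 == 2)%N) ->
  Qdsum P u v w = c 2 0 *: (u + w).
Proof.
move=> PQ; rewrite /Qdsum (sum33 (fun p q => c p q *: ((\sum_(a < p) u ^+ (p.-1 - a) * w ^+ a) * v ^+ q)) PQ).
rewrite !big_cons !big_nil /= !(addr0, add0r) !big_ord_recl !big_ord0 /=.
by rewrite !expr0 mul1r !mulr1 !addr0 mul0r scaler0 add0r.
Qed.

Lemma Qsum11 P u v : (forall p q, P p q = (p + q == 1)%N) ->
  Qsum P u v = c 1 0 *: u ^+ 1 + c 0 1 *: v ^+ 1.
Proof.
move=> PQ; rewrite /Qsum (sum33 (fun p q => c p q *: (u ^+ p * v ^+ q)) PQ).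
by rewrite !big_cons !big_nil /= !(addr0, add0r) expr0 expr0 mulr1 mul1r addrC.
Qed.

Lemma Qdsum11 P u v w : (forall p q, P p q = (p + q == 1)%N) ->
  Qdsum P u v w = c 1 0 *: 1.
Proof.
move=> PQ; rewrite /Qdsum (sum33 (fun p q => c p q *: ((\sum_(a < p) u ^+ (p.-1 - a) * w ^+ a) * v ^+ q)) PQ).
rewrite !big_cons !big_nil /= !(addr0, add0r) !big_ord_recl !big_ord0 /=.
by rewrite !expr0 mul1r !mulr1 !addr0 mul0r scaler0 add0r.
Qed.

Lemma Qsum12 P u v : (forall p q, P p q = (p.*2 + q == 2)%N) ->
  Qsum P u v = c 1 0 *: u ^+ 1 + c 0 2 *: v ^+ 2.
Proof.
move=> PQ; rewrite /Qsum (sum33 (fun p q => c p q *: (u ^+ p * v ^+ q)) PQ).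
by rewrite !big_cons !big_nil /= !(addr0, add0r) expr0 expr0 mulr1 mul1r addrC.
Qed.

Lemma Qdsum12 P u v w : (forall p q, P p q = (p.*2 + q == 2)%N) ->
  Qdsum P u v w = c 1 0 *: 1.
Proof.
move=> PQ; rewrite /Qdsum (sum33 (fun p q => c p q *: ((\sum_(a < p) u ^+ (p.-1 - a) * w ^+ a) * v ^+ q)) PQ).
rewrite !big_cons !big_nil /= !(addr0, add0r) !big_ord_recl !big_ord0 /=.
by rewrite !expr0 mul1r !mulr1 !addr0 mul0r scaler0 add0r.
Qed.

End QuadraticSums.

Section Qpolys.
Variables (k : fieldType) (n : nat).
Variables (t : 'I_n -> 'I_n -> nat -> nat -> k) (t_ok : klr_datum t).
Local Notation F := (free_alg k (klr_gen n)).
Implicit Types (i j : 'I_n) (u v w : F).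

Lemma Qval_orth i j u v : i != j -> cartan i j = 0 -> Qval t i j u v = 1.
Proof.
move=> ij c0; have r0 : root_form i j = 0 by apply/eqP; rewrite root_form_eq0 c0.
rewrite /Qval (negbTE ij) /Qbound r0 absz0 big_ord1 /Qadm r0.
by rewrite big_mkcond big_ord1 /= !mulr0 addr0 eqxx !expr0 mul1r (klr_orth t_ok r0) scale1r.
Qed.

Lemma adjacentP i j : i != j -> cartan i j != 0 ->
  [\/ [/\ val i = 0%N, val j = 1%N & cartan i j = -2],
      [/\ val i = 1%N, val j = 0%N & cartan i j = -1]
    | [/\ val i != 0%N, val j != 0%N & cartan i j = -1]].
Proof.
move=> ij; rewrite /cartan (negbTE ij).
case: ifP => [/andP[/eqP -> /eqP ->] _|h1]; first exact: Or31.
case: ifP => // h2 _.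
have [i0|i0] := eqVneq (val i) 0%N; first by exfalso; move: h1 h2 ij i0; rewrite -val_eqE; lia.
have [j0|j0] := eqVneq (val j) 0%N; last exact: Or33.
by apply: Or32; split=> //; move: h2 i0 j0; lia.
Qed.

(** What the vanishing argument needs to know about Q: its pure power of u has the invertible
    coefficient t_{i,j;-a_ij,0}, and its divided difference is c or c(u + w). *)
Lemma Qval_adj i j u v : i != j -> cartan i j != 0 ->
  exists c c' q, [/\ c != 0, (0 < q)%N,
    Qval t i j u v = c *: u ^+ `|cartan i j|%N + c' *: v ^+ q &
    forall w, Qdiff t i j u v w = c *: if cartan i j == -1 then 1 else u + w].
Proof.
move=> ij cij; have cu := klr_unit t_ok ij.
have sym i0 : symmetrizer i0 = if val i0 == 0%N then 1 else 2 by [].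
have rE i0 : root_form i0 i0 = (if val i0 == 0%N then 2 else 4).
  by rewrite /root_form cartan_diag sym; case: ifP.
have rij : root_form i j = -2.
  by rewrite /root_form sym; case: (adjacentP ij cij) => -[hi _ ->]; case: eqP => // h; lia.
have B : Qbound i j = 3%N by rewrite /Qbound rij.
rewrite /Qval /Qdiff (negbTE ij) B /Qadm !rE rij.
exists (t i j `|cartan i j|%N 0%N).
pose P p q := (if val i == 0%N then 2 else 4) * p%:Z +
    (if val j == 0%N then 2 else 4) * q%:Z == -2 * -2.
case: (adjacentP ij cij) => -[hi hj c]; rewrite c in cu *.
- have PQ p q : P p q = (p + q.*2 == 2)%N by rewrite /P hi hj /=; lia.
  exists (t i j 0 1)%N, 1%N; split=> [||| w]; [exact: cu | by [] | |].
    exact: (Qsum20 (t i j) u v PQ).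
  exact: (Qdsum20 (t i j) u v w PQ).
- have PQ p q : P p q = (p.*2 + q == 2)%N by rewrite /P hi hj /=; lia.
  exists (t i j 0 2)%N, 2%N; split=> [||| w]; [exact: cu | by [] | |].
    exact: (Qsum12 (t i j) u v PQ).
  exact: (Qdsum12 (t i j) u v w PQ).
- have PQ p q : P p q = (p + q == 1)%N.
    by rewrite /P (negbTE hi) (negbTE hj) /=; lia.
  exists (t i j 0 1)%N, 1%N; split=> [||| w]; [exact: cu | by [] | |].
    exact: (Qsum11 (t i j) u v PQ).
  exact: (Qdsum11 (t i j) u v w PQ).
Qed.

End Qpolys.

(** * Modules over the quiver Hecke algebra *)

Lemma rel_act (A : pzRingType) (M : lmodType A) (a b e r : A) (v : M) :
  ((a - b) * e - r) *: v = 0 -> e *: v = v -> a *: v = b *: v + r *: v.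
Proof.
rewrite scalerBl -scalerA => /eqP h e1; move: h; rewrite e1 subr_eq0 scalerBl.
by rewrite subr_eq addrC => /eqP.
Qed.

Lemma rel_comm (A : pzRingType) (M : lmodType A) (a b c d : A) (v : M) :
  (a * b - c * d) *: v = 0 -> a *: (b *: v) = c *: (d *: v).
Proof. by rewrite scalerBl !scalerA => /eqP; rewrite subr_eq0 => /eqP. Qed.

Lemma rel_mul (A : pzRingType) (M : lmodType A) (a b c : A) (v : M) :
  (a * b - c) *: v = 0 -> a *: (b *: v) = c *: v.
Proof. by rewrite scalerBl !scalerA => /eqP; rewrite subr_eq0 => /eqP. Qed.

(* The relations of R(beta), acting on a module over an abstract ring [A]: the
   free algebra is too large a structure to compute with. *)
Record klr_rep (k : fieldType) (n : nat) (beta : Qplus n) (A : pzRingType)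
    (E : seq 'I_n -> A) (X tau : nat -> A) (sc : k -> A)
    (M : lmodType A) : Prop := KlrRep {
  rep_scC : forall c a (v : M), sc c *: (a *: v) = a *: (sc c *: v);
  rep_sc1 : sc 1 = 1;
  rep_scD : forall c d, sc (c + d) = sc c + sc d;
  rep_scM : forall c d, sc (c * d) = sc c * sc d;
  rep_Eout : forall nu, ~~ in_Ibeta beta nu -> forall v : M, E nu *: v = 0;
  rep_Xout : forall l, (height beta <= l)%N -> forall v : M, X l *: v = 0;
  rep_tout : forall m, (height beta <= m.+1)%N -> forall v : M, tau m *: v = 0;
  rep_EE : forall nu nu', in_Ibeta beta nu -> in_Ibeta beta nu' -> forall v : M,
    (E nu * E nu' - (nu == nu')%:R * E nu) *: v = 0;
  rep_E1 : forall v : M,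
    (\sum_(nu : (height beta).-tuple 'I_n | in_Ibeta beta nu) E nu - 1) *: v = 0;
  rep_XX : forall l m, (l < height beta)%N -> (m < height beta)%N -> forall v : M,
    (X l * X m - X m * X l) *: v = 0;
  rep_XE : forall l nu, (l < height beta)%N -> in_Ibeta beta nu -> forall v : M,
    (X l * E nu - E nu * X l) *: v = 0;
  rep_TE : forall m nu, (m.+1 < height beta)%N -> in_Ibeta beta nu -> forall v : M,
    (tau m * E nu - E (swap_adj m nu) * tau m) *: v = 0;
  rep_TT : forall l m, (l.+1 < height beta)%N -> (m.+1 < height beta)%N ->
    (l.+1 < m)%N || (m.+1 < l)%N -> forall v : M,
    (tau l * tau m - tau m * tau l) *: v = 0;
  rep_T2 : forall l nu i j, in_Ibeta beta nu -> onth nu l = Some i ->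
    onth nu l.+1 = Some j -> exists2 q,
      (forall v : M, (tau l ^+ 2 * E nu - q * E nu) *: v = 0) &
      [/\ i = j -> q = 0, i != j -> cartan i j = 0 -> q = 1 &
        i != j -> cartan i j != 0 -> exists c c' a, [/\ c != 0, (0 < a)%N &
          q = sc c * X l ^+ `|cartan i j|%N + sc c' * X l.+1 ^+ a]];
  rep_TX : forall l m nu i j, in_Ibeta beta nu -> onth nu l = Some i ->
    onth nu l.+1 = Some j -> (m < height beta)%N -> forall v : M,
    ((tau l * X m - X (transp l m) * tau l) * E nu
       - (if (m == l) && (i == j) then - E nu
          else if (m == l.+1) && (i == j) then E nu else 0)) *: v = 0;
  rep_TTT : forall l nu i j i', in_Ibeta beta nu -> onth nu l = Some i ->
    onth nu l.+1 = Some j -> onth nu l.+2 = Some i' -> exists2 q,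
      (forall v : M,
        ((tau l.+1 * tau l * tau l.+1 - tau l * tau l.+1 * tau l) * E nu
         - (if i == i' then q * E nu else 0)) *: v = 0) &
      [/\ i = j -> q = 0, i != j -> cartan i j = 0 -> q = 0 &
        i != j -> cartan i j != 0 -> exists2 c, c != 0 &
          q = sc c * (if cartan i j == -1 then 1 else X l + X l.+2)] }.

Section KLRModules.
Variables (k : fieldType) (n : nat) (beta : Qplus n) (A : pzRingType).
Variables (E : seq 'I_n -> A) (X tau : nat -> A) (sc : k -> A).
Variables (M : lmodType A) (HM : klr_rep beta E X tau sc M).
Implicit Types (i j : 'I_n) (nu mu pi : seq 'I_n).
Implicit Types u v : M.
Local Notation N := (height beta).

Definition wv nu v : Prop := E nu *: v = v.

Lemma E_out nu v : seq_content nu != beta -> E nu *: v = 0.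
Proof. by move=> h; apply: (rep_Eout HM). Qed.

Lemma wv_out nu v : wv nu v -> seq_content nu != beta -> v = 0.
Proof. by move=> <- /E_out ->. Qed.

Lemma wv_size nu v : wv nu v -> v != 0 -> size nu = N.
Proof.
move=> h v0; have [<-|/(wv_out h) v00] := eqVneq (seq_content nu) beta.
  by rewrite height_content.
by rewrite v00 eqxx in v0.
Qed.

Lemma X_out l v : (N <= l)%N -> X l *: v = 0.
Proof. by move=> h; apply: (rep_Xout HM). Qed.

Lemma tau_out m v : (N <= m.+1)%N -> tau m *: v = 0.
Proof. by move=> h; apply: (rep_tout HM). Qed.

Lemma EE nu mu v : E nu *: (E mu *: v) = if nu == mu then E mu *: v else 0.
Proof.
have [hn|/(E_out _) hn] := eqVneq (seq_content nu) beta; last first.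
  by case: eqP => [<-|_]; rewrite hn.
have [hm|/(E_out _) hm] := eqVneq (seq_content mu) beta; last first.
  by rewrite hm scaler0; case: ifP.
rewrite (rel_mul (rep_EE HM (introT eqP hn) (introT eqP hm) v)); case: eqP => [->|_]; first by rewrite mul1r.
by rewrite mul0r scale0r.
Qed.

Lemma E_wv nu mu v : wv mu v -> E nu *: v = if nu == mu then v else 0.
Proof. by move=> h; rewrite -h EE; case: eqP => // ->. Qed.

Lemma wvE nu v : wv nu (E nu *: v).
Proof. by rewrite /wv EE eqxx. Qed.

Lemma E_sum v : v = \sum_(nu : N.-tuple 'I_n | in_Ibeta beta nu) E nu *: v.
Proof.
apply/eqP; rewrite eq_sym -subr_eq0 -scaler_suml -[X in _ - X]scale1r -scalerBl.
by apply/eqP; apply: (rep_E1 HM).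
Qed.

Lemma wv_ext (f g : A) : (forall nu v, wv nu v -> f *: v = g *: v) ->
  forall v : M, f *: v = g *: v.
Proof.
move=> h v; rewrite (E_sum v) !scaler_sumr; apply: eq_bigr => nu _.
by apply: h; apply: wvE.
Qed.

Lemma XE l nu v : X l *: (E nu *: v) = E nu *: (X l *: v).
Proof.
have [lN|/X_out h] := ltnP l N; last by rewrite !h scaler0.
have [hn|/(E_out _) hn] := eqVneq (seq_content nu) beta; last by rewrite !hn scaler0.
apply/rel_comm/(rep_XE HM) => //.
exact/eqP.
Qed.

Lemma wv_X l nu v : wv nu v -> wv nu (X l *: v).
Proof. by rewrite /wv -XE => ->. Qed.

Lemma tauE m nu v : tau m *: (E nu *: v) = E (swap_adj m nu) *: (tau m *: v).
Proof.
have [lN|/tau_out h] := ltnP m.+1 N; last by rewrite !h scaler0.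
have [hn|hn] := eqVneq (seq_content nu) beta; last first.
  by rewrite !E_out ?seq_content_swap // scaler0.
apply/rel_comm/(rep_TE HM) => //.
exact/eqP.
Qed.

Lemma wv_tau m nu v : wv nu v -> wv (swap_adj m nu) (tau m *: v).
Proof. by rewrite /wv -tauE => ->. Qed.

Lemma XX l m v : X l *: (X m *: v) = X m *: (X l *: v).
Proof.
have [lN|/X_out h] := ltnP l N; last by rewrite !h scaler0.
have [mN|/X_out h] := ltnP m N; last by rewrite !h scaler0.
by apply/rel_comm/(rep_XX HM).
Qed.

Lemma tau_far l m v : (l.+1 < m)%N || (m.+1 < l)%N ->
  tau l *: (tau m *: v) = tau m *: (tau l *: v).
Proof.
move=> lm; have [lN|/tau_out h] := ltnP l.+1 N; last by rewrite !h scaler0.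
have [mN|/tau_out h] := ltnP m.+1 N; last by rewrite !h scaler0.
by apply/rel_comm/(rep_TT HM).
Qed.

Section Local.
Variables (pi : seq 'I_n).
Local Notation p := (size pi).

Lemma tau2_spec i j nu v : wv (pi ++ [:: i, j & nu]) v -> exists2 q,
  tau p *: (tau p *: v) = q *: v &
      [/\ i = j -> q = 0, i != j -> cartan i j = 0 -> q = 1 &
        i != j -> cartan i j != 0 -> exists c c' a, [/\ c != 0, (0 < a)%N &
          q = sc c * X p ^+ `|cartan i j|%N + sc c' * X p.+1 ^+ a]].
Proof.
move=> h; have [hn|/(wv_out h) v0] := eqVneq (seq_content (pi ++ [:: i, j & nu])) beta.
  have o1 : onth (pi ++ [:: i, j & nu]) p.+1 = Some j by rewrite -addn1 onth_catS.
  have [q qE hq] := rep_T2 HM (introT eqP hn) (onth_cat0 _ _ _) o1.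
  by exists q => //; rewrite scalerA -expr2 -[in LHS]h (rel_mul (qE v)) -scalerA h.
(* Here [v] is 0, but a [q] of the announced shape is still to be exhibited in each case. *)
have [ij|ij] := eqVneq i j; first by exists 0; [rewrite v0 !scaler0 | split=> //; rewrite ij eqxx].
have [c0|c0] := eqVneq (cartan i j) 0; first by exists 1; [rewrite v0 !scaler0 | split=> //; first [by move/eqP; rewrite (negbTE ij) | by rewrite c0 eqxx]].
exists (sc 1 * X p ^+ `|cartan i j|%N + sc 1 * X p.+1 ^+ 1); first by rewrite v0 !scaler0.
by split; [move/eqP; rewrite (negbTE ij) | move=> _ /eqP; rewrite (negbTE c0) | exists 1, 1, 1%N; rewrite oner_eq0].
Qed.

Lemma tau2_eq i nu v : wv (pi ++ [:: i, i & nu]) v -> tau p *: (tau p *: v) = 0.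
Proof. by case/tau2_spec => q -> [-> // _ _]; rewrite scale0r. Qed.

Lemma tau2_orth i j nu v : wv (pi ++ [:: i, j & nu]) v -> i != j -> cartan i j = 0 ->
  tau p *: (tau p *: v) = v.
Proof. by case/tau2_spec => q -> [_ h _] ij c; rewrite h // scale1r. Qed.

Lemma tauX_gen i j nu v m : wv (pi ++ [:: i, j & nu]) v ->
  tau p *: (X m *: v) = X (transp p m) *: (tau p *: v) +
  if (m == p) && (i == j) then - v else if (m == p.+1) && (i == j) then v else 0.
Proof.
move=> h; have [hn|/(wv_out h) ->] := eqVneq (seq_content (pi ++ [:: i, j & nu])) beta; last first.
  by rewrite !scaler0 oppr0; case: ifP => _; rewrite ?addr0 //; case: ifP; rewrite ?addr0.
have sz := size_in_Ibeta (introT eqP hn).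
(* Beyond the last position x vanishes on both sides; such an [m] differs from p and p + 1, which
   are positions of the word. *)
have [mN|mN] := ltnP m N; last first.
  have pN : (p.+1 < N)%N by rewrite -sz size_cat /=; lia.
  rewrite /transp; do !(case: eqP => [?|_]; first by lia).
  by rewrite !(X_out _ mN) scaler0 /= addr0.
have r := @rep_TX _ _ _ _ _ _ _ _ _ HM p m (pi ++ [:: i, j & nu]) i j (introT eqP hn)
  (onth_cat0 _ _ _) _ mN.
rewrite -addn1 onth_catS addn1 in r.
rewrite !scalerA (rel_act (r erefl v) h); congr (_ + _).
case: (_ && _); first by rewrite scaleNr h.
by case: (_ && _); rewrite ?h // scale0r.
Qed.

Lemma tauX_neq i j nu v m : wv (pi ++ [:: i, j & nu]) v -> i != j ->
  tau p *: (X m *: v) = X (transp p m) *: (tau p *: v).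
Proof. by move=> h ij; rewrite (tauX_gen m h) (negbTE ij) !andbF addr0. Qed.

Lemma braid_spec i j l nu v : wv (pi ++ [:: i, j, l & nu]) v -> exists2 q,
  tau p.+1 *: (tau p *: (tau p.+1 *: v)) =
  tau p *: (tau p.+1 *: (tau p *: v)) + (if i == l then q *: v else 0) &
      [/\ i = j -> q = 0, i != j -> cartan i j = 0 -> q = 0 &
        i != j -> cartan i j != 0 -> exists2 c, c != 0 &
          q = sc c * (if cartan i j == -1 then 1 else X p + X p.+2)].
Proof.
move=> h; have [hn|/(wv_out h) v0] := eqVneq (seq_content (pi ++ [:: i, j, l & nu])) beta.
  have o1 : onth (pi ++ [:: i, j, l & nu]) p.+1 = Some j by rewrite -addn1 onth_catS.
  have o2 : onth (pi ++ [:: i, j, l & nu]) p.+2 = Some l by rewrite -addn2 onth_catS.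
  have [q qE hq] := rep_TTT HM (introT eqP hn) (onth_cat0 _ _ _) o1 o2.
  exists q => //; rewrite !scalerA (rel_act (qE v) h); congr (_ + _).
  by case: (_ == _); rewrite -?scalerA ?h // scale0r.
have e0 q : tau p.+1 *: (tau p *: (tau p.+1 *: v)) =
  tau p *: (tau p.+1 *: (tau p *: v)) + (if i == l then q *: v else 0).
  by rewrite v0 !scaler0 if_same addr0.
have [ij|ij] := eqVneq i j; first by exists 0; [apply: e0 | split=> //; rewrite ij eqxx].
have [c0|c0] := eqVneq (cartan i j) 0; first by exists 0; [apply: e0 | split=> //; rewrite c0 eqxx].
exists (sc 1 * (if cartan i j == -1 then 1 else X p + X p.+2)); first exact: e0.
by split; [move/eqP; rewrite (negbTE ij) | move=> _ /eqP; rewrite (negbTE c0) | exists 1; rewrite ?oner_eq0].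
Qed.

Lemma braid i j l nu v : wv (pi ++ [:: i, j, l & nu]) v -> i != l ->
  tau p.+1 *: (tau p *: (tau p.+1 *: v)) = tau p *: (tau p.+1 *: (tau p *: v)).
Proof. by case/braid_spec => q -> _ /negbTE ->; rewrite addr0. Qed.

End Local.

Lemma split_at (q : nat) nu : (q.+1 < size nu)%N ->
  exists i j nu', nu = take q nu ++ [:: i, j & nu'].
Proof.
move=> h; case e: (drop q nu) => [|i [|j nu']].
- by have := size_drop q nu; rewrite e /=; lia.
- by have := size_drop q nu; rewrite e /=; lia.
- by exists i, j, nu'; rewrite -e cat_take_drop.
Qed.

Lemma tauX q m v : m != q -> m != q.+1 -> tau q *: (X m *: v) = X m *: (tau q *: v).
Proof.
move=> m1 m2; rewrite !scalerA; move: v; apply: wv_ext => nu v h; rewrite -!scalerA.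
have [->|v0] := eqVneq v 0; first by rewrite !scaler0.
have [qN|/tau_out h'] := ltnP q.+1 N; last by rewrite !h' scaler0.
have sz := wv_size h v0; rewrite -sz in qN.
have [i [j [nu' e]]] := split_at qN.
have sq : size (take q nu) = q by rewrite size_takel //; lia.
rewrite e in h; have := tauX_gen m h.
by rewrite sq (negbTE m1) (negbTE m2) /= addr0 /transp (negbTE m1) (negbTE m2).
Qed.

End KLRModules.

Section KLRFree.
Variables (k : fieldType) (n : nat).
Variables (t : 'I_n -> 'I_n -> nat -> nat -> k) (t_ok : klr_datum t).
Variable beta : Qplus n.
Local Notation F := (free_alg k (klr_gen n)).
Local Notation E := (@eF k n).
Local Notation X := (xF k n).
Local Notation tau := (tauF k n).
Implicit Types (i j : 'I_n) (nu mu pi : seq 'I_n).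

Definition klr_mod (M : lmodType F) : Prop :=
  forall r, klr_rel t beta r -> forall v : M, r *: v = 0.

Definition cyc_mod (M : lmodType F) : Prop := klr_mod M /\
  forall nu i, in_Ibeta beta nu -> onth nu (height beta).-1 = Some i ->
  forall v : M, X (height beta).-1 ^+ `|Lambda1 n i|%N *: (E nu *: v) = 0.

Lemma klr_pi_eq0 (M : lmodType F) : klr_mod M ->
  forall f, klr_pi t beta f = 0 -> forall v : M, f *: v = 0.
Proof.
move=> HM f /piz_eq; rewrite subr0 => h.
elim: h => {f} [r|| x y _ hx _ hy|a x _ hx|a x _ hx] v; first exact: HM.
- by rewrite scale0r.
- by rewrite scalerDl hx hy addr0.
- by rewrite -scalerA hx scaler0.
- by rewrite -scalerA hx.
Qed.

Lemma klr_pi_rel r : klr_rel t beta r -> klr_pi t beta r = 0.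
Proof. by move=> h; apply/piz_eq; rewrite subr0; apply: IdealIn. Qed.

Lemma klr_piM f g : klr_pi t beta (f * g) = klr_pi t beta f * klr_pi t beta g.
Proof. exact: pirM. Qed.

Lemma klr_piD f g : klr_pi t beta (f + g) = klr_pi t beta f + klr_pi t beta g.
Proof. exact: pirD. Qed.

Lemma is_cyclo_modP (M : lmodType F) : is_cyclo_mod t (Lambda1 n) beta M <-> cyc_mod M.
Proof.
split=> [h|[HM hx]].
  have hk r v : klr_pi t beta r = 0 -> r *: (v : M) = 0.
    move=> kr; apply: h; rewrite /cyclo_pi kr; apply/piz_eq; rewrite subrr; exact: Ideal0.
  split; first by move=> r /klr_pi_rel /hk.
  move=> nu i nub hi v; rewrite scalerA; apply: h.
  by apply/piz_eq; rewrite subr0; apply/IdealIn/CycloRel.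
move=> f /piz_eq; rewrite subr0 => h.
(* The induction runs over an ideal of the quotient R(beta), so the claim is stated for every lift
   of [y] to the free algebra. *)
suff H (y : klr t beta) : ideal_gen (@cyclo_rel k n t beta (Lambda1 n)) y ->
    forall g, y = klr_pi t beta g -> forall v : M, g *: v = 0.
  by move=> v; apply: (H _ h).
have sur (y' : klr t beta) : exists g, y' = klr_pi t beta g.
  by exists (reprz y'); rewrite /klr_pi reprrK.
have dif g1 g2 (v : M) : klr_pi t beta g1 = klr_pi t beta g2 -> g1 *: v = g2 *: v.
  move=> /piz_eq e; apply/eqP; rewrite -subr_eq0 -scalerBl; apply/eqP.
  by apply: (klr_pi_eq0 HM); apply/piz_eq; rewrite subr0.
elim=> {y h} [_ [nu i nub hi]|| x y _ hx' _ hy|a x _ hx'|a x _ hx'] g.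
- by move/esym=> e v; rewrite (dif _ _ _ e) -scalerA; apply: hx hi _.
- move=> e v; rewrite (dif g 0) ?scale0r // -e; exact/esym/klr_pi_eq0.
- have [f1 e1] := sur x; have [f2 e2] := sur y.
  move=> e v; rewrite (dif g (f1 + f2)) ?klr_piD -?e1 -?e2 //.
  by rewrite scalerDl (hx' _ e1) (hy _ e2) addr0.
- have [f1 e1] := sur x; have [f2 e2] := sur a.
  move=> e v; rewrite (dif g (f2 * f1)) ?klr_piM -?e1 -?e2 //.
  by rewrite -scalerA (hx' _ e1) scaler0.
- have [f1 e1] := sur x; have [f2 e2] := sur a.
  move=> e v; rewrite (dif g (f1 * f2)) ?klr_piM -?e1 -?e2 //.
  by rewrite -scalerA (hx' _ e1).
Qed.

Lemma free_scale_generic (L : lalgType k) (c c' : k) (u v : L) :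
  c *: u + c' *: v = c%:A * u + c'%:A * v.
Proof. by rewrite !mulr_algl. Qed.

Lemma free_scale1_generic (L : lalgType k) (c : k) (u : L) : c *: u = c%:A * u.
Proof. by rewrite mulr_algl. Qed.

Lemma KlrT2_q l nu i j : in_Ibeta beta nu -> onth nu l = Some i -> onth nu l.+1 = Some j ->
  forall M, klr_mod M -> forall v : M,
  (tau l ^+ 2 * E nu - Qval t i j (X l) (X l.+1) * E nu) *: v = 0.
Proof. by move=> h1 h2 h3 M HM v; apply: HM; apply: KlrT2. Qed.

Lemma Qdiff_orth i j (u v w : F) : i != j -> cartan i j = 0 -> Qdiff t i j u v w = 0.
Proof.
move=> ij c0; have r0 : root_form i j = 0 by apply/eqP; rewrite root_form_eq0 c0.
rewrite /Qdiff (negbTE ij) /Qbound r0 absz0 big_ord1 big1 // => q _.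
by rewrite big_ord0 mul0r scaler0.
Qed.

Lemma klr_mod_rep (M : lmodType F) : klr_mod M ->
  klr_rep beta E X tau (fun c : k => c%:A : F) M.
Proof.
move=> HM; split.
- by move=> c a v; rewrite scale_algC.
- exact: scale1r.
- by move=> c d; apply: scalerDl.
- by move=> c d; rewrite mulr_algl scalerA.
- by move=> nu h; apply: HM; apply: KlrE_out.
- by move=> l h; apply: HM; apply: KlrX_out.
- by move=> m h; apply: HM; apply: KlrT_out.
- by move=> nu nu' h h'; apply: HM; apply: KlrEE.
- by apply: HM; apply: KlrE1.
- by move=> l m h h'; apply: HM; apply: KlrXX.
- by move=> l nu h h'; apply: HM; apply: KlrXE.
- by move=> m nu h h'; apply: HM; apply: KlrTE.
- by move=> l m h h' h''; apply: HM; apply: KlrTT.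
- move=> l nu i j h h1 h2; exists (Qval t i j (X l) (X l.+1)).
    by apply: KlrT2_q.
  split=> [e|ij c0|ij cij]; first by rewrite /Qval e eqxx.
    exact: Qval_orth.
  have [c [c' [q [c0 q0 e _]]]] := Qval_adj t_ok (X l) (X l.+1) ij cij.
  exists c, c', q; split=> //; rewrite e; exact: free_scale_generic.
- by move=> l m nu i j h h1 h2 h3; apply: HM; apply: KlrTX.
- move=> l nu i j i' h h1 h2 h3; exists (Qdiff t i j (X l) (X l.+1) (X l.+2)).
    by apply: HM; apply: KlrTTT.
  split=> [e|ij c0|ij cij]; first by rewrite /Qdiff e eqxx.
    exact: Qdiff_orth.
  have [c [c' [q [c0 q0 _ e]]]] := Qval_adj t_ok (X l) (X l.+1) ij cij.
  by exists c => //; rewrite e; exact: free_scale1_generic.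
Qed.

End KLRFree.

(** * Vanishing in cyclotomic modules *)

Section CycloModules.
Variables (k : fieldType) (n : nat) (beta : Qplus n) (A : pzRingType).
Variables (E : seq 'I_n -> A) (X tau : nat -> A) (sc : k -> A).
Variables (M : lmodType A) (HM : klr_rep beta E X tau sc M).
Implicit Types (i j : 'I_n) (nu mu pi : seq 'I_n).
Implicit Types u v : M.
Local Notation N := (height beta).

Lemma rep_scale_eq0 c v : c != 0 -> sc c *: v = 0 -> v = 0.
Proof.
move=> c0 h; rewrite -[v]scale1r -(rep_sc1 HM) -(mulVf c0) (rep_scM HM).
by rewrite -scalerA h scaler0.
Qed.

Lemma wv_tau_at pi i j nu v : wv E (pi ++ [:: i, j & nu]) v ->
  wv E (pi ++ [:: j, i & nu]) (tau (size pi) *: v).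
Proof. by rewrite -(swap_adj_cat0 pi i j nu); apply: (wv_tau HM). Qed.

(** In the quadratic relation tau v = 0 removes the left-hand side and x_(p+1) v = 0 the second term
    of Q; the power of x_p remains, with a unit as coefficient. *)
Lemma tau2_adj pi i j nu v : wv E (pi ++ [:: i, j & nu]) v -> i != j ->
  cartan i j != 0 -> X (size pi).+1 *: v = 0 -> tau (size pi) *: v = 0 ->
  X (size pi) ^+ `|cartan i j|%N *: v = 0.
Proof.
move=> h ij cij xv tv; have [q e [_ _ /(_ ij cij) [c [c' [a [c0 a0 qE]]]]]] := tau2_spec HM h.
move: e; rewrite tv scaler0 qE scalerDl -!scalerA; case: a a0 {qE} => // a _.
rewrite exprSr -[_ *: v in X in _ + X]scalerA xv !scaler0 addr0 => /esym.
exact: rep_scale_eq0.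
Qed.

(** At orthogonal letters tau squares to 1, so [v] is recovered by some tau from the vector in which
    [i] has moved left past [nu1]. [P] only has to survive these tau. *)
Lemma move_front pi nu1 i nu2 (P : M -> Prop) :
  all (fun j => cartan i j == 0) nu1 ->
  (forall q u, (size pi <= q)%N -> P u -> P (tau q *: u)) ->
  (forall u, wv E (pi ++ i :: nu1 ++ nu2) u -> P u) ->
  forall v, wv E (pi ++ nu1 ++ i :: nu2) v -> P v.
Proof.
elim/last_ind: nu1 nu2 => [|nu1 c IH] nu2 //.
rewrite all_rcons => /andP[/eqP cic call] Ptau PP v.
rewrite cat_rcons catA => h.
have ic : i != c by apply/eqP => e; move: cic; rewrite e cartan_diag.
have cci : cartan c i = 0 by apply/eqP; rewrite cartan_eq0C cic.
rewrite -(tau2_orth HM h) // 1?eq_sym //; apply: (Ptau _ _); first by rewrite size_cat leq_addr.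
apply: (IH (c :: nu2)) => //; last by rewrite catA; apply: wv_tau_at.
by move=> u hu; apply: PP; rewrite cat_rcons.
Qed.

(** The weight -1 provides a removable [i] in [nu], which is moved next to i j. At i j i both cubic
    terms of the braid relation vanish by induction, so the divided difference of Q kills the
    vector. *)
Lemma vanish_braid s pi i j nu v :
  (forall pi i nu v, size nu = s -> wv E (pi ++ i :: nu) v -> ~~ cpath nu -> v = 0) ->
  (forall pi i j j' nu v, (size nu).+2 = s -> wv E (pi ++ [:: i, j, j' & nu]) v ->
     X (size pi).+2 *: v = 0) ->
  (size nu).+1 = s -> i != j -> cartan i j != 0 -> cpath (j :: nu) ->
  wtw nu i = -1 -> wv E (pi ++ [:: i, j & nu]) v ->
  if cartan i j == -1 then v = 0 else X (size pi) *: v = 0.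
Proof.
move=> IHp IHx2 sz ij cij pj wi.
have pn : cpath nu by case/andP: pj.
have [nu1 [nu2 [e call]]] := cpath_removable pn wi.
pose P u := if cartan i j == -1 then u = 0 else X (size pi) *: u = 0.
rewrite e -[pi ++ _]/(pi ++ ([:: i; j] ++ nu1 ++ i :: nu2)) catA.
move: v; apply: (move_front (P := P)) => //.
  rewrite size_cat /= addn2 /P => q u qs; case: ifP => _ h; first by rewrite h scaler0.
  by rewrite -(tauX HM) ?h ?scaler0 //; lia.
move: e sz => -> {nu pj wi pn}; rewrite size_cat /= => sz u.
set nu3 := nu1 ++ nu2; rewrite -catA /= => hu.
have s3 : (size nu3).+2 = s by rewrite size_cat; lia.
suff Pz : u = 0 \/ P u by case: Pz => // ->; rewrite /P scaler0; case: ifP.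
have [pji|npji] := boolP (cpath [:: j, i & nu3]); last first.
  by left; apply: (IHp pi i [:: j, i & nu3]) => //.
right; case/andP: (pji) => /andP[p3 /eqP wi3] _.
(* The new word is i i j [nu3]. If i j [nu3] were a crystal word, the adjacent letters i and j would
   both be addable to [nu3]. *)
have z1 : tau (size pi).+1 *: u = 0.
  apply: (IHp pi i [:: i, j & nu3]) => //=.
    by rewrite -cat_rcons -(size_rcons pi i); apply: wv_tau_at; rewrite cat_rcons.
  apply/negP => /andP[/andP[_ /eqP wj3] _].
  by move: cij; rewrite (addable_cartan p3 wi3 wj3).
(* The new word is j i i [nu3], and a crystal word has no repeated neighbours. *)
have z2 : tau (size pi) *: u = 0.
  apply: (IHp pi j [:: i, i & nu3]) => //; first exact: wv_tau_at.
  by apply/negP => /cpath_neq; rewrite eqxx.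
have [q e [_ _ /(_ ij cij) [c c0 qE]]] := braid_spec HM hu.
move: e; rewrite qE z1 z2 !scaler0 eqxx add0r -scalerA /P => /esym/(rep_scale_eq0 c0).
case: ifP => _; first by rewrite scale1r.
by rewrite scalerDl (IHx2 _ _ _ _ _ _ s3 hu) addr0.
Qed.

Hypothesis HC : forall nu i, in_Ibeta beta nu -> onth nu N.-1 = Some i ->
  forall v, X N.-1 ^+ `|Lambda1 n i|%N *: (E nu *: v) = 0.

(** The two claims support each other: exchanges move a letter into a shorter suffix, where both are
    known. The prefix [pi] is arbitrary, so that the induction can shift letters into it. *)
Lemma vanish s pi nu v : size nu = s -> wv E (pi ++ nu) v ->
  (forall q, (q < size nu)%N -> X (size pi + q) *: v = 0) /\ (~~ cpath nu -> v = 0).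
Proof.
elim: s pi nu v => [|s IH] pi nu v; first by case: nu.
case: nu => //= i nu [sz] h.
have IHp pi' i' nu' v' : size nu' = s -> wv E (pi' ++ i' :: nu') v' -> ~~ cpath nu' -> v' = 0.
  by move=> s' h'; apply: (IH (rcons pi' i') nu' v' s' _).2; rewrite cat_rcons.
have IHx pi' i' nu' v' q : size nu' = s -> wv E (pi' ++ i' :: nu') v' -> (q < size nu')%N ->
    X (size pi' + q.+1) *: v' = 0.
  move=> s' h' qs; have := (IH (rcons pi' i') nu' v' s' _).1 q qs.
  by rewrite size_rcons addSnnS; apply; rewrite cat_rcons.
suff [x0 w0] : X (size pi) *: v = 0 /\ (wtw nu i != 1 -> v = 0).
  split=> [[|q] qs|]; first by rewrite addn0.
    exact: IHx h _.
  by rewrite negb_and => /orP[/(IHp _ _ _ _ sz h)|].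
have [pn|/(IHp _ _ _ _ sz h) ->] := boolP (cpath nu); last by rewrite scaler0.
case: nu sz h pn => [|j nu] sz h pn.
  have [hc|/(wv_out HM h) ->] := eqVneq (seq_content (pi ++ [:: i])) beta; last first.
    by rewrite scaler0.
  have sN : N.-1 = size pi by rewrite -(size_in_Ibeta (introT eqP hc)) size_cat addn1.
  (* The cyclotomic exponent is 1 at the short node, where it kills x v, and 0 at the other nodes,
     where it kills v itself. *)
  have := HC (introT eqP hc); rewrite sN => /(_ i (onth_cat0 _ _ _) v).
  rewrite h /= !ffunE; case: eqP => i0 /=; first by rewrite expr1 => ->; split=> //; rewrite eqxx.
  by rewrite expr0 scale1r => ->; rewrite scaler0.
have pn' : cpath nu by case/andP: pn.
have wj : wtw nu j = 1 by case/andP: pn => _ /eqP.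
have xj : X (size pi).+1 *: v = 0 by rewrite -addn1; apply: IHx h _.
have ht := wv_tau_at h.
have [eij|ij] := eqVneq i j.
  move: h ht xj; rewrite -eij => h ht xj.
  (* By induction x_(p+1) tau v = 0, so tau x_p v = -v; another tau gives tau v = 0, as tau squares
     to 0 at equal letters. Then tau x_(p+1) v = x_p tau v + v forces v = 0. *)
  have tv : tau (size pi) *: v = 0.
    have := tauX_gen HM (size pi) h; rewrite !eqxx /= /transp eqxx.
    have -> : X (size pi).+1 *: (tau (size pi) *: v) = 0.
      by rewrite -addn1; apply: (IHx pi i (i :: nu)); rewrite // -sz eij.
    rewrite add0r => /(congr1 (fun z => tau (size pi) *: z)).
    by rewrite (tau2_eq HM (wv_X HM _ h)) scalerN => /esym/eqP; rewrite oppr_eq0 => /eqP.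
  have := tauX_gen HM (size pi).+1 h.
  rewrite xj tv !scaler0 add0r !eqxx /= andbT; case: eqP => [e|_]; first by lia.
  by rewrite /= => <-; rewrite scaler0.
have sz' : size (i :: nu) = s by rewrite -sz.
have ji : j != i by rewrite eq_sym.
have [cij|cij] := eqVneq (cartan i j) 0.
  have wi : wtw (j :: nu) i = wtw nu i by rewrite wtwS cij subr0.
  (* For orthogonal letters v = tau (tau v), and tau v has the weight j i [nu], where the induction
     hypothesis applies to i [nu]. *)
  rewrite -(tau2_orth HM h ij cij) wi; split.
    rewrite -[X _ *: _](_ : tau (size pi) *: (X (size pi).+1 *: (tau (size pi) *: v)) = _).
      by rewrite -addn1 (IHx pi j (i :: nu)) ?scaler0.
    rewrite (tauX_neq HM _ ht ji) /transp eqxx.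
    by case: eqP => // e; lia.
  move=> wn; have tv : tau (size pi) *: v = 0; last by rewrite tv scaler0.
  by apply: (IHp pi j (i :: nu)) => //; rewrite /= negb_and wn orbT.
have wi1 : wtw nu i != 1.
  by apply/eqP => wi; move: cij; rewrite (addable_cartan pn' wi wj ij).
(* The weight of tau v contains the suffix i [nu]; [i] is not addable to [nu], because the adjacent
   letter [j] is. *)
have tv : tau (size pi) *: v = 0.
  by apply: (IHp pi j (i :: nu)) => //; rewrite /= negb_and wi1 orbT.
have xc := tau2_adj h ij cij xj tv.
have vb : wtw nu i = -1 -> if cartan i j == -1 then v = 0 else X (size pi) *: v = 0.
  move=> wm; apply: (vanish_braid (s := s) IHp _ _ ij cij pn wm h) => //.
    move=> pi' i' j' j'' nu' v' s' h'; rewrite -addn2.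
    by apply: (IHx pi' i' [:: j', j'' & nu'] v' 1%N) => //=; lia.
have bnd := cpath_bound i pn'; have := cartan_le0 ij.
rewrite wtwS => cle.
(* If a_ij = -1, the pairing of j [nu] with h_i is one more than that of [nu], which is 0 or -1. It
   differs from 1 only for -1, the case of the braid relation. *)
have [c1|c1] := eqVneq (cartan i j) (-1).
  move: xc vb; rewrite c1 expr1 eqxx => xv vb; split=> // w1; apply: vb; lia.
have c2 : cartan i j = -2 /\ val i = 0%N.
  by case: (adjacentP ij cij) => -[? ? c]; split=> //; move: c1; rewrite c.
(* [i] is the short node, so the pairing is neither 0 nor 1. It is -1, and -1 + 2 = 1 makes [i]
   addable to j [nu]; there remains x_p v = 0, which the braid relation gives. *)
case: c2 => c2 i0; have wm : wtw nu i = -1.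
  by have := cpath_neq0 pn' i0; lia.
split; first by have := vb wm; rewrite (negbTE c1).
by rewrite wm c2.
Qed.

End CycloModules.

Section Words.
Variable n : nat.
Implicit Types (nu mu : seq 'I_n).

Lemma swap_adj_catl m nu mu : (m.+1 < size nu)%N ->
  swap_adj m (nu ++ mu) = swap_adj m nu ++ mu.
Proof.
elim: m nu => [|m IH] [|a nu] //=; first by case: nu.
by rewrite ltnS => h; rewrite IH.
Qed.

Lemma swap_adj_rcons nu (a b : 'I_n) mu :
  swap_adj (size nu) (rcons nu a ++ b :: mu) = nu ++ [:: b, a & mu].
Proof. by rewrite cat_rcons swap_adj_cat0. Qed.

Lemma swap_adj_catr m nu mu : (size nu <= m)%N ->
  swap_adj m (nu ++ mu) = nu ++ swap_adj (m - size nu) mu.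
Proof. by move=> h; rewrite -[in LHS](subnKC h) swap_adj_cat. Qed.

Lemma rem_index_cat (i : 'I_n) nu mu : i \notin nu ->
  index i (nu ++ i :: mu) = size nu /\ rem i (nu ++ i :: mu) = nu ++ mu.
Proof.
elim: nu => [|j nu IH] /=; first by rewrite eqxx.
rewrite inE negb_or eq_sym => /andP[/negbTE -> /IH [-> ->]].
by [].
Qed.

Lemma cpath_cons i nu : cpath (i :: nu) = cpath nu && (wtw nu i == 1).
Proof. by []. Qed.

Inductive wconn nu : seq 'I_n -> Prop :=
| WRefl : wconn nu nu
| WStep mu m of wconn nu mu & (m.+1 < size mu)%N & cpath (swap_adj m mu) :
    wconn nu (swap_adj m mu).

Lemma wconn_trans nu mu pi : wconn nu mu -> wconn mu pi -> wconn nu pi.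
Proof. by move=> h; elim=> // mu' m _ h' ms p; apply: WStep. Qed.

Lemma wconn_perm nu mu : wconn nu mu -> perm_eq mu nu.
Proof. by elim=> // mu' m _ IH _ _; apply: perm_trans IH; apply: perm_swap_adj. Qed.

Lemma wconn_cpath nu mu : cpath nu -> wconn nu mu -> cpath mu.
Proof. by move=> p; case. Qed.

Lemma wconn_cons i nu mu : cpath (i :: nu) -> wconn nu mu -> wconn (i :: nu) (i :: mu).
Proof.
move=> /andP[pn wi]; elim=> [|mu' m h IH ms p]; first exact: WRefl.
have -> : i :: swap_adj m mu' = swap_adj m.+1 (i :: mu') by case: (mu').
apply: WStep => //; rewrite (_ : swap_adj _ _ = i :: swap_adj m mu'); last by case: (mu').
rewrite cpath_cons p (wtw_perm (perm_swap_adj _ _)) (wtw_perm (wconn_perm h)).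
exact: wi.
Qed.

Lemma cpath_swap (a b : seq 'I_n) c i : cartan i c = 0 -> cpath (a ++ [:: c, i & b]) ->
  cpath (a ++ [:: i, c & b]).
Proof.
move=> ic; have ci : cartan c i = 0 by apply/eqP; rewrite cartan_eq0C ic.
elim: a => [|j a IH].
  rewrite !cat0s !cpath_cons => /andP[/andP[pb /eqP wi] /eqP wc]; rewrite pb /=.
  rewrite (_ : wtw b c = 1) ?eqxx; last by rewrite -wc wtwS ci subr0.
  by rewrite wtwS wi ic subr0.
rewrite !cat_cons !cpath_cons => /andP[/IH -> wj]; rewrite (_ : wtw (a ++ [:: i, c & b]) = wtw (a ++ [:: c, i & b])) //.
by apply: wtw_perm; rewrite perm_cat2l -[[:: i, c & b]]cat1s -[c :: b]cat1s perm_catCA.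
Qed.

Lemma wconn_move i nu mu : all (fun j => cartan i j == 0) nu -> cpath (nu ++ i :: mu) ->
  wconn (i :: nu ++ mu) (nu ++ i :: mu).
Proof.
elim/last_ind: nu mu => [|nu c IH] mu; first by move=> *; apply: WRefl.
rewrite all_rcons => /andP[/eqP ic h]; rewrite !cat_rcons => p.
rewrite -swap_adj_cat0; apply: WStep; first by apply: IH => //; apply: cpath_swap.
  by rewrite size_cat /= !addnS; lia.
by rewrite swap_adj_cat0.
Qed.

(** The head of [nu] has weight -1 in [mu], hence is removable there and can be brought to the front
    by exchanges of orthogonal letters; the tails are connected by induction. *)
Lemma cpath_wconn nu mu : cpath nu -> cpath mu -> perm_eq nu mu -> wconn nu mu.
Proof.
elim: nu mu => [|i nu IH] mu pn pm nm.
  have /perm_nilP -> : perm_eq mu [::] by rewrite perm_sym.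
    exact: WRefl.
have [pn' w1] : cpath nu /\ wtw nu i = 1 by case/andP: pn => ? /eqP.
have wi : wtw mu i = -1 by rewrite -(wtw_perm nm) wtwS w1 cartan_diag.
have [mu1 [mu2 [e h1]]] := cpath_removable pm wi; rewrite e in pm nm *.
have [p12 _] := cpath_commute h1 pm.
apply: wconn_trans (wconn_move h1 pm); apply: wconn_cons => //; apply: IH => //.
by move: nm; rewrite -[i :: mu2]cat1s perm_sym perm_catCA perm_sym perm_cons.
Qed.

End Words.

(** * Transport along exchanges of commuting letters *)

Section Holonomy.
Variables (k : fieldType) (n : nat) (beta : Qplus n) (A : pzRingType).
Variables (E : seq 'I_n -> A) (X tau : nat -> A) (sc : k -> A).
Variables (M : lmodType A) (HM : klr_rep beta E X tau sc M).
Implicit Types (i j : 'I_n) (nu mu pi : seq 'I_n).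
Implicit Types u v : M.
Local Notation wv := (wv E).

Section Chain.
Variables (pi : seq 'I_n) (i : 'I_n).
Local Notation p := (size pi).

(** Carries the letter [i] at position p to the right past [q] letters. *)
Fixpoint chain q u := if q is q'.+1 then tau (p + q') *: chain q' u else u.

Lemma wv_chain mu1 mu2 u : wv (pi ++ i :: mu1 ++ mu2) u ->
  wv (pi ++ mu1 ++ i :: mu2) (chain (size mu1) u).
Proof.
elim/last_ind: mu1 mu2 => [//|mu1 c IH] mu2; rewrite cat_rcons => /(IH (c :: mu2)).
by rewrite size_rcons cat_rcons /= !catA -size_cat; apply: (wv_tau_at HM).
Qed.

Lemma chain_far q m u : (q < m)%N ->
  tau (p + m) *: chain q u = chain q (tau (p + m) *: u).
Proof.
elim: q => //= q IH qm; rewrite (tau_far HM); last by lia.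
by rewrite IH //; lia.
Qed.

(** An exchange of two letters that [i] has passed slides through the chain, where they still sit
    one position further right. The braid relation has no correction term because its outer letters
    [i] and [b] differ. *)
Lemma chain_braid mu1 a b mu2 mu3 u : wv (pi ++ i :: (mu1 ++ [:: a, b & mu2]) ++ mu3) u ->
  i != b ->
  tau (p + size mu1) *: chain (size mu1 + (size mu2).+2) u =
  chain (size mu1 + (size mu2).+2) (tau (p + (size mu1).+1) *: u).
Proof.
move=> h ib; set m := size mu1.
have : tau (p + m) *: chain (m.+2) u = chain m.+2 (tau (p + m.+1) *: u).
  rewrite /= -chain_far // addnS.
  rewrite -catA /= in h; have := wv_chain h; rewrite catA => h'.
  by have := braid HM h' ib; rewrite size_cat -/m => ->.
rewrite !addnS -!addSn; elim: (size mu2) => [|r IH] hm; first by rewrite !addn0.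
rewrite !addnS /= (tau_far HM); last by lia.
by rewrite IH.
Qed.

End Chain.

(* All ways of moving from [nu0] to [mu] by admissible swaps have the same
   effect on a vector of weight [nu0]. *)
Lemma weight_transport pi nu0 v : cpath nu0 -> wv (pi ++ nu0) v ->
  exists G : seq 'I_n -> M, [/\ G nu0 = v,
    forall mu, perm_eq mu nu0 -> wv (pi ++ mu) (G mu) &
    forall mu m, perm_eq mu nu0 -> cpath mu -> (m.+1 < size mu)%N ->
      tau (size pi + m) *: G mu = G (swap_adj m mu)].
Proof.
elim: nu0 pi v => [|i nu0 IH] pi v p0 h.
  by exists (fun=> v); split=> [//|mu|mu m /perm_size] /=; [move/perm_nilP => -> | case: mu].
have [p0' w0] : cpath nu0 /\ wtw nu0 i = 1 by case/andP: p0 => ? /eqP.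
rewrite -cat_rcons in h; have [G' [Gv Gw Gt]] := IH _ _ p0' h.
(* First the other letters are arranged behind [i], then [i] is carried to the place of its first
   occurrence in [mu]. *)
pose G mu := chain pi (index i mu) (G' (rem i mu)).
have GE mu1 mu2 : i \notin mu1 -> G (mu1 ++ i :: mu2) = chain pi (size mu1) (G' (mu1 ++ mu2)).
  by rewrite /G => /rem_index_cat -/(_ mu2) [-> ->].
have pcat mu1 mu2 : perm_eq (mu1 ++ i :: mu2) (i :: nu0) = perm_eq (mu1 ++ mu2) nu0.
  by rewrite -cat1s perm_catCA perm_cons.
have Gw' mu1 mu2 : perm_eq (mu1 ++ mu2) nu0 -> wv (pi ++ i :: mu1 ++ mu2) (G' (mu1 ++ mu2)).
  by move=> /Gw; rewrite cat_rcons.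
exists G; split.
- by rewrite (GE [::]).
- move=> mu pm; have imu : i \in mu by rewrite (perm_mem pm) mem_head.
  have [mu1 [mu2 [e i1]]] : exists mu1 mu2, mu = mu1 ++ i :: mu2 /\ i \notin mu1.
    move: imu; rewrite -has_pred1 => /split_find [a mu1 mu2 /eqP -> h1].
    by exists mu1, mu2; rewrite cat_rcons -has_pred1.
  by move: pm; rewrite e pcat GE // => pm; apply/wv_chain/Gw'.
move=> mu m pm pmu ms.
have wi : wtw mu i = -1.
  by rewrite (wtw_perm pm) wtwS w0 cartan_diag.
have [mu1 [mu2 [e h1]]] := cpath_removable pmu wi.
(* So the removable occurrence is the first one, the one that [G] carries. *)
have i1 : i \notin mu1.
  by apply/negP => /(allP h1); rewrite cartan_diag.
have [p12 _] := cpath_commute h1 (eq_rect _ (fun s => is_true (cpath s)) pmu _ e).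
rewrite e in pm pmu ms *; rewrite pcat in pm; rewrite GE //.
have hw := Gw' _ _ pm.
have Gt' m' : (m'.+1 < size (mu1 ++ mu2))%N ->
    tau (size pi + m'.+1) *: G' (mu1 ++ mu2) = G' (swap_adj m' (mu1 ++ mu2)).
  by move=> hm; rewrite -Gt // size_rcons addnS.
(* The exchange concerns letters before [i], letters after [i], or [i] and its right neighbour; the
   last case lengthens the chain by one. *)
have [mq|qm|mq] := ltngtP m (size mu1).
- have [m1|m1] := ltnP m.+1 (size mu1); last first.
    case/lastP: mu1 h1 i1 {e p12 ms Gt'} pmu pm hw mq m1 => // mu1 c.
    rewrite all_rcons mem_rcons inE negb_or size_rcons => /andP[/eqP ic h1] /andP[nic i1].
    move=> pmu pm hw mq m1; have -> : m = size mu1 by lia.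
    rewrite swap_adj_rcons GE // cat_rcons /=.
    (* Exchanging [i] with its left neighbour undoes the last tau of the chain. *)
    have h' : wv ((pi ++ mu1) ++ [:: i, c & mu2]) (chain pi (size mu1) (G' (mu1 ++ c :: mu2))).
      by rewrite -catA; apply: wv_chain; move: hw; rewrite cat_rcons.
    by rewrite -size_cat (tau2_orth HM h').
  rewrite swap_adj_catl // GE; last by rewrite (perm_mem (perm_swap_adj _ _)).
  rewrite size_swap_adj -swap_adj_catl // -Gt'; last by rewrite size_cat; lia.
  have [a [b [mu1' e1]]] := split_at m1.
  have sm : size (take m mu1) = m by rewrite size_takel //; lia.
  have := @chain_braid pi i (take m mu1) a b mu1' mu2 (G' (mu1 ++ mu2)).
  have sz1 : size mu1 = (m + (size mu1').+2)%N by rewrite e1 size_cat sm.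
  rewrite -e1 sm sz1 => -> //; last first.
    by apply: contraNneq i1 => ->; rewrite e1 mem_cat !inE eqxx !orbT.
- rewrite swap_adj_catr; last by lia.
  case e2: (m - size mu1)%N => [|r]; first by lia.
  have -> : swap_adj r.+1 (i :: mu2) = i :: swap_adj r mu2 by case: (mu2).
  rewrite GE // chain_far //.
  have mE : m = (size mu1 + r).+1 by lia.
  rewrite mE Gt'; last by move: ms; rewrite !size_cat /= mE; lia.
  by rewrite swap_adj_cat.
- rewrite mq; case: mu2 e pmu pm p12 hw Gt' ms => [|b mu2] e pmu pm p12 hw Gt' ms.
    by move: ms; rewrite size_cat /=; lia.
  rewrite swap_adj_cat0 -[mu1 ++ [:: b, i & mu2]]cat_rcons GE; last first.
    by rewrite mem_rcons inE negb_or i1 (cpath_neq (cpath_cat pmu)).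
  by rewrite size_rcons cat_rcons.
Qed.

End Holonomy.

Lemma wtw_count n (nu : seq 'I_n) (i : 'I_n) :
  let c x := (count (fun a => val a == x) nu)%:Z in
  wtw nu i = if val i == 0%N then 1 - 2 * (c 0%N - c 1%N)
             else c (val i).-1 - 2 * c (val i) + c (val i).+1.
Proof.
elim: nu => [|j nu IH] /=; first by rewrite ffunE; case: ifP.
rewrite -/(wtw (j :: nu)) wtwS {}IH /cartan -val_eqE /=; set c := count^~ nu.
case: i j => [[|a] Ha] [[|[|b]] Hb] /=; rewrite ?eqxx; do ?case: ifP; rewrite /=; lia.
Qed.

Lemma count_residue n (nu : seq 'I_n) (i : 'I_n) :
  count (fun a => val a == val i) nu = count_mem i nu.
Proof. by apply: eq_count => a; rewrite /= val_eqE. Qed.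

Lemma count_out n (nu : seq 'I_n) x : (n <= x)%N -> count (fun a => val a == x) nu = 0%N.
Proof.
move=> h; rewrite (eq_count (a2 := pred0)) ?count_pred0 // => a /=.
by apply/negbTE; rewrite neq_ltn (leq_trans (ltn_ord a) h).
Qed.

(* The counts of the letters in a crystal word decrease by steps 0 or 1, which
   makes [wtw nu i = 1] a condition on two steps. *)
Lemma cpath_count n (nu : seq 'I_n) :
  let c x := count (fun a => val a == x) nu in
  cpath nu -> forall x, (c x.+1 <= c x <= (c x.+1).+1)%N.
Proof.
move=> c /cpath_sgn [e he].
have w (i : 'I_n) := wtw_count nu i; rewrite he /= in w.
have H x : (x < n)%N -> (c x)%:Z - (c x.+1)%:Z = (e x)%:Z.
  elim: x => [|x IH] xn.
    have := w (Ordinal xn); rewrite ffunE /= -/(c 0%N) -/(c 1%N) mulr2n; lia.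
  have := IH (ltnW xn); have := w (Ordinal xn); rewrite ffunE /= -/(c x) -/(c x.+1) -/(c x.+2); lia.
move=> x; have [xn|xn] := ltnP x n; first by have := H x xn; case: (e x); lia.
by rewrite /c !count_out // leqW.
Qed.

(** In terms of diagrams, a diagonal accepts a box when it is as long as the next diagonal and one
    shorter than the previous one. *)
Lemma cpath_step n (nu : seq 'I_n) (i : 'I_n) :
  let c x := count (fun a => val a == x) nu in
  cpath nu -> wtw nu i = 1 -> c (val i) = c (val i).+1 /\
    (forall x, val i = x.+1 -> c x = (c x.+1).+1).
Proof.
move=> c p; rewrite wtw_count -/c => wi; have h := cpath_count p.
have := h (val i); rewrite -/(c (val i)) -/(c (val i).+1); case: ifP wi => [/eqP i0|i0] wi hi.
  by rewrite i0 -/(c 0%N) -/(c 1%N) in wi hi *; split=> //; lia.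
have := h (val i).-1; have ip : (0 < val i)%N by rewrite lt0n i0.
rewrite prednK // => hi'; rewrite -!/(c _) in wi hi'.
split; first by lia.
by move=> x ix; move: wi hi hi'; rewrite ix /=; lia.
Qed.

(** * Standard tableaux as crystal words *)

Section Diagram.
Variables (n : nat) (lam : strict_part n).

(** The length of the diagonal of residue [x]: row r contains each residue below lambda_r once. *)
Definition dl x := count (fun p => x < p)%N lam.

Lemma lam_sorted : sorted gtn lam.
Proof. by case: lam => s /= /andP[]. Qed.

Lemma lam_bound p : p \in (lam : seq nat) -> (0 < p <= n)%N.
Proof. by case: lam => s /= /andP[_ /allP h] /h. Qed.

Lemma lam_uniq : uniq lam.
Proof.
by apply: sorted_uniq lam_sorted => [y x z /= h1 h2|x]; [apply: ltn_trans h1 | rewrite /= ltnn].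
Qed.

Lemma dlS x : dl x = (dl x.+1 + (x.+1 \in (lam : seq nat)))%N.
Proof.
rewrite -(count_uniq_mem _ lam_uniq) /dl.
by elim: (lam : seq nat) => //= p s ->; lia.
Qed.

Lemma dl_step x : (dl x.+1 <= dl x <= (dl x.+1).+1)%N.
Proof. by rewrite (dlS x); case: (_ \in _); lia. Qed.

Lemma dl_anti x y : (x <= y)%N -> (dl y <= dl x)%N.
Proof.
move=> xy; rewrite -(subnKC xy); elim: (y - x)%N => [|d IH]; first by rewrite addn0.
by rewrite addnS; apply: leq_trans IH; case/andP: (dl_step (x + d)).
Qed.

Lemma dl_n x : (n <= x)%N -> dl x = 0%N.
Proof.
move=> nx; rewrite /dl; apply/eqP; rewrite -leqn0 leqNgt -has_count; apply/negP.
by case/hasP => p /lam_bound; lia.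
Qed.

(** The parts are distinct and at most n, so at most d of them exceed n - d. Hence the column r + x
    is a legitimate index. *)
Lemma dl_bound x r : (r < dl x)%N -> (r + x < n)%N.
Proof.
have [nx|xn] := leqP n x; first by rewrite dl_n.
suff H d : (dl (n - d) <= d)%N by have := H (n - x)%N; rewrite subKn ?(ltnW xn) //; lia.
elim: d => [|d IH]; first by rewrite dl_n // subn0.
have [dn|nd] := ltnP d n; last by rewrite (_ : n - d.+1 = n - d)%N; [lia|lia].
by have := dl_step (n - d.+1); rewrite (_ : (n - d.+1).+1 = n - d)%N; lia.
Qed.

Lemma nth_dl r x : (x < nth 0 lam r)%N = (r < dl x)%N.
Proof.
rewrite /dl; have: all (fun p => 0 < p)%N lam by apply/allP => p /lam_bound/andP[].
move: lam_sorted; rewrite sorted_pairwise; last by move=> ? ? ? /= h1 h2; apply: ltn_trans h1.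
elim: (lam : seq nat) r => [|p s IH] r /=; first by rewrite nth_nil.
move=> /andP[/allP ps pw] /andP[p0 s0]; case: r => [|r] /=.
  have [xp|px] //= := ltnP x p; apply/esym/negbTE; rewrite -has_count.
  by apply/hasPn => q /ps /=; lia.
rewrite IH //; have [xp|px] //= := ltnP x p; rewrite add0n.
suff -> : count (fun q => x < q)%N s = 0%N by [].
by apply/eqP; rewrite -leqn0 leqNgt -has_count; apply/hasPn => q /ps /=; lia.
Qed.

Lemma box_le (b : box lam) : (row_of b <= col_of b)%N.
Proof. by case/andP: (valP b). Qed.

Lemma residueE (b : box lam) : val (residue b) = (col_of b - row_of b)%N.
Proof. by []. Qed.

Lemma box_dl (b : box lam) : (row_of b < dl (residue b))%N.
Proof.
rewrite -nth_dl residueE; case/andP: (valP b); rewrite /row_of /col_of.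
by move=> /= h1 h2; rewrite ltn_subLR // addnC.
Qed.

Lemma box_ex x r : (r < dl x)%N -> exists b : box lam, row_of b = r /\ val (residue b) = x.
Proof.
move=> h; have rx := dl_bound h; have rn : (r < n)%N by lia.
have hd : in_diagram lam (Ordinal rn, Ordinal rx).
  by rewrite /in_diagram /=; move: h; rewrite -nth_dl; lia.
by exists (exist (fun y => in_diagram lam y) (Ordinal rn, Ordinal rx) hd); rewrite residueE /row_of /col_of /=; split=> //; lia.
Qed.

Lemma box_inj (b c : box lam) : row_of b = row_of c -> residue b = residue c -> b = c.
Proof.
move=> h1 /(congr1 val); rewrite !residueE => h2.
have := box_le b; have := box_le c => h3 h4.
have {h2 h3 h4} : col_of b = col_of c by lia.
case: b c h1 => -[r1 c1] i1 [[r2 c2] i2]; rewrite /row_of /col_of /= => e1 e2.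
by apply: val_inj => /=; congr pair; apply: val_inj.
Qed.

Lemma card_diag (i : 'I_n) : #|[pred b : box lam | residue b == i]| = dl i.
Proof.
have ex (r : 'I_(dl i)) : exists b : box lam, row_of b = r /\ val (residue b) = i.
  exact: box_ex.
have [f fE] := choice ex.
have fi : injective f.
  by move=> r s e; apply: val_inj; rewrite /= -(fE r).1 -(fE s).1 e.
rewrite -[RHS]card_ord -(card_codom fi); apply: eq_card => b; rewrite !inE.
apply/eqP/codomP => [bi|[r ->]]; last by apply: val_inj; apply: (fE r).2.
have h := box_dl b; rewrite bi in h; exists (Ordinal h); apply: box_inj.
  by rewrite (fE _).1.
by apply: val_inj; rewrite (fE _).2 bi.
Qed.

Lemma contentE (i : 'I_n) : content lam i = dl i.
Proof.
rewrite /content sum_ffunE -card_diag -sum1_card [RHS]big_mkcond.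
by apply: eq_bigr => b _; rewrite ffunE inE /=; case: (_ == _).
Qed.

Lemma height_lam : @height n (content lam) = sumn lam.
Proof.
rewrite /height (eq_bigr (fun i : 'I_n => dl i)) => [|i _]; last exact: contentE.
rewrite sumnE (eq_bigr (fun i : 'I_n => \sum_(p <- lam) (i < p)%N)%N); last first.
  by move=> i _; rewrite /dl -sum1_count big_mkcond; apply: eq_bigr => p _; case: ifP.
rewrite exchange_big /=; apply: eq_big_seq => p /lam_bound /andP[_ pn].
rewrite -(big_mkord xpredT (fun i => (i < p)%N : nat)) (big_cat_nat _ pn) //=.
rewrite (eq_big_nat _ _ (F2 := fun=> 1%N)) => [|i /andP[_ ->]//].
rewrite sum_nat_const_nat muln1 subn0 big_nat_cond big1 ?addn0 // => i.
by case/andP=> /andP[h _] _; rewrite ltnNge h.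
Qed.

End Diagram.

Lemma nth_swap_adj (T : Type) m (s : seq T) p x0 : (m.+1 < size s)%N ->
  nth x0 (swap_adj m s) (transp m p) = nth x0 s p.
Proof.
elim: m s p => [|m IH] [|a [|b s]] p //=; first by case: p => [|[|p]].
move=> h; case: p => [|p] //=; rewrite -(IH (b :: s)) // /transp !eqSS.
by do 2?case: eqP.
Qed.

Lemma count_take_le (T : Type) (P : pred T) (s : seq T) p q : (p <= q)%N ->
  (count P (take p s) <= count P (take q s))%N.
Proof.
move=> pq; rewrite -[take q s](cat_take_drop p) count_cat -take_min.
by rewrite (minn_idPl pq) leq_addr.
Qed.

Lemma count_takeS (T : Type) (P : pred T) (s : seq T) p x0 : (p < size s)%N ->
  count P (take p.+1 s) = (count P (take p s) + P (nth x0 s p))%N.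
Proof. by move=> ps; rewrite (take_nth x0) // -cats1 count_cat /= addn0. Qed.

Lemma count_take_ord (T : Type) N (f : 'I_N -> T) (P : pred T) w :
  count P (take w [seq f p | p <- enum 'I_N]) = #|[pred p | P (f p) && (p < w)%N]|.
Proof.
elim: w => [|w IH].
  by rewrite take0 /= eq_card0 // => p; rewrite !inE andbF.
have [wN|Nw] := ltnP w N; last first.
  have h (p : 'I_N) : (p < w)%N by apply: leq_trans Nw.
  have sz : size [seq f p | p <- enum 'I_N] = N by rewrite size_map size_enum_ord.
  rewrite !take_oversize ?sz ?leqW // in IH *.
  by rewrite IH; apply: eq_card => p; rewrite !inE h ltnW ?h // ltnS h.
have sz : (w < size [seq f p | p <- enum 'I_N])%N by rewrite size_map size_enum_ord.
rewrite (take_nth (f (Ordinal wN)) sz) -cats1 count_cat IH.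
rewrite (nth_map (Ordinal wN)) ?size_enum_ord //=.
have -> : nth (Ordinal wN) (enum 'I_N) w = Ordinal wN.
  by apply: val_inj; rewrite /= nth_enum_ord.
rewrite addn0 addnC [in RHS](cardD1 (Ordinal wN)) inE /= ltnSn andbT; congr (_ + _)%N.
apply: eq_card => p; rewrite !inE /= -val_eqE /= andbCA; congr (_ && _).
by rewrite ltnS [RHS]andbC ltn_neqAle andbC.
Qed.

Section Tableaux.
Variables (n : nat) (lam : strict_part n).
Local Notation N := (sumn lam).
Implicit Types (T : filling lam) (b c : box lam).

Lemma card_box : #|{: box lam}| = N.
Proof.
rewrite -height_lam /height (eq_bigr (fun i : 'I_n => \sum_(b : box lam | residue b == i) 1)%N).
  by rewrite -[LHS]sum1_card (partition_big (fun b => residue b) xpredT).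
by move=> i _; rewrite contentE -card_diag sum1_card; apply: eq_card => b; rewrite inE.
Qed.

Lemma row_res_col b : col_of b = (row_of b + residue b)%N.
Proof. by rewrite residueE subnKC // box_le. Qed.

(** One step up in a column lowers the row and raises the residue by one; by [dl_step] the diagonal
    shrinks by at most one as well. *)
Lemma dl_up r x d : (d <= r)%N -> (r < dl lam x)%N -> (r - d < dl lam (x + d))%N.
Proof.
elim: d => [|d IH] dr h; first by rewrite subn0 addn0.
have := IH (ltnW dr) h; have := dl_step lam (x + d); rewrite addnS; lia.
Qed.

Lemma box_corner b c : (row_of b <= row_of c)%N -> (col_of b <= col_of c)%N ->
  exists d : box lam, row_of d = row_of b /\ col_of d = col_of c.
Proof.
move=> hr hc; have hd := dl_up (leq_subr (row_of b) (row_of c)) (box_dl c).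
rewrite subKn // in hd; have [d [dr dx]] := box_ex hd.
by exists d; split=> //; rewrite !row_res_col dr dx; lia.
Qed.

Section Bijective.
Variables (T : filling lam) (g : 'I_N -> box lam).
Hypotheses (gK : cancel g T) (Kg : cancel T g).

Lemma res_seqE : res_seq T = rev [seq residue (g p) | p <- enum 'I_N].
Proof.
rewrite /res_seq (map_comp (@residue n lam) g) -map_rev; congr map.
apply: (@sorted_eq _ (fun b c => T c <= T b)%N).
- by move=> y x z h1 h2; apply: leq_trans h1.
- by move=> x y; rewrite -eqn_leq => /eqP e; apply: (can_inj Kg); apply/val_inj.
- by apply: sort_sorted => x y; apply: leq_total.
- rewrite rev_sorted sorted_map.
  have := iota_sorted 0 N; rewrite -val_enum_ord sorted_map.
  by congr is_true; apply: eq_sorted => p q; rewrite /= !gK.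
rewrite perm_sort perm_sym; apply: uniq_perm; rewrite ?enum_uniq //.
  by rewrite rev_uniq map_inj_uniq ?enum_uniq //; apply: can_inj gK.
move=> b; rewrite mem_rev mem_enum inE; apply/mapP; by exists (T b); rewrite ?mem_enum.
Qed.

Lemma size_res_seq : size (res_seq T) = N.
Proof. by rewrite res_seqE size_rev size_map size_enum_ord. Qed.

Lemma nth_res_seq x0 b : nth x0 (rev (res_seq T)) (T b) = residue b.
Proof.
rewrite res_seqE revK (nth_map (T b)) ?size_enum_ord //.
by rewrite nth_ord_enum Kg.
Qed.

Lemma nth_res_seq_rev x0 b : nth x0 (res_seq T) (rev_ord (T b)) = residue b.
Proof.
by rewrite -(nth_res_seq x0 b) nth_rev ?size_res_seq ?ltn_ord.
Qed.

Lemma count_res_seq x w :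
  count (fun a : 'I_n => val a == x) (take w (rev (res_seq T))) =
  #|[pred b | (val (residue b) == x) && (T b < w)%N]|.
Proof.
rewrite res_seqE revK count_take_ord.
rewrite -(card_image (can_inj gK)); apply: eq_card => b; rewrite !inE.
apply/imageP/idP => [[p]|h]; first by rewrite inE => h ->; rewrite gK.
by exists (T b); rewrite ?inE Kg.
Qed.

Lemma res_seq_content : seq_content (res_seq T) = content lam.
Proof.
rewrite /seq_content /content /res_seq big_map.
rewrite (perm_big (enum {: box lam})) ?perm_sort // big_enum.
by apply: eq_bigl => b; rewrite inE.
Qed.

End Bijective.

Lemma std_bij T : is_standard T -> exists2 g, cancel g T & cancel T g.
Proof.
case/and3P => /forallP h _ _.
have ex v : exists b, [pred b | T b == v] =i pred1 b.
  by have [b hb] := mem_card1 (eqP (h v)); exists b.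
have [g gE] := choice ex; exists g => [v|b].
  by apply/eqP; apply: etrans (gE v (g v)) (eqxx _).
by apply/esym/eqP; apply: etrans (esym (gE (T b) b)) (eqxx _).
Qed.

Lemma std_row T b c : is_standard T -> row_of b = row_of c -> (col_of b < col_of c)%N ->
  (T b < T c)%N.
Proof.
case/and3P => _ /forallP/(_ b)/forallP/(_ c)/implyP h _ e lt.
by apply: h; rewrite e eqxx.
Qed.

Lemma std_col T b c : is_standard T -> col_of b = col_of c -> (row_of b < row_of c)%N ->
  (T b < T c)%N.
Proof.
case/and3P => _ _ /forallP/(_ b)/forallP/(_ c)/implyP h e lt.
by apply: h; rewrite e eqxx.
Qed.

Lemma box_eq b c : row_of b = row_of c -> col_of b = col_of c -> b = c.
Proof.
move=> h1 h2; apply: box_inj => //; apply: val_inj.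
by rewrite !residueE h1 h2.
Qed.

Lemma std_mono T b c : is_standard T -> (row_of b <= row_of c)%N ->
  (col_of b <= col_of c)%N -> (T b <= T c)%N.
Proof.
move=> st hr hc; have [d [dr dc]] := box_corner hr hc.
apply: (@leq_trans (T d)).
  have [e|ne] := eqVneq (col_of b) (col_of c); first by rewrite (@box_eq b d) // dc.
  by apply: ltnW; apply: std_row; rewrite ?dr ?dc // ltn_neqAle ne.
have [e|ne] := eqVneq (row_of b) (row_of c); first by rewrite (@box_eq d c) // dr.
by apply: ltnW; apply: std_col; rewrite ?dr ?dc // ltn_neqAle ne.
Qed.

Lemma std_inj T : is_standard T -> injective T.
Proof. by case/std_bij => g _ /can_inj. Qed.

Lemma std_lt T b c : is_standard T -> (row_of b <= row_of c)%N ->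
  (col_of b <= col_of c)%N -> residue b != residue c -> (T b < T c)%N.
Proof.
move=> st hr hc nbc; rewrite ltn_neqAle std_mono // andbT.
by apply: contraNneq nbc => /val_inj/(std_inj st) ->.
Qed.

Lemma card_diag_lt x R : (R <= dl lam x)%N ->
  #|[pred b : box lam | (val (residue b) == x) && (row_of b < R)%N]| = R.
Proof.
move=> RD.
have ex (r : 'I_R) : exists b : box lam, row_of b = r /\ val (residue b) = x.
  by apply: box_ex; apply: leq_trans RD.
have [f fE] := choice ex.
have fi : injective f.
  by move=> r s e; apply: val_inj; rewrite /= -(fE r).1 -(fE s).1 e.
rewrite -[RHS]card_ord -(card_codom fi); apply: eq_card => b; rewrite !inE.
apply/andP/codomP => [[/eqP bi h]|[r ->]]; last by rewrite (fE r).1 (fE r).2 eqxx.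
exists (Ordinal h); apply: box_inj; first by rewrite (fE _).1.
by apply: val_inj; rewrite (fE _).2 bi.
Qed.

Lemma std_count T b x R : is_standard T -> (R <= dl lam x)%N ->
  (forall c, val (residue c) = x -> (T c < T b)%N = (row_of c < R)%N) ->
  count (fun a : 'I_n => val a == x) (take (T b) (rev (res_seq T))) = R.
Proof.
move=> st RD h; have [g gK Kg] := std_bij st.
rewrite (count_res_seq gK Kg) -[RHS](card_diag_lt RD); apply: eq_card => c.
by rewrite !inE; case: eqP => //= /h.
Qed.

(** A diagonal is filled in the order of its rows. *)
Lemma std_count_res T b : is_standard T ->
  count (fun a : 'I_n => val a == val (residue b)) (take (T b) (rev (res_seq T))) = row_of b.
Proof.
move=> st; apply: std_count => // [|c cb]; first exact/ltnW/box_dl.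
have [lt|ge] := ltnP (row_of c) (row_of b); last first.
  by apply/negbTE; rewrite -leqNgt; apply: std_mono => //; rewrite !row_res_col cb leq_add2r.
have le : (T c <= T b)%N.
  by apply: std_mono; rewrite ?(ltnW lt) // !row_res_col cb leq_add2r ltnW.
rewrite ltn_neqAle le andbT.
by apply: contraTneq lt => /val_inj/(std_inj st) ->; rewrite ltnn.
Qed.

Lemma cpath_rev (s : seq 'I_n) :
  (forall p x0, (p < size s)%N -> wtw (rev (take p s)) (nth x0 s p) = 1) -> cpath (rev s).
Proof.
elim/last_ind: s => [//|s a IH] h; rewrite rev_rcons cpath_cons; apply/andP; split.
  apply: IH => p x0 ps; have := h p x0; rewrite size_rcons => /(_ (ltnW ps)).
  by rewrite -cats1 takel_cat ?(ltnW ps) // nth_cat ps.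
have := h (size s) a; rewrite size_rcons ltnSn => /(_ isT).
by rewrite -cats1 take_size_cat // nth_cat ltnn subnn => ->.
Qed.

(** When a box of row r is filled, its own diagonal and the next one hold r boxes and the previous
    one r + 1, so the pairing is (r + 1) - 2r + r = 1; on the first diagonal it is 1 - 2(r - r) =
    1. *)
Lemma res_seq_cpath T : is_standard T -> cpath (res_seq T).
Proof.
move=> st; have [g gK Kg] := std_bij st; rewrite -[res_seq T]revK; apply: cpath_rev => p x0.
rewrite size_rev (size_res_seq gK Kg) => pN.
have -> : p = T (g (Ordinal pN)) by rewrite gK.
set b := g _; rewrite (nth_res_seq gK Kg) wtw_count !count_rev std_count_res //.
have cS : count (fun a : 'I_n => val a == (val (residue b)).+1)
    (take (T b) (rev (res_seq T))) = row_of b.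
  apply: std_count => // [|c cb].
    by have := dl_step lam (residue b); have := box_dl b; rewrite /=; lia.
  have [lt|ge] := ltnP (row_of c) (row_of b).
    apply: std_lt => //; rewrite ?(ltnW lt) //; first by rewrite !row_res_col cb /=; lia.
    by rewrite -val_eqE cb /=; lia.
  by apply/negbTE; rewrite -leqNgt; apply: std_mono => //; rewrite !row_res_col cb /=; lia.
case: ifP => [/eqP b0|b0].
  by have cR := std_count_res b st; rewrite b0 in cS cR; rewrite cR cS subrr mulr0.
(* On the previous diagonal the box in the row of [b] is its left neighbour, so it is filled
   already. *)
rewrite cS (_ : count _ _ = (row_of b).+1); first by lia.
have bp : (0 < residue b)%N by rewrite lt0n b0.
apply: std_count => // [|c cb].
  by have := dl_step lam (residue b).-1; rewrite prednK //; have := box_dl b; rewrite /=; lia.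
have [lt|ge] := ltnP (row_of c) (row_of b).+1.
  apply: std_lt => //; first by rewrite !row_res_col cb /=; lia.
  by move: bp; rewrite -val_eqE cb /=; lia.
by apply/negbTE; rewrite -leqNgt; apply: std_mono => //; rewrite ?(ltnW ge) //; move: bp; rewrite !row_res_col cb /=; lia.
Qed.

(** By [std_count_res], the entry of a box in row r is the place where its residue occurs for the (r
    + 1)-st time. *)
Lemma res_seq_inj T T' : is_standard T -> is_standard T' -> res_seq T = res_seq T' -> T = T'.
Proof.
have half U U' b : is_standard U -> is_standard U' -> res_seq U = res_seq U' ->
    (U b < U' b)%N -> False.
  move=> st st' e lt; have [g gK Kg] := std_bij st.
  have := std_count_res b st'; rewrite -e.
  have := count_take_le (fun a : 'I_n => val a == val (residue b)) (rev (res_seq U)) lt.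
  rewrite (count_takeS _ (residue b)); last first.
    by rewrite size_rev (size_res_seq gK Kg) ltn_ord.
  by rewrite std_count_res // (nth_res_seq gK Kg) eqxx addn1 => + h; rewrite h ltnn.
move=> st st' e; apply/ffunP => b; apply: val_inj; apply/eqP.
by case: ltngtP => // lt; [have := half _ _ _ st st' e lt | have := half _ _ _ st' st (esym e) lt].
Qed.

End Tableaux.

Section TableauxOfWords.
Variables (n : nat) (lam : strict_part n).
Local Notation N := (sumn lam).
Implicit Types (T : filling lam) (b c : box lam).

Lemma std_intro T g : cancel g T -> cancel T g ->
  (forall b c, row_of b = row_of c -> (col_of b < col_of c)%N -> (T b < T c)%N) ->
  (forall b c, col_of b = col_of c -> (row_of b < row_of c)%N -> (T b < T c)%N) ->
  is_standard T.
Proof.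
move=> gK Kg hr hc; apply/and3P; split.
- apply/forallP => v.
  have e : [pred b | T b == v] =i pred1 (g v).
    move=> b; rewrite [LHS]inE [RHS]inE; apply/eqP/eqP => [<-|->]; first by rewrite Kg.
    by rewrite gK.
  exact/eqP/(etrans (eq_card e))/card1.
- by apply/forallP => b; apply/forallP => c; apply/implyP => /andP[/eqP h1 h2]; apply: hr.
- by apply/forallP => b; apply/forallP => c; apply/implyP => /andP[/eqP h1 h2]; apply: hc.
Qed.

Lemma simple_transpE m (p : 'I_N) : (m.+1 < N)%N ->
  val (simple_transp N m p) = transp m p.
Proof.
move=> h; rewrite /simple_transp; case: insubP => [a _ am|]; last by rewrite (ltnW h).
case: insubP => [b _ bm|]; last by rewrite h.
rewrite /transp; case: tpermP => [->|->|pa pb].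
- by rewrite am eqxx bm.
- by rewrite bm eqxx am; case: eqP => // e; lia.
case: eqP => [e|_]; first by case: pa; apply: val_inj; rewrite am.
by case: eqP => // e; case: pb; apply: val_inj; rewrite bm.
Qed.

Lemma perm_act_bij (w : 'S_N) T g : cancel g T -> cancel T g ->
  cancel (fun p => g (rev_ord ((w^-1)%g (rev_ord p)))) (perm_act w T) /\
  cancel (perm_act w T) (fun p => g (rev_ord ((w^-1)%g (rev_ord p)))).
Proof.
move=> gK Kg; split=> [p|b]; rewrite /perm_act ffunE; first by rewrite gK rev_ordK permKV rev_ordK.
by rewrite rev_ordK permK rev_ordK Kg.
Qed.

Lemma res_perm_act m T g : cancel g T -> cancel T g -> (m.+1 < N)%N ->
  res_seq (perm_act (simple_transp N m) T) = swap_adj m (res_seq T).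
Proof.
move=> gK Kg mN; set T' := perm_act _ _.
have [g'K Kg'] := perm_act_bij (simple_transp N m) gK Kg; set g' := fun _ => _ in g'K Kg'.
have sz := size_res_seq gK Kg; have sz' := size_res_seq g'K Kg'.
case e: (res_seq T') => [|x0 s]; first by move: mN; rewrite -sz' e.
rewrite -e; apply: (@eq_from_nth _ x0); rewrite ?size_swap_adj sz' ?sz // => p pN.
pose b := g' (rev_ord (Ordinal pN)).
have pE : p = rev_ord (T' b) by rewrite /b g'K rev_ordK.
rewrite {1}pE (nth_res_seq_rev g'K Kg') pE /T' /perm_act ffunE rev_ordK simple_transpE //.
by rewrite nth_swap_adj ?sz // (nth_res_seq_rev gK Kg).
Qed.

Lemma cartanS (i j : 'I_n) : val i = (val j).+1 -> cartan i j != 0 /\ cartan j i != 0.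
Proof.
move=> h; have nij : i != j by rewrite -val_eqE h neq_ltn ltnSn orbT.
split; last rewrite cartan_eq0C; by rewrite /cartan (negbTE nij) h eqxx /=.
Qed.

(** If both orders of two letters give crystal words, the letters are orthogonal, so their boxes are
    not neighbours; and exchanging consecutive entries can only break the order of neighbouring
    boxes. *)
Lemma swap_std m T : (m.+1 < N)%N -> is_standard T ->
  cpath (swap_adj m (res_seq T)) -> is_standard (perm_act (simple_transp N m) T).
Proof.
move=> mN st ps; have [g gK Kg] := std_bij st.
have sz := size_res_seq gK Kg.
have [|i [j [nu e]]] := @split_at _ m (res_seq T); first by rewrite sz.
have sm : size (take m (res_seq T)) = m by rewrite size_takel // sz; lia.
have cij : cartan i j = 0.
  have := ps; rewrite e -{1}sm swap_adj_cat0 => /cpath_cat /andP[/andP[pn /eqP wi] _].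
  have := res_seq_cpath st; rewrite e => /cpath_cat => p2; have ij := cpath_neq p2.
  by case/andP: p2 => /andP[_ /eqP wj] _; apply: addable_cartan pn wi wj ij.
set T' := perm_act _ _.
have [g'K Kg'] := perm_act_bij (simple_transp N m) gK Kg; set g' := fun _ => _ in g'K Kg'.
rewrite -/T' in g'K Kg'.
have T'E b : val (rev_ord (T' b)) = transp m (rev_ord (T b)).
  by rewrite /T' /perm_act ffunE rev_ordK simple_transpE.
clearbody g' T'.
have res_m b : val (rev_ord (T b)) = m -> residue b = i.
  by move=> h; rewrite -(nth_res_seq_rev gK Kg i) h e -{2}sm nth_cat ltnn subnn.
have res_m1 b : val (rev_ord (T b)) = m.+1 -> residue b = j.
  move=> h; rewrite -(nth_res_seq_rev gK Kg i) h e nth_cat sm ltnNge leqnSn /=.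
  by rewrite subSnn.
(* The only pair whose order changes is the exchanged one. *)
have key b c : (T b < T c)%N -> ~~ (T' b < T' c)%N ->
    (T c = (T b).+1 :> nat) /\ cartan (residue c) (residue b) = 0.
  move=> lt nlt; have nbc : T' b != T' c.
    by apply: contraTneq lt => e'; rewrite (can_inj Kg' e') ltnn.
  have {nlt} lt' : (T' c < T' b)%N by rewrite ltn_neqAle eq_sym nbc leqNgt.
  have := T'E b; have := T'E c; rewrite /= /transp.
  have hb := ltn_ord (T b); have hc := ltn_ord (T c).
  have hb' := ltn_ord (T' b); have hc' := ltn_ord (T' c).
  have [ec ec'|nec] := eqVneq (N - (T c).+1)%N m.
    have [eb|neb] := eqVneq (N - (T b).+1)%N m; first by lia.
    have [eb eb'|neb1] := eqVneq (N - (T b).+1)%N m.+1; last by lia.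
    by split; [lia | rewrite (res_m c) // (res_m1 b)].
  have [ec ec'|nec1] := eqVneq (N - (T c).+1)%N m.+1.
    by do 2?case: eqP; lia.
  by do 2?case: eqP; lia.
have mid b c d : (T b < T d)%N -> (T d < T c)%N -> (T' b < T' c)%N.
  by move=> h1 h2; apply: contraT => /(key _ _ (ltn_trans h1 h2)) [h3 _]; lia.
have hrow b c : row_of b = row_of c -> (col_of b < col_of c)%N -> (T' b < T' c)%N.
  move=> er lc; have [|d [dr dc]] := @box_ex _ lam (col_of b - row_of b).+1 (row_of b).
    have h := box_dl c; rewrite residueE -er in h.
    have bl := box_le b.
    by apply: leq_trans h _; apply: dl_anti; lia.
  have cd : col_of d = (col_of b).+1 by rewrite row_res_col dr dc; have := box_le b; lia.
  have lbd : (T b < T d)%N by apply: std_row => //; rewrite cd.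
  (* [d] is the right neighbour of [b]. Either it is [c], whose residue is then adjacent, or its
     entry lies strictly between those of [b] and [c]. *)
  have [e1|ne1] := eqVneq (col_of d) (col_of c); last first.
    by apply: (mid _ _ d) => //; apply: std_row; rewrite ?dr //; lia.
  have dcE : d = c by apply: box_eq; rewrite // dr.
  rewrite -dcE in lc er *; apply: contraT => /(key _ _ lbd) [_].
  have [|h _] := @cartanS (residue d) (residue b); last by move/eqP; rewrite (negbTE h).
  by rewrite dc -residueE.
have hcol b c : col_of b = col_of c -> (row_of b < row_of c)%N -> (T' b < T' c)%N.
  move=> ec lr; have cl := box_le c.
  have [|d [dr dx]] := @box_ex _ lam (col_of b - (row_of b).+1) (row_of b).+1.
    have := @dl_up _ lam (row_of c) (residue c) (row_of c - (row_of b).+1) (leq_subr _ _) (box_dl c).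
    by rewrite residueE subKn // ec (_ : col_of c - row_of c + (row_of c - (row_of b).+1) = col_of c - (row_of b).+1)%N //; lia.
  have cd : col_of d = col_of b by rewrite row_res_col dr dx; lia.
  have lbd : (T b < T d)%N by apply: std_col => //; rewrite dr.
  have [e1|ne1] := eqVneq (row_of d) (row_of c); last first.
    by apply: (mid _ _ d) => //; apply: std_col; rewrite ?cd //; lia.
  have dcE : d = c by apply: box_eq; rewrite // cd.
  rewrite -dcE in lr ec *; apply: contraT => /(key _ _ lbd) [_].
  have [|_ h] := @cartanS (residue b) (residue d); last by move/eqP; rewrite (negbTE h).
  by rewrite dx residueE; have := box_le b; have := box_le d; rewrite dr cd; lia.
exact: (std_intro g'K Kg' hrow hcol).
Qed.

(** Reading the word from its end, each letter is placed on the diagonal of its residue, in the row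
    given by the number of its earlier occurrences. *)
Lemma cpath_std nu : cpath nu -> seq_content nu = content lam ->
  exists T : ST lam, res_seq (val T) = nu.
Proof.
move=> pn hc; set s := rev nu.
have sz : size s = N by rewrite size_rev -height_lam -hc height_content.
pose cnt x p := count (fun a : 'I_n => val a == x) (take p s).
have cntN x : cnt x N = dl lam x.
  rewrite /cnt -sz take_size count_rev.
  have [xn|xn] := ltnP x n; last by rewrite count_out // dl_n.
  by rewrite (count_residue nu (Ordinal xn)) -seq_contentE hc contentE.
have cntle x p q : (p <= q)%N -> (cnt x p <= cnt x q)%N by apply: count_take_le.
have pre p : cpath (rev (take p s)).
  by apply: (@cpath_cat _ (rev (drop p s))); rewrite -rev_cat cat_take_drop revK.
have shape p x : (cnt x.+1 p <= cnt x p <= (cnt x.+1 p).+1)%N.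
  by have := cpath_count (pre p) x; rewrite !count_rev.
have step (p : 'I_N) x0 : let i := nth x0 s p in cnt (val i) p = cnt (val i).+1 p /\
    (forall x, val i = x.+1 -> cnt x p = (cnt x.+1 p).+1).
  move=> i; have := pre p.+1; rewrite (take_nth x0) ?sz // rev_rcons => /andP[h /eqP wi].
  by have := cpath_step h wi; rewrite /= !count_rev => -[h1 h2]; split=> // x /h2; rewrite !count_rev.
have cntS (p : 'I_N) x0 x : cnt x p.+1 = (cnt x p + (val (nth x0 s p) == x))%N.
  by rewrite /cnt (count_takeS _ x0) // sz.
have ex (p : 'I_N) : exists b : box lam, (forall x0, residue b = nth x0 s p) /\
    row_of b = cnt (residue b) p.
  have ps : (p < size s)%N by rewrite sz.
  have [x0 _] : exists x0 : 'I_n, True by case: (s) ps => [|x0 s'] // _; exists x0.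
  have [|b [br bx]] := @box_ex _ lam (val (nth x0 s p)) (cnt (val (nth x0 s p)) p).
    by rewrite -cntN; apply: leq_trans (cntle _ _ _ (ltn_ord p)); rewrite (cntS _ x0) eqxx addn1.
  have bi : residue b = nth x0 s p by apply: val_inj.
  exists b; split; last by rewrite br bi.
  by move=> x1; rewrite bi; apply: set_nth_default; rewrite sz.
have [g gE] := choice ex.
have gi : injective g.
  have half p q : g p = g q -> (p < q)%N -> False.
    move=> e lt; have [rp rowp] := gE p; have [rq rowq] := gE q.
    have := cntle (residue (g p)) _ _ lt; rewrite (cntS p (residue (g p))) -rp eqxx addn1.
    by rewrite -rowp e -rowq ltnn.
  move=> p q e; apply: val_inj; case: (ltngtP p q) => // lt; first by case: (half _ _ e lt).
  by case: (half _ _ (esym e) lt).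
have [f gK fK] : bijective g by apply: inj_card_bij => //; rewrite card_box card_ord.
pose T : filling lam := finfun f.
have TE b : T b = f b by rewrite ffunE.
have cg : cancel g T by move=> p; rewrite TE gK.
have gc : cancel T g by move=> b; rewrite TE fK.
have rowE b : row_of b = cnt (residue b) (T b) by rewrite -{1}(gc b) (gE (T b)).2 gc.
have nthE b x0 : nth x0 s (T b) = residue b by rewrite -((gE (T b)).1 x0) gc.
have before b c : (row_of b < cnt (residue b) (T c))%N -> (T b < T c)%N.
  by move=> h; rewrite ltnNge; apply/negP => /(cntle (residue b)); rewrite -rowE leqNgt h.
have anti x y p : (x <= y)%N -> (cnt y p <= cnt x p)%N.
  move=> xy; rewrite -(subnKC xy); elim: (y - x)%N => [|d IH]; first by rewrite addn0.
  by rewrite addnS; apply: leq_trans IH; case/andP: (shape p (x + d)%N).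
have low x d p : (cnt x p <= cnt (x + d) p + d)%N.
  elim: d => [|d IH]; first by rewrite !addn0.
  by apply: leq_trans IH _; rewrite !addnS; have := shape p (x + d)%N; lia.
have st : is_standard T.
  apply: (std_intro cg gc) => b c h1 h2.
  (* When [c] is filled, the diagonal before its own is already longer by one, and by [anti] the
     diagonal of [b] is at least that long. *)
  - apply: before; rewrite h1 rowE.
    have bl := box_le b; have cl := box_le c.
    have [_ h] := step (T c) (residue c); rewrite /= nthE in h.
    have cx : val (residue c) = (col_of c - row_of c).-1.+1 by rewrite residueE; lia.
    have {h} := h _ cx; rewrite -cx => h.
    rewrite -ltnS -h ltnS; apply: anti; rewrite residueE; lia.
  (* When [c] is filled, the next diagonal is as long as its own. From there to the diagonal of [b]
     the lengths drop by at most one per step ([low]), which leaves at least [row_of b] + 1. *)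
  - apply: before.
    have bl := box_le b; have cl := box_le c.
    have [h _] := step (T c) (residue c); rewrite /= nthE -rowE in h.
    have := low (val (residue c)).+1 (row_of c - (row_of b).+1)%N (T c).
    rewrite -h (_ : (val (residue c)).+1 + (row_of c - (row_of b).+1) = val (residue b))%N; last by rewrite !residueE; lia.
    by move=> L; have {L} L : (row_of c <= cnt (residue b) (T c) + (row_of c - (row_of b).+1))%N := L; lia.
exists (exist _ T st) => /=; rewrite -[nu]revK -/s (res_seqE cg gc); congr rev.
have [s0|sn] := eqVneq N 0%N.
  by rewrite (size0nil (s := s)) ?sz // (size0nil (s := map _ _)) // size_map size_enum_ord.
have [x0 _] : exists x0 : 'I_n, True.
  by move: sn; rewrite -sz; case: (s) => [|x0 s'] // _; exists x0.
apply: (@eq_from_nth _ x0); first by rewrite size_map size_enum_ord sz.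
move=> p; rewrite size_map size_enum_ord => pN.
rewrite (nth_map (Ordinal pN)) ?size_enum_ord // (nth_ord_enum _ (Ordinal pN)).
by rewrite ((gE _).1 x0).
Qed.

End TableauxOfWords.

(** * The modules S(b) *)

Section ActLemmas.
Variables (A : pzRingType) (M : lmodType A).
Implicit Types (a b c d e q : A) (v : M).

Lemma act_comm a b c d v : a *: (b *: v) = c *: (d *: v) -> (a * b - c * d) *: v = 0.
Proof. by rewrite scalerBl -!scalerA => ->; rewrite subrr. Qed.

Lemma act_mul a b c v : a *: (b *: v) = c *: v -> (a * b - c) *: v = 0.
Proof. by rewrite scalerBl -!scalerA => ->; rewrite subrr. Qed.

Lemma act_sub a b v : a *: v = b *: v -> (a - b) *: v = 0.
Proof. by rewrite scalerBl => ->; rewrite subrr. Qed.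

Lemma act_square x e q v : e *: v = 0 \/ (e *: v = v /\ x *: (x *: v) = q *: v) ->
  (x ^+ 2 * e - q * e) *: v = 0.
Proof.
rewrite scalerBl -!scalerA; case=> [->|[-> h]]; first by rewrite !scaler0 subrr.
by rewrite h subrr.
Qed.

Lemma act_braid a b c e q (i : bool) v :
  e *: v = 0 \/ [/\ e *: v = v, a *: (b *: (c *: v)) = b *: (c *: (b *: v)) & i -> q *: v = 0] ->
  ((a * b * c - b * c * b) * e - (if i then q * e else 0)) *: v = 0.
Proof.
rewrite scalerBl -!scalerA; case=> [e0|[e1 h qv]].
  by rewrite e0 scaler0; case: i; rewrite ?scale0r -?scalerA ?e0 ?scaler0 subr0.
rewrite e1 scalerBl -!scalerA h subrr sub0r; case: i qv => [qv|_]; last by rewrite scale0r oppr0.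
by rewrite -scalerA e1 qv // oppr0.
Qed.

Lemma act_poly a b x y m p v : (forall u : M, x *: u = 0) -> (forall u : M, y *: u = 0) ->
  (0 < m)%N -> (0 < p)%N -> (a * x ^+ m + b * y ^+ p) *: v = 0.
Proof.
move=> hx hy; case: m p => // m [//|p] _ _.
by rewrite scalerDl -!scalerA !exprS -!scalerA hx hy !scaler0 addr0.
Qed.

(** The hexagon of exchanges of three letters i j l. The booleans say which pairs are orthogonal;
    both paths use all three pairs, so both vanish as soon as one pair is not orthogonal. *)
Lemma act_swap3 a b (c1 c2 c3 : bool) u ujil uilj ujli ulij ulji :
  a *: u = (if c1 then uilj else 0) -> b *: uilj = (if c2 then ulij else 0) ->
  a *: ulij = (if c3 then ulji else 0) ->
  b *: u = (if c3 then ujil else 0) -> a *: ujil = (if c2 then ujli else 0) ->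
  b *: ujli = (if c1 then ulji else 0) ->
  a *: (b *: (a *: u)) = b *: (a *: (b *: u)) :> M.
Proof.
move=> h1 h2 h3 h4 h5 h6; rewrite h1 h4.
case: c1 h6 {h1} => h6; case: c3 h3 {h4} => h3; rewrite ?h2 ?h5 ?scaler0 //;
  by case: c2 h2 h5 => h2 h5; rewrite ?h3 ?h6 ?scaler0.
Qed.

Lemma act_swap2 a b (c1 c2 : bool) u u1 u2 u12 :
  a *: u = (if c1 then u1 else 0) -> b *: u = (if c2 then u2 else 0) ->
  a *: u2 = (if c1 then u12 else 0) -> b *: u1 = (if c2 then u12 else 0) ->
  a *: (b *: u) = b *: (a *: u) :> M.
Proof.
move=> -> -> h1 h2; case: c1 h1 => h1; case: c2 h2 => h2;
  by rewrite ?h1 ?h2 ?scaler0.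
Qed.

Lemma act_mul0 a b v : b *: v = 0 -> (a * b) *: v = 0.
Proof. by rewrite -scalerA => ->; rewrite scaler0. Qed.

Lemma act_X a x x' e r v : (forall u : M, x *: u = 0) -> (forall u : M, x' *: u = 0) -> r *: v = 0 ->
  ((a * x - x' * a) * e - r) *: v = 0.
Proof. by move=> h h' r0; rewrite scalerBl -scalerA scalerBl -!scalerA h h' r0 scaler0 !subr0. Qed.

Lemma sum_act (T : eqType) (J : finType) (f : J -> T) (P : pred J) (e : T -> A) (mu : T) v j :
  injective f -> f j = mu -> P j -> (forall nu, e nu *: v = if nu == mu then v else 0) ->
  (\sum_(i | P i) e (f i)) *: v = v.
Proof.
move=> fi fj Pj h; rewrite scaler_suml (bigD1 j) //= h fj eqxx big1 ?addr0 // => i /andP[_ ij].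
by rewrite h -fj (inj_eq fi) (negbTE ij).
Qed.

Lemma sum_act0 (J : finType) (P : pred J) (e : J -> A) v :
  (forall j, P j -> e j *: v = 0) -> (\sum_(j | P j) e j) *: v = 0.
Proof. by move=> h; rewrite scaler_suml big1. Qed.

End ActLemmas.

Section GenModules.
Variables (k : fieldType) (G : choiceType) (V : lmodType k) (rho : G -> {linear V -> V}).

Lemma genmod_gen g (v : genmod rho) : free_gen k g *: v = rho g v.
Proof. by rewrite [LHS]free_actU scale1r /word_op fmU. Qed.

Lemma algCE (c : k) : c%:A = malgC c :> free_alg k G.
Proof. by rewrite -mul_malgC mulr1. Qed.

Lemma genmodZ (c : k) (v : genmod rho) : c%:A *: v = c *: (v : V).
Proof. by rewrite algCE [LHS]free_actU /word_op fm1. Qed.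

End GenModules.

Section SpechtModule.
Variables (k : fieldType) (n : nat) (lam : strict_part n).
Local Notation F := (free_alg k (klr_gen n)).
Local Notation E := (@eF k n).
Local Notation X := (xF k n).
Local Notation tau := (tauF k n).
Local Notation N := (sumn lam).
Local Notation S := (specht k lam).
Implicit Types (T : ST lam) (nu mu : seq 'I_n) (v : S).

Definition tvec T : S := tab_vec k T.

Lemma specht_sum v : v = \sum_T (v T : k)%:A *: tvec T.
Proof.
rewrite (eq_bigr (fun T => (v T : k) *: tab_vec k T)) => [|T _]; last exact: genmodZ.
apply/ffunP => T; rewrite sum_ffunE (bigD1 T) //= !ffunE eqxx [_ *: _]mulr1 big1 ?addr0 //.
by move=> T' h; rewrite !ffunE eq_sym (negbTE h) [_ *: _]mulr0.
Qed.

Lemma specht_op_tab g T : specht_op g (tab_vec k T) = specht_gen k g T.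
Proof.
rewrite /specht_op (bigD1 T) //= ffunE eqxx scale1r big1 ?addr0 // => T' h.
by rewrite ffunE (negbTE h) scale0r.
Qed.

(** By [res_seq_inj] the sum has at most one term: it is the basis vector of the tableau with word
    [nu], or 0. Indexing by words makes the action of tau uniform. *)
Definition wvec nu : S := \sum_(T | res_seq (val T) == nu) tvec T.

Lemma wvec_tab T : wvec (res_seq (val T)) = tvec T.
Proof.
rewrite /wvec (bigD1 T) //= big1 ?addr0 // => T' /andP[/eqP e].
by case/eqP; apply: val_inj; apply: res_seq_inj (valP _) (valP _) e.
Qed.

Lemma wvec_out nu : ~~ (cpath nu && (seq_content nu == content lam)) -> wvec nu = 0.
Proof.
move=> h; rewrite /wvec big1 // => T /eqP e; case/negP: h; rewrite -e.
by rewrite (res_seq_cpath (valP T)) res_seq_content eqxx.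
Qed.

Lemma E_tvec nu T : E nu *: tvec T = if nu == res_seq (val T) then tvec T else 0.
Proof. by rewrite /eF genmod_gen [LHS]specht_op_tab. Qed.

Lemma X_act l v : X l *: v = 0.
Proof.
by rewrite /xF genmod_gen; apply: big1 => T _; rewrite scaler0.
Qed.

Lemma tau_tvec m T : tau m *: tvec T =
  if (m.+1 < N)%N then wvec (swap_adj m (res_seq (val T))) else 0.
Proof.
rewrite /tauF genmod_gen [LHS]specht_op_tab /=; case: ifP => // mN.
have [g gK Kg] := std_bij (valP T).
case: insubP => [T' st e|nst] /=.
  by rewrite -(res_perm_act gK Kg mN) -e wvec_tab.
rewrite wvec_out //; apply/negP => /andP[p _].
by case/negP: nst; apply: swap_std => //; apply: valP.
Qed.

Lemma specht_ind (P : S -> Prop) : P 0 -> (forall u v, P u -> P v -> P (u + v)) ->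
  (forall (c : k) v, P v -> P (c%:A *: v)) -> (forall T, P (tvec T)) -> forall v, P v.
Proof.
move=> P0 PD PZ PT v; rewrite (specht_sum v); elim/big_ind: _ => // T _.
by apply: PZ.
Qed.

Lemma specht_act0 (f : F) : (forall T, f *: tvec T = 0) -> forall v, f *: v = 0.
Proof.
move=> h; elim/specht_ind => // [|u v hu hv|c v hv]; first by rewrite scaler0.
  by rewrite scalerDr hu hv addr0.
by rewrite scale_algC hv scaler0.
Qed.

Lemma wvec_cases nu : wvec nu = 0 \/ exists2 T, res_seq (val T) = nu & wvec nu = tvec T.
Proof.
have [/existsP [T /eqP e]|h] := boolP [exists T : ST lam, res_seq (val T) == nu].
  by right; exists T; rewrite // -e wvec_tab.
left; rewrite /wvec big1 // => T e; case/negP: h; apply/existsP; exists T; exact: e.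
Qed.

Lemma E_wvec nu mu : E nu *: wvec mu = if nu == mu then wvec mu else 0.
Proof.
have [->|[T <- ->]] := wvec_cases mu; first by rewrite scaler0 if_same.
exact: E_tvec.
Qed.

Lemma size_res T : size (res_seq (val T)) = N.
Proof. by have [g gK Kg] := std_bij (valP T); apply: (size_res_seq gK Kg). Qed.

(** Orthogonal exchanges preserve crystal words, so both vectors vanish together. For letters that
    are not orthogonal, the two orders cannot both be crystal words, by [addable_cartan]. *)
Lemma tau_wvec_at pi i j nu : tau (size pi) *: wvec (pi ++ [:: i, j & nu]) =
  if cartan i j == 0 then wvec (pi ++ [:: j, i & nu]) else 0.
Proof.
have [w0|[T e we]] := wvec_cases (pi ++ [:: i, j & nu]); last first.
  rewrite we tau_tvec -(size_res T) e swap_adj_cat0 size_cat /= !addnS leq_addr.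
  case: eqP => // cij; apply: wvec_out; apply/negP => /andP[p2 _].
  have p1 := res_seq_cpath (valP T); rewrite e in p1.
  have /andP[/andP[pn /eqP wi] _] := cpath_cat p2.
  have /andP[/andP[_ /eqP wj] _] := cpath_cat p1.
  by case: cij; apply: addable_cartan pn wi wj (cpath_neq (cpath_cat p1)).
rewrite w0 scaler0; case: eqP => // cij.
have [-> //|[T e _]] := wvec_cases (pi ++ [:: j, i & nu]).
have pT := res_seq_cpath (valP T); rewrite e in pT.
have cT : seq_content (res_seq (val T)) = content lam by apply: res_seq_content.
have p1 := cpath_swap cij pT.
have [|T1 e1] := cpath_std (lam := lam) p1.
  rewrite -cT e; apply: seq_content_perm.
  by rewrite perm_cat2l -[[:: i, j & nu]]cat1s -[j :: nu]cat1s perm_catCA.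
have := wvec_tab T1; rewrite e1 w0 => /esym h.
have := E_tvec (res_seq (val T1)) T1; rewrite eqxx => _.
have : (tvec T1 : specht_space k lam) T1 = (0 : specht_space k lam) T1 by rewrite h.
by rewrite !ffunE eqxx => /eqP; rewrite oner_eq0.
Qed.

Lemma tau_wvec_at2 pi i j pi2 a b nu :
  tau (size pi + (size pi2).+2) *: wvec (pi ++ [:: i, j & pi2 ++ [:: a, b & nu]]) =
  if cartan a b == 0 then wvec (pi ++ [:: i, j & pi2 ++ [:: b, a & nu]]) else 0.
Proof.
have E2 x y : pi ++ [:: i, j & pi2 ++ [:: x, y & nu]] = (pi ++ [:: i, j & pi2]) ++ [:: x, y & nu].
  by rewrite -catA.
by rewrite !E2 -tau_wvec_at size_cat.
Qed.

Lemma tau_far_wvec pi i j pi2 a b nu :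
  let w := wvec (pi ++ [:: i, j & pi2 ++ [:: a, b & nu]]) in
  tau (size pi) *: (tau (size pi + (size pi2).+2) *: w) =
  tau (size pi + (size pi2).+2) *: (tau (size pi) *: w).
Proof.
apply: act_swap2; first exact: tau_wvec_at.
- exact: tau_wvec_at2.
- exact: tau_wvec_at.
- exact: tau_wvec_at2.
Qed.

Lemma tau_wvec_atS pi i j l nu : tau (size pi).+1 *: wvec (pi ++ [:: i, j, l & nu]) =
  if cartan j l == 0 then wvec (pi ++ [:: i, l, j & nu]) else 0.
Proof. by rewrite -!(cat_rcons i pi) -tau_wvec_at size_rcons. Qed.

Lemma tau_braid_wvec pi i j l nu :
  let w := wvec (pi ++ [:: i, j, l & nu]) in
  tau (size pi).+1 *: (tau (size pi) *: (tau (size pi).+1 *: w)) =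
  tau (size pi) *: (tau (size pi).+1 *: (tau (size pi) *: w)).
Proof.
apply: act_swap3; first exact: tau_wvec_atS.
- exact: tau_wvec_at.
- exact: tau_wvec_atS.
- exact: tau_wvec_at.
- exact: tau_wvec_atS.
- exact: tau_wvec_at.
Qed.

Lemma tau_out_specht m v : (N <= m.+1)%N -> tau m *: v = 0.
Proof. by move=> h; apply: specht_act0 => T; rewrite tau_tvec ltnNge h. Qed.

End SpechtModule.

Lemma onth_split (T : eqType) (s : seq T) l a : onth s l = Some a ->
  exists s1 s2, s = s1 ++ a :: s2 /\ size s1 = l.
Proof.
elim: s l => [|b s IH] [|l] //=; first by case=> ->; exists [::], s.
by move/IH => [s1 [s2 [-> <-]]]; exists (b :: s1), s2.
Qed.

Section SpechtKLR.
Variables (k : fieldType) (n : nat).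
Variables (t : 'I_n -> 'I_n -> nat -> nat -> k) (t_ok : klr_datum t).
Variable lam : strict_part n.
Local Notation F := (free_alg k (klr_gen n)).
Local Notation E := (@eF k n).
Local Notation X := (xF k n).
Local Notation tau := (tauF k n).
Local Notation N := (sumn lam).
Local Notation S := (specht k lam).
Local Notation beta := (content lam).
Implicit Types (T : ST lam) (nu mu : seq 'I_n) (v : S).

Lemma E_tvec_cases nu T : E nu *: tvec k T = 0 \/
  (nu = res_seq (val T) /\ E nu *: tvec k T = tvec k T).
Proof. by rewrite E_tvec; case: eqP => h; [right | left]. Qed.

Lemma tvec_wvec nu T : nu = res_seq (val T) -> tvec k T = wvec k lam nu.
Proof. by move=> ->; rewrite wvec_tab. Qed.

(** After the first [i] the weight at [i] is -1 and [j] raises it to 0 only. For a_ij = -2 the word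
    may occur, but there the braid correction is a multiple of a sum of x. *)
Lemma not_cpath_iji pi (i j : 'I_n) nu : i != j -> cartan i j = -1 ->
  wvec k lam (pi ++ [:: i, j, i & nu]) = 0.
Proof.
move=> ij c; apply: wvec_out; apply/negP => /andP[/cpath_cat].
rewrite !cpath_cons => /andP[/andP[/andP[_ /eqP wi] _]] /eqP; rewrite !wtwS wi cartan_diag c.
by [].
Qed.

Lemma specht_klr_mod : klr_mod t beta S.
Proof.
move=> r h; apply: specht_act0 => T; have hN := height_lam lam.
case: h => {r}.
- move=> nu nin; have [//|[e _]] := E_tvec_cases nu T.
  by case/negP: nin; rewrite e; apply/eqP/res_seq_content.
- by move=> l _; apply: X_act.
- by rewrite hN => m h; apply: tau_out_specht.
- move=> nu nu' _ _; apply: act_mul; rewrite E_tvec.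
  case: (nu' =P _) => [->|ne]; rewrite ?E_tvec; first by case: eqP => [->|_]; rewrite ?mul1r ?mul0r ?scale0r ?E_tvec ?eqxx.
  rewrite scaler0; case: eqP => [->|_]; last by rewrite mul0r scale0r.
  by rewrite mul1r E_tvec; case: eqP.
- apply: act_sub; rewrite scale1r.
  have sz : size (res_seq (val T)) == height beta by rewrite size_res hN.
  apply: (sum_act (f := fun nu : (height beta).-tuple 'I_n => nu : seq 'I_n)
    (mu := res_seq (val T)) (j := Tuple sz)) => //.
  + exact: val_inj.
  + by apply/eqP; apply: res_seq_content.
  + by move=> nu; apply: E_tvec.
- by move=> l m _ _; apply: act_comm; rewrite !X_act.
- by move=> l nu _ _; apply: act_comm; rewrite !X_act ?scaler0.
- rewrite hN => m nu mN _; apply: act_comm.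
  rewrite E_tvec [tau m *: tvec k T]tau_tvec mN E_wvec; case: (nu =P _) => [->|ne].
    by rewrite eqxx tau_tvec mN.
  rewrite scaler0; case: eqP => // e; case: ne.
  have inv (s : seq 'I_n) : swap_adj m (swap_adj m s) = s.
    by elim: m s {mN e} => [|m IH] [|a [|b s]] //=; rewrite ?IH //; case: m IH.
  by rewrite -[nu]inv e inv.
- rewrite hN => l m lN mN lm; apply: act_comm.
  wlog lm' : l m lN mN lm / (l.+1 < m)%N.
    by move=> W; case/orP: (lm) => h; [apply: W | apply/esym/W => //; rewrite orbC].
  have [|i [j [nu e]]] := @split_at _ l (res_seq (val T)); first by rewrite size_res.
  have sp : size (take l (res_seq (val T))) = l by rewrite size_takel // size_res; lia.
  move: (take l _) e sp => pi e sp.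
  have [|a [b [mu e2]]] := @split_at _ (m - l.+2) nu.
    by have := size_res T; rewrite e size_cat sp /=; lia.
  have sp2 : size (take (m - l.+2) nu) = (m - l.+2)%N.
    by rewrite size_takel //; have := size_res T; rewrite e size_cat sp /=; lia.
  move: (take (m - l.+2) nu) e2 sp2 => pi2 e2 sp2.
  rewrite (tvec_wvec (esym e)) e2 -sp.
  have -> : m = (size pi + (size pi2).+2)%N by lia.
  exact: tau_far_wvec.
- move=> l nu i j _ /onth_split [pi [nu' [e sp]]] h2.
  have {h2} [nu2 e2] : exists nu2, nu' = j :: nu2.
    move: h2; rewrite e -sp -addn1 onth_catS; case: nu' {e} => // a nu2 [->].
    by exists nu2.
  rewrite {nu'}e2 in e; rewrite -sp; apply: act_square.
  have [h|[e' h]] := E_tvec_cases nu T; [by left | right; split; first exact: h].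
  rewrite (tvec_wvec e') e tau_wvec_at.
  have [eij|ij] := eqVneq i j.
    by rewrite eij cartan_diag /= scaler0 /Qval eqxx scale0r.
  case: eqP => [cij|/eqP cij].
    have cji : cartan j i == 0 by rewrite cartan_eq0C cij.
    by rewrite tau_wvec_at cji Qval_orth // scale1r.
  have [c [c' [q [c0 q0 -> _]]]] := Qval_adj t_ok (X (size pi)) (X (size pi).+1) ij cij.
  rewrite scaler0 free_scale_generic; apply/esym/act_poly => //; try exact: X_act.
  by rewrite absz_gt0.
- move=> l m nu i j _ /onth_split [pi [nu' [e sp]]] h2 _.
  have {h2} [nu2 e2] : exists nu2, nu' = j :: nu2.
    move: h2; rewrite e -sp -addn1 onth_catS; case: nu' {e} => // a nu2 [->].
    by exists nu2.
  rewrite {nu'}e2 in e.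
  (* The x act by 0, so the correction of the relation must vanish too; it occurs only at equal
     neighbours, which crystal words do not have. *)
  have e0 : i == j -> E nu *: tvec k T = 0.
    move=> /eqP eij; have [//|[e' _]] := E_tvec_cases nu T.
    have := res_seq_cpath (valP T); rewrite -e' e => /cpath_cat/cpath_neq.
    by rewrite eij eqxx.
  apply: act_X; [exact: X_act | exact: X_act |].
  by case: ifP => [/andP[_ /e0 h]|_]; [|case: ifP => [/andP[_ /e0 h]|_]];
    rewrite ?scaleNr ?h ?scale0r ?oppr0.
- move=> l nu i j i' _ /onth_split [pi [nu' [e sp]]] h2 h3.
  have {h2 h3} [nu2 e2] : exists nu2, nu' = [:: j, i' & nu2].
    rewrite e -sp -addn1 onth_catS in h2; rewrite e -sp -addn2 onth_catS in h3.
    move: h2 h3; by case: nu' {e} => // a [//|b nu2] [->] [->]; exists nu2.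
  rewrite {nu'}e2 in e; rewrite -sp.
  apply: act_braid; have [h|[e' h]] := E_tvec_cases nu T; [by left | right].
  rewrite (tvec_wvec e') e in h *; split=> [||/eqP ii]; [exact: h | exact: tau_braid_wvec |].
  rewrite -ii.
  have [eij|ij] := eqVneq i j; first by rewrite /Qdiff eij eqxx scale0r.
  have [cij|cij] := eqVneq (cartan i j) 0; first by rewrite Qdiff_orth // scale0r.
  have [c [c' [q [c0 q0 _ ->]]]] := Qval_adj t_ok (X (size pi)) (X (size pi).+1) ij cij.
  rewrite free_scale1_generic; apply: act_mul0; case: eqP => [c1|_].
    by rewrite not_cpath_iji // scaler0.
  by rewrite scalerDl !X_act addr0.
Qed.

Lemma cpath_last pi (i : 'I_n) : cpath (rcons pi i) -> val i = 0%N.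
Proof.
by rewrite -cats1 => /cpath_cat /=; rewrite ffunE; case: (val i =P 0%N).
Qed.

Lemma specht_cyc_mod : cyc_mod t beta S.
Proof.
split; first exact: specht_klr_mod.
move=> nu i _ hi; rewrite ffunE; case: eqP => /= i0 v.
  by rewrite expr1 X_act.
rewrite expr0 scale1r; move: v; apply: specht_act0 => T.
have [//|[e _]] := E_tvec_cases nu T; case: i0.
have := res_seq_cpath (valP T); rewrite -e.
move: hi; rewrite height_lam -(size_res T) -e.
case/lastP: nu e => // nu a e; rewrite size_rcons /= -cats1 onth_cat0 cats1 => -[->].
exact: cpath_last.
Qed.

End SpechtKLR.

Lemma scale_mul (A : pzRingType) (M : lmodType A) (a b c : A) (v : M) :
  c = a * b -> c *: v = a *: (b *: v).
Proof. by move=> ->; rewrite scalerA. Qed.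

Lemma scale_sum1 (A : pzRingType) (M : lmodType A) (J : finType) (a : A) (f : J -> M) j w :
  a *: f j = w -> (forall i, i != j -> a *: f i = 0) -> a *: (\sum_i f i) = w.
Proof. by move=> <- h; rewrite scaler_sumr (bigD1 j) //= big1 ?addr0. Qed.

Section LinearExtension.
Variables (k : fieldType) (n : nat) (lam : strict_part n).
Local Notation F := (free_alg k (klr_gen n)).
Local Notation E := (@eF k n).
Local Notation X := (xF k n).
Local Notation tau := (tauF k n).
Local Notation N := (sumn lam).
Local Notation S := (specht k lam).
Variable M : lmodType F.
Implicit Types (T : ST lam) (nu mu : seq 'I_n) (u v : S).

Definition lext (f : ST lam -> M) u : M := \sum_T (u T : k)%:A *: f T.

Lemma lextD f u v : lext f (u + v) = lext f u + lext f v.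
Proof.
rewrite /lext -big_split; apply: eq_bigr => T _.
have -> : (u + v) T = (u T + v T) :> k by rewrite ffunE.
by rewrite scalerDl scalerDl.
Qed.

Lemma lextZ f (c : k) u : lext f (c%:A *: u) = c%:A *: lext f u.
Proof.
transitivity (\sum_T c%:A *: ((u T : k)%:A *: f T)); last by rewrite -scaler_sumr.
apply: eq_bigr => T _; apply: scale_mul.
have -> : (c%:A *: u) T = c * u T :> k by rewrite genmodZ ffunE.
by rewrite mulr_algl scalerA.
Qed.

Lemma lext_tvec f T : lext f (tvec k T) = f T.
Proof.
rewrite /lext (bigD1 T) //= big1 ?addr0.
  by rewrite ffunE eqxx !scale1r.
by move=> T' h; rewrite ffunE (negbTE h) !scale0r.
Qed.

Lemma lext0 f : lext f 0 = 0.
Proof. by rewrite /lext big1 // => T _; rewrite ffunE !scale0r. Qed.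

Lemma lext_wvec f nu : lext f (wvec k lam nu) = \sum_(T | res_seq (val T) == nu) f T.
Proof.
rewrite /wvec; elim/big_rec2: _ => [|T u v _ <-]; first exact: lext0.
by rewrite lextD lext_tvec.
Qed.

Lemma lext_hom (f : ST lam -> M) (a b : F) :
  (forall T, lext f (a *: tvec k T) = b *: f T) ->
  forall u, lext f (a *: u) = b *: lext f u.
Proof.
move=> h; elim/specht_ind => [|u v hu hv|c v hv|T]; last by rewrite h lext_tvec.
- by rewrite scaler0 lext0 scaler0.
- by rewrite scalerDr !lextD hu hv scalerDr.
- by rewrite scale_algC !lextZ hv scale_algC.
Qed.

Lemma specht_hom (f : ST lam -> M) :
  (forall nu T, E nu *: f T = if nu == res_seq (val T) then f T else 0) ->
  (forall l T, X l *: f T = 0) ->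
  (forall m T, tau m *: f T = if (m.+1 < N)%N then
     \sum_(T' : ST lam | res_seq (val T') == swap_adj m (res_seq (val T))) f T' else 0) ->
  exists phi : {linear S -> M}, forall T, phi (tvec k T) = f T.
Proof.
move=> hE hX ht.
have [||g u|phi phiE] := @free_linear k _ S M (lext f).
- exact: lextD.
- by move=> c v; apply: lextZ.
- apply: lext_hom => T; case: g => [nu|[l|m]].
  + rewrite -[free_gen k _]/(E nu) hE E_tvec; case: ifP => _; [exact: lext_tvec | exact: lext0].
  + by rewrite -[free_gen k _]/(X l) hX X_act lext0.
  + rewrite -[free_gen k _]/(tau m) ht tau_tvec; case: ifP => _; [exact: lext_wvec | exact: lext0].
by exists phi => T; rewrite phiE lext_tvec.
Qed.

End LinearExtension.

(** * Reading words of the rows *)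

Section RowWords.
Variable n : nat.

(* The residues of a row of length a <= n, from right to left; letters that are
   not in ['I_n] would be skipped. *)
Fixpoint row_word (a : nat) : seq 'I_n :=
  if a is a'.+1 then (if insub a' is Some i then [:: i] else [::]) ++ row_word a' else [::].

Definition rows_word (s : seq nat) : seq 'I_n :=
  foldl (fun acc p => row_word p ++ acc) [::] s.

Lemma row_wordS a (h : (a < n)%N) : row_word a.+1 = Ordinal h :: row_word a.
Proof. by rewrite /= insubT. Qed.

Lemma count_row_word a x : (a <= n)%N ->
  count (fun i : 'I_n => val i == x) (row_word a) = (x < a)%N.
Proof.
elim: a => // a IH h; rewrite (row_wordS h) [count _ _]/= IH ?(ltnW h) //.
by rewrite /=; lia.
Qed.

Lemma rows_word_rcons s p : rows_word (rcons s p) = row_word p ++ rows_word s.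
Proof. by rewrite /rows_word -cats1 foldl_cat. Qed.

Lemma count_rows_word s x : all (fun p => p <= n)%N s ->
  count (fun i : 'I_n => val i == x) (rows_word s) = count (fun p => x < p)%N s.
Proof.
elim/last_ind: s => [//|s p IH]; rewrite all_rcons => /andP[pn /IH h].
by rewrite rows_word_rcons count_cat count_row_word // h -cats1 count_cat /= addn0 addnC.
Qed.

(** The new row is added from left to right. The hypothesis says that all rows of [nu] are longer
    than [a]; up to residue [a] their diagonals have the same length. *)
Lemma cpath_row a nu : (a <= n)%N -> cpath nu ->
  (forall x, (x <= a)%N -> count (fun i : 'I_n => val i == x) nu = count (fun i : 'I_n => val i == 0%N) nu) ->
  cpath (row_word a ++ nu).
Proof.
elim: a => // a IH h pn hc; rewrite (row_wordS h) cat_cons cpath_cons.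
rewrite IH ?(ltnW h) //=; last by move=> x xa; apply: hc; apply: leq_trans xa _.
rewrite wtw_count /= !count_cat !count_row_word ?(ltnW h) // !hc //; try lia.
by case: ifP => [/eqP a0|/eqP a0]; apply/eqP; lia.
Qed.

Lemma cpath_rows_word s : sorted gtn s -> all (fun p => p <= n)%N s -> cpath (rows_word s).
Proof.
elim/last_ind: s => [//|s p IH]; rewrite sorted_pairwise; last by move=> ? ? ? /= h1 h2; apply: ltn_trans h1.
rewrite pairwise_rcons -sorted_pairwise; last by move=> ? ? ? /= h1 h2; apply: ltn_trans h1.
rewrite all_rcons => /andP[/allP sp so] /andP[pn an]; rewrite rows_word_rcons.
apply: cpath_row => //; first exact: IH.
have H x : (x <= p)%N -> count (fun q => x < q)%N s = size s.
  move=> xp; apply/eqP; rewrite -all_count; apply/allP => q /sp /=; lia.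
by move=> x xp; rewrite !count_rows_word // !H.
Qed.

Lemma rows_word_content (lam : strict_part n) : seq_content (rows_word lam) = content lam.
Proof.
apply/ffunP => i; rewrite seq_contentE contentE -count_residue count_rows_word //.
by apply/allP => p /lam_bound/andP[].
Qed.

Lemma rows_tableau (lam : strict_part n) : exists T : ST lam, res_seq (val T) = rows_word lam.
Proof.
apply: cpath_std (rows_word_content lam); apply: cpath_rows_word (lam_sorted lam) _.
by apply/allP => p /lam_bound/andP[].
Qed.

End RowWords.

(** * Simplicity and the universal property *)

Section SpechtSimple.
Variables (k : fieldType) (n : nat) (lam : strict_part n).
Local Notation F := (free_alg k (klr_gen n)).
Local Notation E := (@eF k n).
Local Notation X := (xF k n).
Local Notation tau := (tauF k n).
Local Notation S := (specht k lam).
Implicit Types (T : ST lam) (nu mu : seq 'I_n) (u v : S).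

Lemma tvec_neq0 T : tvec k T != 0.
Proof.
apply/eqP => /(congr1 (fun u : S => u T)); rewrite !ffunE eqxx => /eqP.
by rewrite oner_eq0.
Qed.

Lemma E_res T u : E (res_seq (val T)) *: u = (u T : k)%:A *: tvec k T.
Proof.
rewrite {1}(specht_sum u); apply: (@scale_sum1 _ _ _ _ _ T) => [|T' ne].
  by rewrite scale_algC E_tvec eqxx.
rewrite scale_algC E_tvec; case: eqP => [e|_]; last by rewrite scaler0.
by case/eqP: ne; apply: val_inj; apply: res_seq_inj (valP _) (valP _) (esym e).
Qed.

Lemma submod_wconn (P : S -> Prop) T T' : is_submod P -> P (tvec k T) -> P (tvec k T').
Proof.
move=> [P0 PD PZ] PT.
have : wconn (res_seq (val T)) (res_seq (val T')).
  apply: cpath_wconn; try exact/res_seq_cpath/valP.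
  by apply: perm_seq_content; rewrite !res_seq_content.
rewrite -(wvec_tab k T').
suff H nu : wconn (res_seq (val T)) nu -> P (wvec k lam nu) by apply: H.
elim=> [|mu m h IH ms p]; first by rewrite wvec_tab.
have := PZ (tau m) _ IH.
have [|T1 e1] := cpath_std (lam := lam) (wconn_cpath (res_seq_cpath (valP T)) h).
  by rewrite (seq_content_perm (wconn_perm h)) res_seq_content.
by rewrite -e1 wvec_tab tau_tvec -(size_res T1) e1 ms.
Qed.

(** Some e(res(T)) cuts a nonzero vector down to a nonzero multiple of T, and exchanges lead from T
    to every other tableau. *)
Lemma specht_simple : simple_mod S.
Proof.
split; first by have [T _] := rows_tableau lam; exists (tvec k T); apply: tvec_neq0.
move=> P hP; have [h|/existsNP [u]] := pselect (forall v, P v -> v = 0); first by left.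
move=> /not_implyP [Pu u0]; right; case: (hP) => P0 PD PZ.
have [T uT] : exists T, (u T : k) != 0.
  apply/existsP; apply: contraT => /existsPn h; case: u0.
  by apply/ffunP => T; rewrite ffunE; have := h T; rewrite negbK => /eqP.
have PT : P (tvec k T).
  have := PZ (((u T : k)^-1)%:A) _ (PZ (E (res_seq (val T))) _ Pu).
  rewrite E_res scalerA mulr_algl scalerA mulVf //.
  by rewrite !scale1r.
by move=> v; rewrite (specht_sum v); apply: is_submod_sum => // T' _; apply/PZ/(submod_wconn T' hP PT).
Qed.

End SpechtSimple.

Section CycloVanishing.
Variables (k : fieldType) (n : nat).
Variables (t : 'I_n -> 'I_n -> nat -> nat -> k) (t_ok : klr_datum t).
Variable beta : Qplus n.
Local Notation F := (free_alg k (klr_gen n)).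
Local Notation E := (@eF k n).
Local Notation X := (xF k n).
Variables (M : lmodType F) (HM : cyc_mod t beta M).

Let R := klr_mod_rep t_ok HM.1.

Lemma cyc_vanish nu (v : M) : wv E nu v -> ~~ cpath nu -> v = 0.
Proof. by move=> h; have [_] := vanish R HM.2 (pi := [::]) (erefl (size nu)) h. Qed.

Lemma cyc_X l (v : M) : X l *: v = 0.
Proof.
rewrite -[RHS](scale0r v); move: v; apply: (wv_ext R) => nu v h; rewrite scale0r.
have [->|v0] := eqVneq v 0; first by rewrite scaler0.
have sz := wv_size R h v0.
have [ln|nl] := ltnP l (size nu); last by apply: (X_out R); rewrite -sz.
by have [hx _] := vanish R HM.2 (pi := [::]) (erefl (size nu)) h; apply: hx.
Qed.

End CycloVanishing.

Section Universal.
Variables (k : fieldType) (n : nat).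
Variables (t : 'I_n -> 'I_n -> nat -> nat -> k) (t_ok : klr_datum t).
Variable lam : strict_part n.
Local Notation F := (free_alg k (klr_gen n)).
Local Notation E := (@eF k n).
Local Notation X := (xF k n).
Local Notation tau := (tauF k n).
Local Notation S := (specht k lam).
Local Notation beta := (content lam).
Variables (M : lmodType F) (HM : cyc_mod t beta M).
Implicit Types (T : ST lam) (nu mu : seq 'I_n).

Let R := klr_mod_rep t_ok HM.1.

Lemma universal T0 (v : M) : wv E (res_seq (val T0)) v ->
  exists2 phi : {linear S -> M}, phi (tvec k T0) = v &
    exists G : seq 'I_n -> M, [/\ forall T, phi (tvec k T) = G (res_seq (val T)),
      G (res_seq (val T0)) = v &
      forall T m, (m.+1 < sumn lam)%N ->
        tau m *: G (res_seq (val T)) = G (swap_adj m (res_seq (val T)))].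
Proof.
move=> h; have [G [G0 Gw Gt]] := weight_transport R (pi := [::]) (res_seq_cpath (valP T0)) h.
have per T : perm_eq (res_seq (val T)) (res_seq (val T0)).
  by apply: perm_seq_content; rewrite !res_seq_content.
have Gt' T m : (m.+1 < sumn lam)%N ->
    tau m *: G (res_seq (val T)) = G (swap_adj m (res_seq (val T))).
  by move=> mN; apply: Gt (per T) (res_seq_cpath (valP T)) _; rewrite size_res.
have [||m T|phi phiE] := @specht_hom k n lam M (fun T => G (res_seq (val T))).
- by move=> nu T; apply: (E_wv R); apply: (Gw _ (per T)).
- by move=> l T; apply: (cyc_X t_ok HM).
- case: ifP => mN; last by apply: (tau_out R); rewrite height_lam leqNgt mN.
  rewrite Gt' //; have [p|np] := boolP (cpath (swap_adj m (res_seq (val T)))).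
    have [|T' e'] := cpath_std (lam := lam) p; first by rewrite seq_content_swap res_seq_content.
    rewrite -e' (bigD1 T') //= big1 ?addr0 // => T'' /andP[/eqP e2].
    by case/eqP; apply: val_inj; apply: res_seq_inj (valP _) (valP _) e2.
  (* No tableau has the exchanged word; on the side of [M] the vector has a weight outside the
     crystal and vanishes. *)
  rewrite big1 => [|T' /eqP e']; last by case/negP: np; rewrite -e'; apply: res_seq_cpath (valP T').
  apply: (cyc_vanish t_ok HM) np; apply: Gw; exact: perm_trans (perm_swap_adj _ _) (per T).
by exists phi; [rewrite phiE | exists G].
Qed.

End Universal.

(** * The basis of the cyclotomic algebra *)

Section ReducedWords.
Variables (n : nat) (lam : strict_part n).
Local Notation N := (sumn lam).
Implicit Types (T U Y : filling lam) (ks : seq nat) (b c : box lam).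

Lemma perm_actM (u w : 'S_N) T : perm_act (u * w)%g T = perm_act w (perm_act u T).
Proof. by apply/ffunP => b; rewrite !ffunE permM rev_ordK. Qed.

Lemma perm_act1 T : perm_act 1%g T = T.
Proof. by apply/ffunP => b; rewrite ffunE perm1 rev_ordK. Qed.

Lemma word_perm_cat ks ks' : word_perm N (ks ++ ks') = (word_perm N ks' * word_perm N ks)%g.
Proof. by elim: ks => [|m ks IH] /=; rewrite ?mulg1 // IH mulgA. Qed.

Lemma perm_act_word ks ks' T :
  perm_act (word_perm N (ks ++ ks')) T = perm_act (word_perm N ks) (perm_act (word_perm N ks') T).
Proof. by rewrite word_perm_cat perm_actM. Qed.

Lemma tab_permP (T S : ST lam) : perm_act (tab_perm T S) (val S) = val T.
Proof.
rewrite /tab_perm; case: pickP => [w /eqP //|h].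
have [gT gTK KgT] := std_bij (valP T); have [gS gSK KgS] := std_bij (valP S).
have fi : injective (fun p => rev_ord (val T (gS (rev_ord p)))).
  move=> p q /rev_ord_inj/(can_inj KgT)/(can_inj gSK).
  exact: rev_ord_inj.
have := h (perm fi); rewrite (_ : perm_act _ _ = val T) ?eqxx //.
by apply/ffunP => b; rewrite ffunE permE !rev_ordK KgS.
Qed.

(** A simple transposition reverses the order of no pair of entries but the one that it
    exchanges. *)
Lemma flip_step m Y b c : (m.+1 < N)%N -> (Y b < Y c)%N ->
  (perm_act (simple_transp N m) Y c < perm_act (simple_transp N m) Y b)%N ->
  simple_transp N m = tperm (rev_ord (Y c)) (rev_ord (Y b)).
Proof.
move=> mN lt lt'.
have E d : val (rev_ord (perm_act (simple_transp N m) Y d)) = transp m (rev_ord (Y d)).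
  by rewrite ffunE rev_ordK simple_transpE.
have := E b; have := E c; rewrite /= /transp.
move: lt'; set yb := perm_act _ _ b; set yc := perm_act _ _ c => lt'.
have hb := ltn_ord (Y b); have hc := ltn_ord (Y c).
have hb' := ltn_ord yb; have hc' := ltn_ord yc.
have [ec ec'|nec] := eqVneq (N - (Y c).+1)%N m; last first.
  by do 3?case: eqP; lia.
have [eb|neb] := eqVneq (N - (Y b).+1)%N m; first by lia.
have [eb eb'|neb1] := eqVneq (N - (Y b).+1)%N m.+1; last by lia.
rewrite /simple_transp; case: insubP => [p _ pm|]; last by rewrite (ltnW mN).
case: insubP => [q _ qm|]; last by rewrite mN.
by congr tperm; apply: val_inj; rewrite /= ?pm ?qm.
Qed.

Lemma flip_word ks Y b c : is_word N ks -> (Y b < Y c)%N ->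
  (perm_act (word_perm N ks) Y c < perm_act (word_perm N ks) Y b)%N ->
  exists ks1 m ks2, ks = ks1 ++ m :: ks2 /\
    simple_transp N m = tperm (rev_ord (perm_act (word_perm N ks2) Y c))
                              (rev_ord (perm_act (word_perm N ks2) Y b)).
Proof.
elim: ks => [|m ks IH]; first by rewrite perm_act1; lia.
case/andP=> mN wks lt; rewrite [word_perm _ _]/= perm_actM => lt'.
have [lt2|ge] := ltnP (perm_act (word_perm N ks) Y b) (perm_act (word_perm N ks) Y c).
  by exists [::], m, ks; split=> //; apply: flip_step lt'.
have [e|ne] := eqVneq (perm_act (word_perm N ks) Y b) (perm_act (word_perm N ks) Y c).
  by move: lt'; rewrite !ffunE in e *; move/rev_ord_inj/perm_inj/rev_ord_inj: e => ->; rewrite ltnn.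
have [|ks1 [m' [ks2 [-> h]]]] := IH wks lt; first by rewrite ltn_neqAle eq_sym ne.
by exists (m :: ks1), m', ks2.
Qed.

Lemma is_word_cat ks ks' : is_word N (ks ++ ks') = is_word N ks && is_word N ks'.
Proof. exact: all_cat. Qed.

(* A reduced word exchanges a given pair of boxes at most once: the two letters
   of a double exchange could be deleted. Hence a pair in the same order in [T]
   and in [U] stays in this order along the word. *)
Lemma reduced_order (T U : ST lam) ks1 ks2 b c :
  reduced_expr (tab_perm T U) (ks1 ++ ks2) -> (val U b < val U c)%N -> (val T b < val T c)%N ->
  (perm_act (word_perm N ks2) (val U) b < perm_act (word_perm N ks2) (val U) c)%N.
Proof.
case=> wk wE min Ult Tlt.
have [w1 w2] : is_word N ks1 /\ is_word N ks2 by apply/andP; rewrite -all_cat.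
set X := perm_act _ _.
have TX : val T = perm_act (word_perm N ks1) X by rewrite -perm_act_word wE tab_permP.
rewrite ltnNge; apply/negP => Xle.
have Xlt : (X c < X b)%N.
  rewrite ltn_neqAle Xle andbT; apply/eqP => /val_inj; rewrite !ffunE.
  by move/rev_ord_inj/perm_inj/rev_ord_inj => e; rewrite e ltnn in Ult.
have [a2 [m2 [c2 [e2 s2]]]] := flip_word w2 Ult Xlt.
have [|a1 [m1 [c1 [e1 s1]]]] := flip_word w1 Xlt; first by rewrite -TX.
pose w := word_perm N (c1 ++ a2).
(* Both letters exchange [b] and [c], so they are conjugate under the word between them and cancel:
   deleting both leaves a shorter expression of the same permutation. *)
have sJ : simple_transp N m1 = (simple_transp N m2 ^ w)%g.
  rewrite s1 s2 tpermJ tpermC.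
  have XE d : perm_act (word_perm N c1) X d =
      perm_act w (perm_act (simple_transp N m2) (perm_act (word_perm N c2) (val U))) d.
    by rewrite /w word_perm_cat perm_actM /X e2 perm_act_word /= perm_actM.
  by rewrite !XE ![perm_act w _ _]ffunE !rev_ordK ![perm_act (simple_transp N m2) _ _]ffunE !rev_ordK s2 tpermL tpermR tpermC.
have := min (a1 ++ (c1 ++ a2) ++ c2).
have -> : word_perm N (a1 ++ (c1 ++ a2) ++ c2) = tab_perm T U.
  have ss : (simple_transp N m2 * simple_transp N m2 = 1)%g by rewrite s2 tperm2.
  have ws : (w * simple_transp N m1 = simple_transp N m2 * w)%g.
    by rewrite sJ conjgE !mulgA mulgV mul1g.
  rewrite -wE e1 e2 !word_perm_cat /= -/(word_perm N c2) -/(word_perm N c1).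
  transitivity (word_perm N c2 * (simple_transp N m2 * (w * simple_transp N m1)) * word_perm N a1)%g.
    by rewrite ws (mulgA (simple_transp N m2)) ss mul1g /w word_perm_cat.
  by rewrite /w word_perm_cat !mulgA.
rewrite e1 e2 !is_word_cat; move: w1 w2; rewrite e1 e2 !is_word_cat /=.
case/and3P=> -> _ -> /and3P[-> _ ->] /(_ isT erefl).
by rewrite !size_cat /=; lia.
Qed.

(** Every order required in rows and columns holds in both [U] and [T], hence at each intermediate
    stage. So each tau of a reduced expression acts as an exchange of standard tableaux. *)
Lemma reduced_std (T U : ST lam) ks1 ks2 :
  reduced_expr (tab_perm T U) (ks1 ++ ks2) ->
  is_standard (perm_act (word_perm N ks2) (val U)).
Proof.
move=> red; have [g gK Kg] := std_bij (valP U).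
have [g'K Kg'] := perm_act_bij (word_perm N ks2) gK Kg.
apply: (std_intro g'K Kg') => b c h1 h2; apply: (reduced_order red).
- exact: std_row (valP U) h1 h2.
- exact: std_row (valP T) h1 h2.
- exact: std_col (valP U) h1 h2.
- exact: std_col (valP T) h1 h2.
Qed.

End ReducedWords.

Lemma sum_pair (V : nmodType) (I J : finType) (w : I * J -> V) :
  \sum_p w p = \sum_j \sum_i w (i, j).
Proof.
rewrite exchange_big (pair_bigA _ (fun i j => w (i, j))).
by apply: eq_bigr => -[].
Qed.

Lemma scale_mul2 (A : pzRingType) (M : lmodType A) (a b : A) (u v : M) :
  b *: u = v -> a *: v = (a * b) *: u.
Proof. by move=> <-; rewrite scalerA. Qed.

Section Basis.
Variables (k : fieldType) (n : nat).
Variables (t : 'I_n -> 'I_n -> nat -> nat -> k) (t_ok : klr_datum t).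
Variable lam : strict_part n.
Local Notation F := (free_alg k (klr_gen n)).
Local Notation E := (@eF k n).
Local Notation X := (xF k n).
Local Notation tau := (tauF k n).
Local Notation S := (specht k lam).
Local Notation beta := (content lam).
Local Notation N := (sumn lam).
Implicit Types (T U : ST lam) (nu mu : seq 'I_n).
Local Notation cpi := (cyclo_pi t beta (Lambda1 n)).

Lemma tau_reduced T U ks : reduced_expr (tab_perm T U) ks ->
  (\prod_(m <- ks) tau m) *: tvec k U = tvec k T.
Proof.
move=> red.
suff H ks1 ks2 (T' : ST lam) : ks = ks1 ++ ks2 -> val T' = perm_act (word_perm N ks2) (val U) ->
    (\prod_(m <- ks2) tau m) *: tvec k U = tvec k T'.
  by apply: (H [::]) => //; case: red => _ -> _; rewrite tab_permP.
elim: ks2 ks1 T' => [|m ks2 IH] ks1 T' e eT.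
  by rewrite big_nil scale1r; congr tvec; apply: val_inj; rewrite eT perm_act1.
rewrite -cat_rcons in e; have st := red; rewrite e in st; have {}st := reduced_std st.
rewrite big_cons -scalerA (IH _ (exist (fun Y => is_standard Y) _ st) e erefl) tau_tvec.
have mN : (m.+1 < N)%N.
  by case: red => /allP wk _ _; apply: wk; rewrite e mem_cat mem_rcons mem_head.
have [g gK Kg] := std_bij st.
by rewrite mN -(res_perm_act gK Kg mN) -perm_actM -[(_ * _)%g]/(word_perm N (m :: ks2)) -eT wvec_tab.
Qed.

Definition cF T U (ks : seq nat) : F :=
  E (res_seq (val T)) * (\prod_(m <- ks) tau m) * E (res_seq (val U)).

Lemma cF_act (M : lmodType F) T U ks (phi : {linear S -> M}) (v : M) :
  reduced_expr (tab_perm T U) ks -> phi (tvec k U) = E (res_seq (val U)) *: v ->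
  cF T U ks *: v = phi (tvec k T).
Proof.
move=> red e; rewrite /cF -!scalerA -e -!linearZZ (tau_reduced red) E_tvec.
by rewrite eqxx.
Qed.

Lemma cF_specht T U ks T' : reduced_expr (tab_perm T U) ks ->
  cF T U ks *: tvec k T' = if T' == U then tvec k T else 0.
Proof.
move=> red; rewrite /cF -!scalerA E_tvec.
have -> : (res_seq (val U) == res_seq (val T')) = (T' == U).
  apply/eqP/eqP => [e|->//]; apply: val_inj; exact: res_seq_inj (valP _) (valP _) (esym e).
case: eqP => [->|_]; last by rewrite !scaler0.
by rewrite (tau_reduced red) E_tvec eqxx.
Qed.

Section Regular.

(** The cyclotomic algebra as a module over the free algebra, where morphisms from S(b) can be
    applied to its unit. *)
Definition regular : lmodType F := quotm (fun f : F^o => cpi f = 0).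

Lemma cpiD f g : cpi (f + g) = cpi f + cpi g.
Proof. by rewrite /cyclo_pi klr_piD; apply: pirD. Qed.

Lemma cpiM f g : cpi (f * g) = cpi f * cpi g.
Proof. by rewrite /cyclo_pi klr_piM; apply: pirM. Qed.

Lemma cpi0 : cpi 0 = 0.
Proof. exact: (additive0 cpiD). Qed.

Lemma cpiB f g : cpi (f - g) = cpi f - cpi g.
Proof. exact: (additiveB cpiD). Qed.

Lemma cpi_sum (J : finType) (f : J -> F) : cpi (\sum_j f j) = \sum_j cpi (f j).
Proof. exact: (big_morph cpi cpiD cpi0). Qed.

Lemma cpi_eq f g : pim (fun f : F^o => cpi f = 0) f = pim _ g <-> cpi f = cpi g.
Proof.
have sub0 (h : F) : submod_gen (fun f : F^o => cpi f = 0) h <-> cpi h = 0.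
  split=> [|h0]; last exact: SubmodIn.
  elim=> [//||x y _ hx _ hy|a x _ hx]; first exact: cpi0.
    by rewrite cpiD hx hy addr0.
  by rewrite -[a *: x]/(a * x) cpiM hx mulr0.
split=> [/piz_eq/sub0|e]; first by rewrite cpiB => /eqP; rewrite subr_eq0 => /eqP.
by apply/piz_eq/sub0; rewrite cpiB e subrr.
Qed.

Lemma regular_cyc : cyc_mod t beta regular.
Proof.
apply/is_cyclo_modP => f f0 v; rewrite -[v]reprmK -pim_scale.
have -> : (0 : regular) = pim _ (0 : F^o) by [].
by apply/cpi_eq; rewrite -[f *: _]/(f * _) cpiM f0 mul0r cpi0.
Qed.

Definition reg1 : regular := pim _ (1 : F^o).

Lemma regE f : f *: reg1 = pim _ (f : F^o).
Proof. by rewrite -pim_scale -[f *: _]/(f * _) mulr1. Qed.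

Lemma cpi_act f g : f *: reg1 = g *: reg1 -> cpi f = cpi g.
Proof. by rewrite !regE => /cpi_eq. Qed.

Lemma cpi_specht f g : cpi f = cpi g -> forall u : S, f *: u = g *: u.
Proof.
move=> e u; apply/eqP; rewrite -subr_eq0 -scalerBl; apply/eqP.
have /is_cyclo_modP := specht_cyc_mod t_ok lam; apply.
by rewrite -/(cpi (f - g)) cpiB e subrr.
Qed.

End Regular.

Let R := klr_mod_rep t_ok regular_cyc.1.

(** The idempotents of all other words act by 0 on a cyclotomic module. *)
Lemma E_sum_ST (M : lmodType F) : cyc_mod t beta M ->
  forall v : M, v = \sum_(T : ST lam) E (res_seq (val T)) *: v.
Proof.
move=> HM v; have RM := klr_mod_rep t_ok HM.1.
rewrite -scaler_suml -[LHS]scale1r; move: v; apply: (wv_ext RM) => nu v h.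
rewrite scale1r scaler_suml; have [->|v0] := eqVneq v 0.
  by rewrite big1 // => T _; rewrite scaler0.
have p : cpath nu by apply: contraT => /(cyc_vanish t_ok HM h) v00; rewrite v00 eqxx in v0.
have [hb|/(wv_out RM h) v00] := eqVneq (seq_content nu) beta; last by rewrite v00 eqxx in v0.
have [T e] := cpath_std p hb.
rewrite (bigD1 T) //= e h big1 ?addr0 // => T' ne; rewrite (E_wv RM _ h).
case: eqP => // e'; case/eqP: ne; apply: val_inj; apply: res_seq_inj (valP _) (valP _) _.
by rewrite e'.
Qed.

Lemma univ_reg U : exists phi : {linear S -> regular}, phi (tvec k U) = E (res_seq (val U)) *: reg1.
Proof.
have h : wv E (res_seq (val U)) (E (res_seq (val U)) *: reg1) by apply: (wvE R).
by have [phi e _] := universal t_ok regular_cyc h; exists phi.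
Qed.

(** c_{T,U} is the image of T under the morphism from S(b) to the algebra that sends U to e(res(U));
    the reduced expression does not enter. *)
Lemma c_elt_indep T U ks ks' : reduced_expr (tab_perm T U) ks ->
  reduced_expr (tab_perm T U) ks' ->
  c_elt t beta (Lambda1 n) T U ks = c_elt t beta (Lambda1 n) T U ks'.
Proof.
move=> r r'; have [phi e] := univ_reg U.
exact: cpi_act (etrans (cF_act r e) (esym (cF_act r' e))).
Qed.

Lemma c_elt_basis (ks : ST lam -> ST lam -> seq nat) :
  (forall T U, reduced_expr (tab_perm T U) (ks T U)) ->
  cyclo_basis (fun TU : ST lam * ST lam => c_elt t beta (Lambda1 n) TU.1 TU.2 (ks TU.1 TU.2)).
Proof.
move=> red y.
have [f ->] : exists f, y = cpi f.
  by exists (reprz (reprz y)); rewrite /cyclo_pi /klr_pi !reprrK.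
pose g (a : {ffun ST lam * ST lam -> k}) : F :=
  \sum_(TU : ST lam * ST lam) (a TU)%:A * cF TU.1 TU.2 (ks TU.1 TU.2).
have gE (a : {ffun ST lam * ST lam -> k}) : \sum_(TU : ST lam * ST lam)
    cpi (a TU)%:A * c_elt t beta (Lambda1 n) TU.1 TU.2 (ks TU.1 TU.2) = cpi (g a).
  by rewrite cpi_sum; apply: eq_bigr => TU _; apply/esym/cpiM.
have gS (a : {ffun ST lam * ST lam -> k}) T U : (g a *: tvec k U : S) T = a (T, U).
  rewrite scaler_suml.
  rewrite (eq_bigr (fun TU => if TU.2 == U then (a TU)%:A *: tvec k TU.1 else 0)); last first.
    move=> TU _; rewrite -scalerA (cF_specht _ (red _ _)) (eq_sym U).
    by case: (_ == _); rewrite ?scaler0.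
  rewrite -big_mkcond sum_ffunE (bigD1 (T, U)) //= big1.
    by rewrite addr0 genmodZ !ffunE eqxx [_ *: _]mulr1.
  move=> [T' U'] /andP[/eqP /= eU ne]; rewrite genmodZ !ffunE.
  by case: eqP => [e|_]; [rewrite e eU eqxx in ne | rewrite [_ *: _]mulr0].
(* c_{T,U} acts on S(b) as the matrix unit sending U to T, so the coefficients must be the matrix of
   [f]; this also gives uniqueness. *)
pose a0 : {ffun ST lam * ST lam -> k} := [ffun TU => (f *: tvec k TU.2 : S) TU.1 : k].
have a0E T U : a0 (T, U) = (f *: tvec k U : S) T by rewrite ffunE.
exists a0; split.
  (* The unit is the sum of the e(res(U)), and f e(res(U)) is the image of f U under the morphism of
     [univ_reg], which sends T to c_{T,U}. *)
  rewrite gE; apply: cpi_act.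
  rewrite {1}(E_sum_ST regular_cyc reg1) scaler_sumr /g scaler_suml.
  apply: etrans _ (esym (sum_pair _)).
  apply: eq_bigr => U _; have [phi e] := univ_reg U.
  rewrite -e -linearZZ {1}(specht_sum (f *: tvec k U)) linear_sum; apply: eq_bigr => T _.
  by rewrite linearZZ a0E; apply: scale_mul2; rewrite (cF_act (red T U) e).
move=> a; rewrite gE => /cpi_specht h; apply/ffunP => -[T U].
by rewrite a0E h gS.
Qed.

End Basis.

(** * Weights of strict partitions *)

Section Weights.
Variable n : nat.
Implicit Types (nu mu : seq 'I_n) (beta gamma : Qplus n) (lam : strict_part n).

Lemma QrootD beta gamma : Qroot (beta + gamma) = Qroot beta + Qroot gamma.
Proof. by rewrite /Qroot -big_split; apply: eq_bigr => i _; rewrite ffunE mulrnDr. Qed.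

Lemma Qroot_alpha i : Qroot (@alpha n i) = root i.
Proof.
rewrite /Qroot (bigD1 i) //= ffunE eqxx big1 ?addr0 // => j ji.
by rewrite ffunE eq_sym (negbTE ji).
Qed.

Lemma wtw_Qroot nu : wtw nu = Lambda1 n - Qroot (seq_content nu).
Proof.
elim: nu => [|i nu IH].
  by rewrite /seq_content big_nil /Qroot big1 ?subr0 // => i _; rewrite ffunE.
by rewrite [LHS]/= -/(wtw nu) IH seq_content_cons QrootD Qroot_alpha opprD addrAC addrA.
Qed.

Lemma content_word beta : exists nu, seq_content nu = beta.
Proof.
exists (flatten [seq nseq (beta i) i | i <- enum 'I_n]); apply/ffunP => j.
rewrite seq_contentE count_flatten -map_comp sumnE big_map big_enum (bigD1 j) //=.
rewrite count_nseq /= eqxx mul1n big1 ?addn0 // => i ij.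
by rewrite count_nseq /= (negbTE ij).
Qed.

(** From the short node on, the pairings give the differences of consecutive letter counts; the
    counts then follow downwards from the index n, where they are 0. *)
Lemma wtw_inj nu mu : wtw nu = wtw mu -> seq_content nu = seq_content mu.
Proof.
move=> h; pose c (s : seq 'I_n) x := count (fun a => val a == x) s.
have w (i : 'I_n) := etrans (esym (wtw_count nu i)) (etrans (congr1 (fun f : weight n => f i) h) (wtw_count mu i)).
have e x : (x < n)%N -> (c nu x)%:Z - (c nu x.+1)%:Z = (c mu x)%:Z - (c mu x.+1)%:Z.
  elim: x => [|x IH] xn; have := w (Ordinal xn); rewrite /= -!/(c _ _).
    by lia.
  by have := IH (ltnW xn); lia.
have d x : c nu (n - x)%N = c mu (n - x)%N.
  elim: x => [|x IH]; first by rewrite /c !count_out ?subn0.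
  have [xn|nx] := ltnP x n; last by rewrite (_ : n - x.+1 = n - x)%N //; lia.
  by have := e (n - x.+1)%N; rewrite (_ : (n - x.+1).+1 = n - x)%N; lia.
apply/ffunP => i; rewrite !seq_contentE -!count_residue.
by have := d (n - i)%N; rewrite subKn // ltnW.
Qed.

Lemma Qroot_inj beta gamma : Qroot beta = Qroot gamma -> beta = gamma.
Proof.
have [nu <-] := content_word beta; have [mu <-] := content_word gamma => h.
by apply: wtw_inj; rewrite !wtw_Qroot h.
Qed.

Lemma wtE lam : wt lam = Lambda1 n - Qroot (content lam).
Proof.
rewrite /wt; congr (_ - _); rewrite /content.
rewrite (big_morph _ QrootD (_ : Qroot 0 = 0)); last first.
  by rewrite /Qroot big1 // => i _; rewrite ffunE.
by apply: eq_bigr => b _; rewrite Qroot_alpha.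
Qed.

Lemma wtw_wt lam nu : seq_content nu = content lam -> wtw nu = wt lam.
Proof. by move=> h; rewrite wtw_Qroot h wtE. Qed.

(** A diagonal exceeds the next one by 1 exactly when the corresponding length is a part ([dlS]):
    the parts are the negative coordinates. *)
Lemma wt_sgn lam : wt lam = sgn_wt n (fun x => x.+1 \in (lam : seq nat)).
Proof.
rewrite -(wtw_wt (rows_word_content lam)); apply/ffunP => i; rewrite wtw_count ffunE.
have an : all (fun p => p <= n)%N lam by apply/allP => p /lam_bound/andP[].
rewrite !count_rows_word // -!/(dl lam _) [in RHS]mulr2n.
case: i => [[|a] Ha] /=; first by have := dlS lam 0; case: (1%N \in (lam : seq nat)) => ->; lia.
have := dlS lam a; have := dlS lam a.+1.
by case: (a.+1 \in (lam : seq nat)); case: (a.+2 \in (lam : seq nat)); lia.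
Qed.

Lemma sgn_lam (e : nat -> bool) : exists lam, wt lam = sgn_wt n e.
Proof.
pose s := rev [seq x.+1 | x <- iota 0 n & e x].
have ss : is_strict n s.
  rewrite /is_strict rev_sorted all_rev; apply/andP; split.
    rewrite sorted_map; apply: (@sorted_filter _ _ _ _ _ (iota_ltn_sorted 0 n)).
    by move=> y x z /=; apply: ltn_trans.
  by apply/allP => p /mapP [x]; rewrite mem_filter mem_iota => /andP[_ h] ->.
exists (StrictPart ss); rewrite wt_sgn; apply/ffunP => i; rewrite !ffunE /=.
have mE x : (x < n)%N -> (x.+1 \in s) = e x.
  move=> xn; rewrite mem_rev mem_map; last by move=> ? ? [].
  by rewrite mem_filter mem_iota add0n xn /= andbT.
have i_n := ltn_ord i; rewrite !mE //; try lia.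
Qed.

Lemma wt_lambda_of (b : weight n) : weyl_orbit (Lambda1 n) b -> wt (lambda_of b) = b.
Proof.
move=> /orbit_sgn [e ->]; have [lam h] := sgn_lam e.
exact: (@classical_sets.xgetPex _ _ (fun lam => wt lam = sgn_wt n e) (ex_intro _ lam h)).
Qed.

Lemma content_lambda_of (b : weight n) beta : weyl_orbit (Lambda1 n) b ->
  Lambda1 n - Qroot beta = b -> content (lambda_of b) = beta.
Proof.
move=> /wt_lambda_of h e; apply: Qroot_inj; apply/oppr_inj/(addrI (Lambda1 n)).
by rewrite -wtE h e.
Qed.

Lemma orbit_reflection i (b : weight n) : weyl_orbit (Lambda1 n) b ->
  weyl_orbit (Lambda1 n) (reflection i b).
Proof. by case=> w ->; exists (i :: w). Qed.

Lemma content_ftilde i (b : weight n) : weyl_orbit (Lambda1 n) b -> b i = 1 ->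
  content (lambda_of (b - root i)) = alpha i + content (lambda_of b).
Proof.
move=> ob bi; have := orbit_reflection i ob; rewrite /reflection bi mulr1z => ob'.
apply: content_lambda_of => //.
by rewrite QrootD Qroot_alpha opprD addrCA -wtE wt_lambda_of // addrC.
Qed.

Lemma content_etilde i (b : weight n) : weyl_orbit (Lambda1 n) b -> b i = -1 ->
  content (lambda_of b) = alpha i + content (lambda_of (b + root i)).
Proof.
move=> ob bi; have := orbit_reflection i ob; rewrite /reflection bi mulrNz mulr1z opprK => ob'.
have := @content_ftilde i _ ob'; rewrite addrK; apply.
by rewrite !ffunE bi cartan_diag.
Qed.

End Weights.

Lemma sum_act1 (A : pzRingType) (M : lmodType A) (J : finType) (P : pred J) (e : J -> A)
    (j : J) (v : M) : P j -> e j *: v = v -> (forall i, i != j -> e i *: v = 0) ->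
  (\sum_(i | P i) e i) *: v = v.
Proof.
move=> Pj h h0; rewrite scaler_suml (bigD1 j) //= h big1 ?addr0 // => i /andP[_].
exact: h0.
Qed.

Lemma free_scale_act (k : fieldType) (G : choiceType) (M : lmodType (free_alg k G))
    (c : k) (f : free_alg k G) (v : M) :
  (c *: f) *: v = c%:A *: (f *: v).
Proof. by rewrite free_scaleE -scalerA. Qed.

Lemma sum_fix (A : pzRingType) (M : lmodType A) (J : finType) (a : A) (f : J -> M) :
  (forall j, a *: f j = f j) -> a *: (\sum_j f j) = \sum_j f j.
Proof. by move=> h; rewrite scaler_sumr; apply: eq_bigr. Qed.

Lemma lext_fix (k : fieldType) (n : nat) (lam : strict_part n)
    (M : lmodType (free_alg k (klr_gen n))) (a : free_alg k (klr_gen n))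
    (f : ST lam -> M) u :
  (forall T, a *: f T = f T) -> a *: lext f u = lext f u.
Proof.
by move=> h; apply: sum_fix => T; apply: etrans (scale_algC _ _ _) _; rewrite h.
Qed.

(** * Restriction and induction *)

Section Pairs.
Variables (k : fieldType) (n : nat).
Local Notation F := (free_alg k (klr_gen n)).
Local Notation E := (@eF k n).
Implicit Types (nu mu a b : seq 'I_n) (beta gamma : Qplus n).
Variable M : lmodType F.

Lemma e_pair_id beta gamma a b (v : M) : seq_content a = beta -> seq_content b = gamma ->
  (forall mu, E mu *: v = if mu == a ++ b then v else 0) -> e_pair k beta gamma *: v = v.
Proof.
move=> ha hb h.
have sa : size a == height beta by rewrite -ha height_content.
have sb : size b == height gamma by rewrite -hb height_content.
have inner (nu : (height beta).-tuple 'I_n) :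
    (\sum_(nu' : (height gamma).-tuple 'I_n | in_Ibeta gamma nu') E (nu ++ nu')) *: v =
    if nu == Tuple sa then v else 0.
  case: eqP => [->|ne].
    apply: (sum_act (f := fun nu' : (height gamma).-tuple 'I_n => a ++ nu')
      (mu := a ++ b) (j := Tuple sb)) => //; last exact/eqP.
    by move=> x y /eqP; rewrite eqseq_cat // eqxx => /eqP/val_inj.
  apply: sum_act0 => nu' _; rewrite h; case: eqP => // /eqP.
  rewrite eqseq_cat; last by rewrite size_tuple (eqP sa).
  by case/andP=> /eqP e _; case: ne; apply: val_inj.
apply: (@sum_act1 _ _ _ _ _ (Tuple sa)); first exact/eqP.
  by rewrite inner eqxx.
by move=> nu ne; rewrite inner (negbTE ne).
Qed.

Lemma e_pair_0 beta gamma (v : M) :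
  (forall a b, seq_content a = beta -> seq_content b = gamma -> E (a ++ b) *: v = 0) ->
  e_pair k beta gamma *: v = 0.
Proof.
move=> h; apply: sum_act0 => nu /eqP hn; apply: sum_act0 => nu' /eqP hn'.
exact: h.
Qed.

End Pairs.

Section Prefix.
Variables (k : fieldType) (n : nat) (lam lam' : strict_part n) (pi : seq 'I_n).
Hypothesis lamE : content lam' = seq_content pi + content lam.
Local Notation F := (free_alg k (klr_gen n)).
Local Notation E := (@eF k n).
Local Notation X := (xF k n).
Local Notation tau := (tauF k n).
Local Notation S := (specht k lam).
Local Notation S' := (specht k lam').
Implicit Types (T : ST lam) (nu mu : seq 'I_n) (u v : S).

(** Writes [pi] in front of every word. With one letter it gives the branching rules, with the word
    of a row the map out of the convolution product. *)
Definition iota_pre u : S' := lext (fun T => wvec k lam' (pi ++ res_seq (val T))) u.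

Lemma iota_preD u v : iota_pre (u + v) = iota_pre u + iota_pre v.
Proof. exact: lextD. Qed.

Lemma iota_preZ c u : iota_pre (c%:A *: u) = c%:A *: iota_pre u.
Proof. exact: lextZ. Qed.

Lemma iota_pre0 : iota_pre 0 = 0. Proof. exact: lext0. Qed.

Lemma iota_tvec T : iota_pre (tvec k T) = wvec k lam' (pi ++ res_seq (val T)).
Proof. exact: lext_tvec. Qed.

Lemma Qplus_addI (a b c : Qplus n) : a + b = a + c -> b = c.
Proof.
move=> h; apply/ffunP => i; move/(congr1 (fun f : Qplus n => f i)): h.
by rewrite !ffunE => /addnI.
Qed.

(** A suffix of a crystal word is a crystal word, so [nu] is a word of [lam] whenever its extension
    is a word of [lam']. *)
Lemma iota_wvec nu : iota_pre (wvec k lam nu) = wvec k lam' (pi ++ nu).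
Proof.
have [w0|[T <- ->]] := wvec_cases k lam nu; last exact: iota_tvec.
rewrite w0 iota_pre0 wvec_out //; apply/negP => /andP[p /eqP hc].
have [|T e] := cpath_std (lam := lam) (cpath_cat p).
  by apply: (@Qplus_addI (seq_content pi)); rewrite -lamE -hc seq_content_cat.
by have := tvec_neq0 k T; rewrite -wvec_tab e w0 eqxx.
Qed.

Lemma iota_E nu u : iota_pre (E nu *: u) = E (pi ++ nu) *: iota_pre u.
Proof.
elim/specht_ind: u => [|u v hu hv|c u hu|T].
- by rewrite !(iota_pre0, scaler0).
- by rewrite scalerDr !iota_preD hu hv scalerDr.
- by rewrite scale_algC !iota_preZ hu scale_algC.
rewrite E_tvec iota_tvec E_wvec eqseq_cat // eqxx /=.
by case: ifP => _; [exact: iota_tvec | exact: iota_pre0].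
Qed.

Lemma iota_tau m u : iota_pre (tau m *: u) = tau (size pi + m) *: iota_pre u.
Proof.
elim/specht_ind: u => [|u v hu hv|c u hu|T].
- by rewrite !(iota_pre0, scaler0).
- by rewrite scalerDr !iota_preD hu hv scalerDr.
- by rewrite scale_algC !iota_preZ hu scale_algC.
have sz := size_res T; have [mN|Nm] := ltnP m.+1 (sumn lam); last first.
  rewrite (tau_out_specht _ Nm) iota_pre0 tau_out_specht //.
  rewrite -[sumn lam']height_lam lamE heightD height_content height_lam; lia.
have [|i [j [nu e]]] := @split_at _ m (res_seq (val T)); first by rewrite sz.
have sm : size (take m (res_seq (val T))) = m by rewrite size_takel // sz; lia.
move: (take m _) e sm => mu e sm.
rewrite -wvec_tab e iota_wvec -{1}sm tau_wvec_at catA -sm -size_cat tau_wvec_at.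
by case: ifP => _; rewrite ?iota_pre0 // iota_wvec catA.
Qed.

End Prefix.

Section Shift.
Variables (k : fieldType) (n : nat) (lam lam' : strict_part n) (i : 'I_n).
Hypothesis lamE : content lam' = alpha i + content lam.
Local Notation F := (free_alg k (klr_gen n)).
Local Notation E := (@eF k n).
Local Notation S := (specht k lam).
Local Notation S' := (specht k lam').
Implicit Types (T : ST lam) (nu mu : seq 'I_n) (u v : S).

Lemma alpha_content : seq_content [:: i] = alpha i.
Proof. by rewrite /seq_content big_seq1. Qed.

Let lamE' : content lam' = seq_content [:: i] + content lam.
Proof. by rewrite alpha_content. Qed.

Local Notation iota := (@iota_pre k n lam lam' [:: i]).

Lemma iota_gen g u : iota (free_gen k g *: u) = shift_gen k i g *: iota u.
Proof.
case: g => [nu|[l|m]]; first exact: iota_E.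
  by rewrite -[free_gen k _]/(xF k n l) X_act iota_pre0 X_act.
exact: (iota_tau lamE' m u).
Qed.

Lemma iota_shift (f : F) u : iota (f *: u) = free_map (shift_gen k i) f *: iota u.
Proof.
elim/free_ind: f u => [|g f IH|f h IHf IHh|c f IH] u.
- by rewrite free_map1 !scale1r.
- by rewrite free_mapM free_map_gen -!scalerA iota_gen IH.
- by rewrite free_mapD !scalerDl iota_preD IHf IHh.
- rewrite free_mapZ (free_scale_act c f u) iota_preZ IH.
  exact/esym/free_scale_act.
Qed.

Lemma iota_epair u : e_pair k (alpha i) (content lam) *: iota u = iota u.
Proof.
apply: lext_fix => T; apply: (e_pair_id (a := [:: i]) (b := res_seq (val T))).
- exact: alpha_content.
- exact: res_seq_content.
- by move=> mu; apply: E_wvec.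
Qed.

Lemma iota_tvec_head (T' : ST lam') : (exists nu, res_seq (val T') = i :: nu) ->
  exists T, iota (tvec k T) = tvec k T'.
Proof.
case=> nu e; have [||T eT] := @cpath_std n lam nu.
- by have := res_seq_cpath (valP T'); rewrite e => /andP[].
- apply: (@Qplus_addI _ (alpha i)); rewrite -lamE -seq_content_cons -e.
  exact: res_seq_content.
by exists T; rewrite iota_tvec eT -[_ ++ _]/(i :: nu) -e wvec_tab.
Qed.

End Shift.

Section CornerLemmas.
Variables (k : fieldType) (G : choiceType) (M : lmodType (free_alg k G)).
Variables (e : free_alg k G) (h : G -> free_alg k G).
Local Notation C := (corner_mod M e h).
Local Notation cval := (fun v : C => @corner_val k G M e v : M).

Lemma corner_inj (u v : C) : cval u = cval v -> u = v.
Proof. exact: val_inj. Qed.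

Lemma corner_valD (u v : C) : cval (u + v) = cval u + cval v.
Proof. by []. Qed.

Lemma corner_valZ (c : k) (u : C) : cval (c%:A *: u) = c%:A *: cval u.
Proof. by rewrite genmodZ. Qed.

Lemma corner_val_gen g (u : C) : cval (free_gen k g *: u) = e *: (h g *: cval u).
Proof. by rewrite genmod_gen. Qed.

Lemma corner_iso (S : lmodType (free_alg k G)) (f : S -> M) :
  {morph f : u v / u + v} -> (forall (c : k) v, f (c%:A *: v) = c%:A *: f v) ->
  (forall g v, f (free_gen k g *: v) = h g *: f v) ->
  (forall v, e *: f v = f v) -> (forall v, f v = 0 -> v = 0) ->
  (forall w, exists v, f v = e *: w) -> lmod_iso C S.
Proof.
move=> fD fZ fG fe f0 fs.
pose F u : C := Corner (corner_opP e 1 (f u)).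
have FE u : cval (F u) = f u by rewrite /= scale1r fe.
apply: lmod_iso_sym.
have [|||H HE] := @free_linear k G S C F.
- by move=> u v; apply: corner_inj; rewrite corner_valD !FE fD.
- by move=> c v; apply: corner_inj; rewrite corner_valZ !FE fZ.
- by move=> g v; apply: corner_inj; rewrite corner_val_gen !FE -fG fe.
apply: (@linear_iso _ _ _ H) => [v|w].
  by rewrite HE => /(congr1 cval); rewrite FE => /f0.
have [u wE] : exists u : M, cval w = e *: u by case: w => w /= /asboolP.
by have [v vE] := fs u; exists v; apply: corner_inj; rewrite HE FE vE wE.
Qed.

Lemma corner_triv : (forall w : M, e *: w = 0) -> forall v : C, v = 0.
Proof.
move=> h0 v; apply: corner_inj; case: v => w /= /asboolP [u ->].
exact: h0.
Qed.

End CornerLemmas.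

Section Restriction.
Variables (k : fieldType) (n : nat) (i : 'I_n).
Local Notation F := (free_alg k (klr_gen n)).
Local Notation E := (@eF k n).

Lemma e_res_add (beta : Qplus n) : e_res k (alpha i + beta) i = e_pair k (alpha i) beta.
Proof.
rewrite /e_res !ffunE eqxx /=; congr (e_pair _ _ _); apply/ffunP => j.
by rewrite !ffunE addKn.
Qed.

Lemma E_pair_alpha (M : lmodType F) (beta : Qplus n) (v : M) :
  (forall nu, seq_content nu = beta -> E (i :: nu) *: v = 0) ->
  e_pair k (alpha i) beta *: v = 0.
Proof.
move=> h; apply: e_pair_0 => a b ha hb.
have sa : size a = 1%N by rewrite -(height_content a) ha height_alpha.
case: a ha sa => [//|j [|//]] ha _.
suff -> : j = i by apply: h.
apply/eqP; move/(congr1 (fun f : Qplus n => f i)): ha.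
by rewrite seq_contentE /= ffunE eqxx addn0; case: eqP.
Qed.

Section Extend.
Variables (lam lam' : strict_part n).
Hypothesis lamE : content lam' = alpha i + content lam.
Hypothesis wti : wt lam i = 1.
Local Notation iota := (@iota_pre k n lam lam' [:: i]).

Lemma extend_tableau (T : ST lam) : exists T' : ST lam', res_seq (val T') = i :: res_seq (val T).
Proof.
apply: cpath_std; last by rewrite seq_content_cons res_seq_content lamE.
by rewrite cpath_cons (res_seq_cpath (valP T)) (wtw_wt (res_seq_content (val T))) wti eqxx.
Qed.

Lemma iota_tvec_neq0 T : iota (tvec k T) != 0.
Proof.
have [T' e] := extend_tableau T.
by rewrite iota_tvec -[_ ++ _]/(i :: _) -e wvec_tab tvec_neq0.
Qed.

(** The kernel is a submodule of a simple module and misses a tableau vector, because [i] is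
    addable. *)
Lemma iota_inj u : iota u = 0 -> u = 0.
Proof.
have hN : is_submod (fun u => iota u = 0).
  apply: free_submod => [|u' v hu hv|c v hv|g v hv].
  - exact: iota_pre0.
  - by rewrite iota_preD hu hv addr0.
  - by rewrite iota_preZ hv scaler0.
  - by rewrite (iota_gen lamE) hv scaler0.
case: (specht_simple k lam) => _ /(_ _ hN) [|h]; first exact.
have [T _] := rows_tableau lam.
by have := iota_tvec_neq0 T; rewrite h eqxx.
Qed.

Lemma iota_surj (w : specht k lam') : exists u, iota u = e_res k (content lam') i *: w.
Proof.
rewrite lamE e_res_add.
elim/specht_ind: w => [|u v [u' hu] [v' hv]|c v [v' hv]|T].
- by exists 0; rewrite iota_pre0 scaler0.
- by exists (u' + v'); rewrite iota_preD hu hv scalerDr.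
- by exists (c%:A *: v'); rewrite iota_preZ hv scale_algC.
have [[nu e]|h] := pselect (exists nu, res_seq (val T) = i :: nu).
  have [T1 <-] := iota_tvec_head k lamE (ex_intro _ nu e).
  by exists (tvec k T1); rewrite iota_epair.
exists 0; rewrite iota_pre0; apply/esym/E_pair_alpha => nu _.
by rewrite E_tvec; case: eqP => // e; case: h; exists nu.
Qed.

Lemma restriction_iso :
  lmod_iso (Ecyclo (content lam') i (specht k lam')) (specht k lam).
Proof.
apply: (@corner_iso _ _ _ _ _ _ iota).
- exact: iota_preD.
- exact: iota_preZ.
- by move=> g v; apply: iota_gen.
- by move=> v; rewrite lamE e_res_add iota_epair.
- exact: iota_inj.
- exact: iota_surj.
Qed.

End Extend.

(** A word of [lam] that starts with [i] forces the weight 1 - 2 = -1 at [i]. *)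
Lemma restriction_triv (lam : strict_part n) : wt lam i != - 1 ->
  forall v : Ecyclo (content lam) i (specht k lam), v = 0.
Proof.
move=> h; apply: corner_triv => w; rewrite /e_res; case: ifP => [c0|_]; last by rewrite scale0r.
apply: E_pair_alpha => nu hnu; move: w; apply: specht_act0 => T; rewrite E_tvec.
case: eqP => // e; case/eqP: h; have p := res_seq_cpath (valP T).
have cT := res_seq_content (val T); rewrite -(wtw_wt cT).
move: p; rewrite -e cpath_cons => /andP[_ /eqP hi].
by rewrite wtwS hi cartan_diag.
Qed.

End Restriction.

Section MonomialModule.
Variables (A : nzRingType) (C : choiceType).
Local Notation L := {malg A[C]}.

Lemma malg_lift (N : lmodType A) (f : C -> N) :
  exists g : {linear L -> N}, forall c, g << c >> = f c.
Proof.
pose g (x : L) := \sum_(c <- msupp x) x@_c *: f c.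
have gE (d : {fset C}) x : (msupp x `<=` d)%fset -> g x = \sum_(c <- d) x@_c *: f c.
  move=> le; rewrite /g (big_fset_incl _ le) => //= c _ /mcoeff_outdom ->.
  by rewrite scale0r.
have [|h hE] := @mk_linear A L N g.
  move=> a u v; pose d := (msupp u `|` msupp v)%fset.
  rewrite (gE d); last first.
    apply: fsubset_trans (msuppD_le _ _) _.
    by rewrite fsetSU ?msuppZ_le.
  rewrite (gE d u) ?fsubsetUl // (gE d v) ?fsubsetUr // scaler_sumr -big_split.
  by apply: eq_bigr => c _; rewrite mcoeffD mcoeffZ scalerDl scalerA.
exists h => c; rewrite hE (gE [fset c]%fset) ?msuppU_le // big_seq_fset1.
by rewrite mcoeffUU scale1r.
Qed.

Lemma malg_gen (P : L -> Prop) : is_submod P -> (forall c, P << c >>) -> forall x, P x.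
Proof.
move=> hP h x; rewrite (monalgE x); apply: is_submod_sum => // c _.
rewrite malgU_scale; by case: hP => _ _; apply.
Qed.

End MonomialModule.

Section FreeMonomial.
Variables (k : fieldType) (G C : choiceType).
Local Notation F := (free_alg k G).

Lemma presented_gen (X : {malg F[C]} -> Prop) (P : quotm X -> Prop) : is_submod P ->
  (forall c, P (pim X << c >>)) -> forall x, P x.
Proof.
move=> [P0 PD PZ] h x; rewrite -[x]reprmK.
apply: (@malg_gen F C (fun y => P (pim X y))) => //; split=> // [y z|a y] hy.
  by move=> hz; rewrite pimD; apply: PD.
by rewrite pim_scale; apply: PZ.
Qed.

Lemma presented_lift (X : {malg F[C]} -> Prop) (N : lmodType F) (f : C -> N) :
  (forall g : {linear {malg F[C]} -> N}, (forall c, g << c >> = f c) ->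
     forall x, X x -> g x = 0) ->
  exists g : {linear quotm X -> N}, forall c, g (pim X << c >>) = f c.
Proof.
move=> h; have [g gE] := malg_lift f; have [g' g'E] := quotm_lift (h g gE).
by exists g' => c; rewrite g'E gE.
Qed.

End FreeMonomial.

Lemma pim_eq (A : pzRingType) (M : lmodType A) (X : M -> Prop) y z :
  X (y - z) -> pim X y = pim X z.
Proof. by move=> h; apply/piz_eq; apply: SubmodIn. Qed.

Section Induction.
Variables (k : fieldType) (n : nat).
Variables (t : 'I_n -> 'I_n -> nat -> nat -> k) (t_ok : klr_datum t).
Variable i : 'I_n.
Local Notation F := (free_alg k (klr_gen n)).
Local Notation E := (@eF k n).

Section Presentation.
Variables (beta : Qplus n) (M : lmodType F).
Local Notation rel := (@ind_rel k n t (Lambda1 n) beta i M).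
Local Notation D := (Fcyclo t (Lambda1 n) beta i M).

Definition ind_elt (u : M) : D := pim rel << u >>.

Lemma ind_cyc_mod : cyc_mod t (alpha i + beta) D.
Proof.
apply/is_cyclo_modP => f f0 v; rewrite -[v]reprmK -(pim_scale rel); apply/pim_eq0.
exact/SubmodIn/IndCyclo.
Qed.

Lemma ind_eltD u v : ind_elt (u + v) = ind_elt u + ind_elt v.
Proof.
rewrite /ind_elt -(pimD rel); apply: pim_eq; rewrite opprD addrA; exact: IndD.
Qed.

Lemma ind_eltE u : e_pair k (alpha i) beta *: ind_elt u = ind_elt u.
Proof. by rewrite /ind_elt -(pim_scale rel); apply: pim_eq; apply: IndE. Qed.

Lemma ind_eltS f u : free_map (shift_gen k i) f *: ind_elt u = ind_elt (f *: u).
Proof. by rewrite /ind_elt -(pim_scale rel); apply: pim_eq; apply: IndS. Qed.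

Lemma ind_elt0 : ind_elt 0 = 0.
Proof. by apply: additive0 ind_eltD. Qed.

Lemma ind_eltZ (c : k) u : ind_elt (c%:A *: u) = c%:A *: ind_elt u.
Proof. by rewrite -ind_eltS free_mapZ free_map1. Qed.

Lemma ind_gen (P : D -> Prop) : is_submod P -> (forall u, P (ind_elt u)) -> forall x, P x.
Proof. exact: presented_gen. Qed.

End Presentation.

(** The generators have weights i [nu] with [nu] of content [content lam], and these are not crystal
    words. *)
Lemma induction_triv (lam : strict_part n) : wt lam i != 1 ->
  forall v : Fcyclo t (Lambda1 n) (content lam) i (specht k lam), v = 0.
Proof.
move=> h; pose D := Fcyclo t (Lambda1 n) (content lam) i (specht k lam).
have R := klr_mod_rep t_ok (ind_cyc_mod (content lam) (specht k lam)).1.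
apply: ind_gen => [|u]; first by split=> // [x y -> ->|a x ->]; rewrite ?addr0 ?scaler0.
rewrite -ind_eltE; apply: E_pair_alpha => nu hnu.
apply: (cyc_vanish t_ok (ind_cyc_mod (content lam) (specht k lam)) (wvE R _ _)).
by rewrite cpath_cons (wtw_wt hnu) negb_and h orbT.
Qed.

Section Extend.
Variables (lam lam' : strict_part n).
Hypothesis lamE : content lam' = alpha i + content lam.
Hypothesis wti : wt lam i = 1.
Local Notation iota := (@iota_pre k n lam lam' [:: i]).
Local Notation S := (specht k lam).
Local Notation S' := (specht k lam').
Local Notation D := (Fcyclo t (Lambda1 n) (content lam) i S).
Local Notation q := (@ind_elt (content lam) S).

Lemma ind_to_specht : exists f : {linear D -> S'}, forall u, f (q u) = iota u.
Proof.
apply: presented_lift => g gE x; case=> [f y f0|u u'|u|f u].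
- have := (is_cyclo_modP t (content lam') S').2 (specht_cyc_mod t_ok lam').
  rewrite linearZZ lamE; apply; exact: f0.
- by rewrite /tens1 !linearB /= !gE iota_preD -addrA -opprD subrr.
- by rewrite raddfB /= linearZZ gE iota_epair subrr.
- by rewrite raddfB /= linearZZ !gE (iota_shift lamE) subrr.
Qed.

(** The universal property of S(lam') gives a map back to the induced module, sending the extended
    tableau to the generator of T. It is injective by simplicity of S(lam'), surjective by
    simplicity of S(lam). *)
Lemma induction_iso : lmod_iso D S'.
Proof.
have [f fE] := ind_to_specht; have [T _] := rows_tableau lam.
have HD := ind_cyc_mod (content lam) S.
have R := klr_mod_rep t_ok HD.1.
have [T' eT'] := extend_tableau lamE wti T.
have iT : iota (tvec k T) = tvec k T' by rewrite iota_tvec -[_ ++ _]/(i :: _) -eT' wvec_tab.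
rewrite -lamE in HD R.
have hv : wv E (res_seq (val T')) (q (tvec k T)).
  have : free_map (shift_gen k i) (E (res_seq (val T))) *: q (tvec k T) = q (tvec k T).
    by rewrite ind_eltS E_tvec eqxx.
  by rewrite free_map_gen eT'.
have [psi psiT _] := universal t_ok HD hv.
apply: lmod_iso_sym; apply: (@linear_iso _ _ _ psi).
  have hN := is_submod_ker psi.
  case: (specht_simple k lam') => _ /(_ _ hN) [//|h].
  have := tvec_neq0 k T'; rewrite -iT -fE -psiT h linear0 eqxx //.
have him : is_submod (fun w => exists v, psi v = w).
  split; first by exists 0; rewrite linear0.
    by move=> _ _ [v <-] [w <-]; exists (v + w); rewrite linearD.
  by move=> a _ [v <-]; exists (a *: v); rewrite linearZZ.
apply: ind_gen => // u.
(* The vectors whose generators lie in the image form a submodule, which contains the vector of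
   [T]. *)
have hN : is_submod (fun u => exists v, psi v = q u).
  case: him => him0 himD himZ; apply: free_submod => [|x y hx hy|c v hv'|g v hv'].
  - by rewrite ind_elt0.
  - by rewrite ind_eltD; apply: himD.
  - by rewrite ind_eltZ; apply: himZ.
  - by rewrite -ind_eltS; apply: himZ.
case: (specht_simple k lam) => _ /(_ _ hN) [h|]; last exact.
by case/eqP: (tvec_neq0 k T); apply: h; exists (tvec k T').
Qed.

End Extend.
End Induction.

(** * Convolution with a row *)

Lemma swap_adjK (T : Type) m : involutive (@swap_adj T m).
Proof. by elim: m => [|m IH] [|a [|b s]] //=; rewrite ?IH //; case: m IH. Qed.

Lemma onth_swap_lt (T : Type) l m (s : seq T) : (l < m)%N -> onth (swap_adj m s) l = onth s l.
Proof. by elim: m l s => // m IH [|l] [|x s] //= h; apply: IH. Qed.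

Lemma onth_swapS (T : Type) m (s : seq T) : (m.+1 < size s)%N ->
  onth (swap_adj m s) m.+1 = onth s m.
Proof. by elim: m s => [|m IH] [|x [|y s]] //= h; apply: IH. Qed.

Section Closure.
Variables (k : fieldType) (n : nat) (beta : Qplus n) (A : pzRingType).
Variables (E : seq 'I_n -> A) (X tau : nat -> A) (sc : k -> A).
Variables (M : lmodType A) (HM : klr_rep beta E X tau sc M).
Implicit Types (nu mu : seq 'I_n) (u v : M) (P Q : M -> Prop).
Local Notation N := (height beta).

Record add_closed P : Prop := AddClosed {
  add_closed0 : P 0; add_closedD : forall u v, P u -> P v -> P (u + v) }.

(** Submodules over the subalgebra of the e and the x: all correction terms of the relations of tau
    lie there. *)
Record X_closed P : Prop := XClosed {
  X_closedA :> add_closed P;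
  X_closedZ : forall c v, P v -> P (sc c *: v);
  X_closedE : forall nu v, P v -> P (E nu *: v);
  X_closedX : forall m v, P v -> P (X m *: v) }.

Lemma X_closedN P v : X_closed P -> P v -> P (- v).
Proof.
move=> hP Pv; have -> : - v = sc (-1) *: v; last exact: X_closedZ.
apply/eqP; rewrite eq_sym -subr_eq0 opprK -[X in _ + X]scale1r -(rep_sc1 HM).
by rewrite -scalerDl -(rep_scD HM) addNr (additive0 (rep_scD HM)) scale0r.
Qed.

Lemma weight_ind P Q f : (forall nu v, P v -> P (E nu *: v)) -> add_closed Q ->
  (forall nu v, P v -> wv E nu v -> Q (f *: v)) -> forall v, P v -> Q (f *: v).
Proof.
move=> PE [Q0 QD] h v Pv; rewrite (E_sum HM v) scaler_sumr; elim/big_ind: _ => // nu _.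
by apply: (h nu); [apply: PE | apply: (wvE HM)].
Qed.

Lemma X_closed_exp P m p v : X_closed P -> P v -> P (X m ^+ p *: v).
Proof.
move=> hP Pv; elim: p => [|p IH]; first by rewrite expr0 scale1r.
by rewrite exprS -scalerA; apply: (X_closedX hP).
Qed.

Lemma tau2_closed P q v : X_closed P -> P v -> P (tau q *: (tau q *: v)).
Proof.
move=> hP; rewrite scalerA; move: v.
apply: weight_ind => [|//|nu v Pv h]; [exact: X_closedE | exact: hP |].
have P0 := add_closed0 hP; have PD := add_closedD hP; have PZ := X_closedZ hP.
rewrite -scalerA; have [->|v0] := eqVneq v 0; first by rewrite !scaler0.
have [qN|/(tau_out HM) ->] := ltnP q.+1 N; last exact: P0.
have sz := wv_size HM h v0; rewrite -sz in qN.
have [i [j [nu' e]]] := split_at qN.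
have sq : size (take q nu) = q by rewrite size_takel //; lia.
rewrite e in h; have := tau2_spec HM h; rewrite sq => -[r -> [h1 h2 h3]].
have [/h1 ->|ij] := eqVneq i j; first by rewrite scale0r.
have [/(h2 ij) ->|cij] := eqVneq (cartan i j) 0; first by rewrite scale1r.
have [c [c' [b [_ _ ->]]]] := h3 ij cij; rewrite scalerDl -!scalerA.
by apply: PD; apply: PZ; apply: X_closed_exp.
Qed.

(** x_m tau v is tau applied to another x, up to a correction in [P]. *)
Lemma tauX_closed P Q q m v : X_closed P -> add_closed Q ->
  (forall v, P v -> Q v) -> (forall v, P v -> Q (tau q *: v)) -> P v ->
  Q (X m *: (tau q *: v)).
Proof.
move=> hP hQ PQ PtQ; rewrite scalerA; move: v.
apply: weight_ind => [|//|nu v Pv h]; first exact: X_closedE.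
rewrite -scalerA; have [->|v0] := eqVneq v 0; first by rewrite !scaler0; apply: add_closed0.
have [qN|/(tau_out HM) ->] := ltnP q.+1 N; last by rewrite scaler0; apply: add_closed0.
have sz := wv_size HM h v0; rewrite -sz in qN.
have [i [j [nu' e]]] := split_at qN.
have sq : size (take q nu) = q by rewrite size_takel //; lia.
rewrite e in h; have := tauX_gen HM (transp q m) h; rewrite sq.
have -> : transp q (transp q m) = m.
  by rewrite /transp; do !case: eqP => //; lia.
move/esym/(canRL (addrK _)) => ->; apply: add_closedD => //.
  by apply: PtQ; apply: X_closedX.
apply: PQ; apply: X_closedN => //.
have P0 := add_closed0 hP; case: ifP => _; first exact: X_closedN.
by case: ifP.
Qed.

Lemma braid_closed P Q q v : (forall nu v, P v -> P (E nu *: v)) -> X_closed Q ->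
  (forall v, P v -> Q v) ->
  (forall v, P v -> Q (tau q.+1 *: (tau q *: (tau q.+1 *: v)))) -> P v ->
  Q (tau q *: (tau q.+1 *: (tau q *: v))).
Proof.
move=> PE hQ PQ Pb; rewrite !scalerA; move: v.
apply: weight_ind => [//||nu v Pv h]; first exact: hQ.
have Q0 := add_closed0 hQ; have QD := add_closedD hQ; have QZ := X_closedZ hQ.
rewrite -!scalerA; have [->|v0] := eqVneq v 0; first by rewrite !scaler0.
have [qN|/(tau_out HM) ->] := ltnP q.+2 N; last by rewrite scaler0.
have sz := wv_size HM h v0; rewrite -sz in qN.
have [i [j [nu' e]]] := split_at (ltnW qN).
have sq : size (take q nu) = q by rewrite size_takel //; lia.
case: nu' e => [|l nu'] e.
  by move: qN; rewrite e size_cat sq /=; lia.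
rewrite e in h; have := braid_spec HM h; rewrite sq => -[r + [h1 h2 h3]].
move/esym/(canRL (addrK _)) => ->; apply: (QD _ _); first exact: Pb.
apply: X_closedN => //; case: ifP => _ //.
have [/h1 ->|ij] := eqVneq i j; first by rewrite scale0r.
have [/(h2 ij) ->|cij] := eqVneq (cartan i j) 0; first by rewrite scale0r.
have [c _ ->] := h3 ij cij; rewrite -scalerA; apply: QZ.
case: ifP => _; first by rewrite scale1r; apply: PQ.
by rewrite scalerDl; apply: QD; apply: X_closedX => //; apply: PQ.
Qed.

Section Tower.
Variables (Y0 : M -> Prop) (a : nat).
Hypothesis Y0X : X_closed Y0.
Hypothesis Y0_tau : forall q v, (a <= q)%N -> Y0 v -> Y0 (tau q *: v).
Hypothesis Y0_X0 : forall q v, (q < a)%N -> Y0 v -> X q *: v = 0.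
Hypothesis Y0_tau0 : forall q v, (q.+1 < a)%N -> Y0 v -> tau q *: v = 0.

(* In [L o M] with [L] the module of a row of length a and [Y0 = L (x) M], this is
   the part reached by shuffles that fix the first j letters of [L]. *)
Inductive clos (j : nat) : M -> Prop :=
| ClosIn v of Y0 v : clos j v
| Clos0 : clos j 0
| ClosD u v of clos j u & clos j v : clos j (u + v)
| ClosZ c v of clos j v : clos j (sc c *: v)
| ClosE nu v of clos j v : clos j (E nu *: v)
| ClosX m v of clos j v : clos j (X m *: v)
| ClosT q v of (j <= q)%N & clos j v : clos j (tau q *: v).

Lemma clos_base v : clos a v -> Y0 v.
Proof.
elim=> {v} [v||u v _ hu _ hv|c v _|nu v _|m v _|q v aq _] //.
- exact: (add_closed0 Y0X).
- exact: (add_closedD Y0X).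
- exact: (X_closedZ Y0X).
- exact: (X_closedE Y0X).
- exact: (X_closedX Y0X).
- exact: Y0_tau.
Qed.

Lemma clos_X0 j q v : (q < j <= a)%N -> clos j v -> X q *: v = 0.
Proof.
move=> /andP[qj ja]; elim=> {v} [v||u v _ hu _ hv|c v _ hv|nu v _ hv|m v _ hv|r v jr _ hv].
- by apply: Y0_X0; apply: leq_trans qj ja.
- exact: scaler0.
- by rewrite scalerDr hu hv addr0.
- by rewrite -(rep_scC HM) hv scaler0.
- by rewrite (XE HM) hv scaler0.
- by rewrite (XX HM) hv scaler0.
- by rewrite -(tauX HM) ?hv ?scaler0 //; lia.
Qed.

(** A tau_q with q + 1 < j commutes with all tau_r, r >= j, and kills [Y0]; the x that it does not
    commute with act by 0. *)
Lemma clos_tau0 j q v : (q.+1 < j <= a)%N -> clos j v -> tau q *: v = 0.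
Proof.
move=> /andP[qj ja]; elim=> {v} [v||u v _ hu _ hv|c v _ hv|nu v _ hv|m v cv hv|r v jr _ hv].
- by apply: Y0_tau0; apply: leq_trans qj ja.
- exact: scaler0.
- by rewrite scalerDr hu hv addr0.
- by rewrite -(rep_scC HM) hv scaler0.
- by rewrite (tauE HM) hv scaler0.
- have [mj|jm] := ltnP m j; first by rewrite (clos_X0 _ cv) ?mj ?scaler0.
  by rewrite (tauX HM) ?hv ?scaler0 //; lia.
- by rewrite (tau_far HM) ?hv ?scaler0 //; lia.
Qed.

(** The element for s_(j+d-1) ... s_j: these are the coset representatives of the permutations
    fixing j in those that fix the positions below j. *)
Fixpoint tau_chain (j d : nat) (y : M) : M :=
  if d is d'.+1 then tau (j + d') *: tau_chain j d' y else y.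

(** The word that an idempotent becomes when it moves to the right through [tau_chain]. *)
Fixpoint swap_chain (j d : nat) (nu : seq 'I_n) : seq 'I_n :=
  if d is d'.+1 then swap_chain j d' (swap_adj (j + d') nu) else nu.

Lemma tau_chainE j d nu y :
  E nu *: tau_chain j d y = tau_chain j d (E (swap_chain j d nu) *: y).
Proof.
elim: d nu => //= d IH nu; rewrite -IH (tauE HM) swap_adjK //.
Qed.

Lemma tau_chainZ j d c y : sc c *: tau_chain j d y = tau_chain j d (sc c *: y).
Proof. by elim: d => //= d <-; rewrite (rep_scC HM). Qed.

Lemma tau_chain_far j d q y : (j + d < q)%N ->
  tau q *: tau_chain j d y = tau_chain j d (tau q *: y).
Proof.
elim: d => //= d IH h; rewrite -IH; last by lia.
by rewrite (tau_far HM) //; lia.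
Qed.

(** The span of the cosets of length at most [d] over [clos j.+1]. The bound [d] carries the
    inductions; in the end every element of [clos j] lies in some [zspan j d]. *)
Inductive zspan (j d : nat) : M -> Prop :=
| ZspanIn d' y of (d' <= d)%N & clos j.+1 y : zspan j d (tau_chain j d' y)
| Zspan0 : zspan j d 0
| ZspanD u v of zspan j d u & zspan j d v : zspan j d (u + v).

Lemma zspan_A j d : add_closed (zspan j d).
Proof. by split; constructor. Qed.

Lemma zspan_act j d (x : A) Q : add_closed Q ->
  (forall d' y, (d' <= d)%N -> clos j.+1 y -> Q (x *: tau_chain j d' y)) ->
  forall v, zspan j d v -> Q (x *: v).
Proof.
move=> [Q0 QD] h v; elim=> {v} [d' y|| u v _ hu _ hv]; first exact: h.
  by rewrite scaler0.
by rewrite scalerDr; apply: QD.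
Qed.

Lemma zspanW j d d' v : (d <= d')%N -> zspan j d v -> zspan j d' v.
Proof.
move=> dd; elim=> {v} [d1 y h cy||u v _ hu _ hv]; last exact: ZspanD.
  by apply: ZspanIn => //; apply: leq_trans h dd.
exact: Zspan0.
Qed.

Lemma zspan_tau_far j d q v : (j + d <= q)%N -> zspan j d v -> zspan j d.+1 (tau q *: v).
Proof.
move=> h; apply: zspan_act => [|d' y dd cy]; first exact: zspan_A.
have [lt|ge] := ltnP (j + d') q.
  rewrite tau_chain_far //; apply: ZspanIn; first exact: leqW.
  by apply: ClosT => //; lia.
have -> : q = (j + d')%N by lia.
by rewrite -[_ *: _]/(tau_chain j d'.+1 y); apply: ZspanIn.
Qed.

(** Moving x past the last tau of a chain leaves a correction with a shorter chain. *)
Lemma zspan_X j d : X_closed (zspan j d).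
Proof.
have ZE d1 nu v : zspan j d1 v -> zspan j d1 (E nu *: v).
  apply: zspan_act => [|d' y dd cy]; first exact: zspan_A.
  by rewrite tau_chainE; apply: ZspanIn => //; apply: ClosE.
have ZZ d1 c v : zspan j d1 v -> zspan j d1 (sc c *: v).
  apply: zspan_act => [|d' y dd cy]; first exact: zspan_A.
  by rewrite tau_chainZ; apply: ZspanIn => //; apply: ClosZ.
split=> [|c v|nu v|]; [exact: zspan_A | exact: ZZ | exact: ZE |].
elim/ltn_ind: d => d IH m v.
apply: zspan_act => [|[|d'] y dd cy]; first exact: zspan_A.
  by apply: (@ZspanIn j d 0) => //; apply: ClosX.
apply: (@tauX_closed (zspan j d')) => [||u|u|].
- by split=> [|c u|nu u|m' u]; [exact: zspan_A | exact: ZZ | exact: ZE | exact: IH].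
- exact: zspan_A.
- by apply: zspanW; apply: ltnW.
- by move=> hu; apply: zspanW dd _; apply: zspan_tau_far hu; rewrite leqnn.
- exact: ZspanIn.
Qed.

(** A tau at the end of the chain is absorbed by the quadratic relation, one step earlier it goes
    through by the braid relation, and otherwise it commutes with the last tau of the chain. *)
Lemma zspan_tau_in j d r y : (r < d)%N -> clos j.+1 y ->
  zspan j d (tau (j + r) *: tau_chain j d y).
Proof.
elim: d => // d IH; rewrite ltnS leq_eqVlt => /orP[/eqP ->|rd] cy.
  by apply: zspanW (leqnSn _) _; apply: tau2_closed (zspan_X _ _) _; apply: ZspanIn.
case: d IH rd => // d IH; rewrite ltnS leq_eqVlt => /orP[/eqP ->|rd].
  rewrite /= addnS.
  apply: (@braid_closed (fun v => exists2 y, clos j.+1 y & v = tau_chain j d y)).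
  - move=> nu _ [z cz ->]; rewrite tau_chainE.
    by exists (E (swap_chain j d nu) *: z) => //; apply: ClosE.
  - exact: zspan_X.
  - by move=> _ [z cz ->]; apply: ZspanIn => //; lia.
  - move=> _ [z cz ->]; rewrite tau_chain_far; last by lia.
    have := @ZspanIn j d.+2 d.+2 (tau (j + d).+1 *: z) (leqnn _).
    by rewrite /= addnS; apply; apply: ClosT => //; lia.
  - by exists y.
have -> : tau (j + r) *: tau_chain j d.+2 y = tau (j + d.+1) *: (tau (j + r) *: tau_chain j d.+1 y).
  by rewrite (tau_far HM) //; lia.
by apply: zspan_tau_far => //; apply: IH => //; apply: leqW.
Qed.

Lemma zspan_tau j d q v : (j <= q)%N -> zspan j d v -> zspan j (d + q).+1 (tau q *: v).
Proof.
move=> jq; apply: zspan_act => [|d' y dd cy]; first exact: zspan_A.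
have [lt|ge] := ltnP q (j + d').
  have -> : q = (j + (q - j))%N by lia.
  apply: (@zspanW j d'); first lia.
  by apply: zspan_tau_in => //; lia.
by apply: (@zspanW j d'.+1); [lia | apply: zspan_tau_far => //; apply: ZspanIn].
Qed.

Lemma clos_zspan j v : (j < a)%N -> clos j v -> exists d, zspan j d v.
Proof.
move=> ja; elim=> {v} [v y||u v _ [d hu] _ [d' hv]|c v _ [d hv]|nu v _ [d hv]|m v _ [d hv]|q v jq _ [d hv]].
- by exists 0%N; apply: (@ZspanIn j 0 0) => //; apply: ClosIn.
- by exists 0%N; apply: Zspan0.
- exists (d + d')%N; apply: ZspanD; [apply: zspanW hu | apply: zspanW hv];
    [exact: leq_addr | exact: leq_addl].
- by exists d; apply: (X_closedZ (zspan_X _ _)).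
- by exists d; apply: (X_closedE (zspan_X _ _)).
- by exists d; apply: (X_closedX (zspan_X _ _)).
- by exists (d + q).+1; apply: zspan_tau.
Qed.

(** The letters below [a] are those of the row of length [a]. *)
Definition small nu j := oapp (fun c : 'I_n => val c < a)%N false (onth nu j).

Hypothesis Y0_small : forall nu v, small nu a -> Y0 v -> E nu *: v = 0.

Lemma onth_swap_chain j d nu : (j.+1 < size nu)%N ->
  onth (swap_chain j d.+1 nu) j.+1 = onth nu j.
Proof.
elim: d nu => [|d IH] nu h; first by rewrite [swap_chain _ _ _]/(swap_adj (j + 0) nu) addn0 onth_swapS.
rewrite [swap_chain _ _ _]/(swap_chain j d.+1 _) IH ?size_swap_adj //.
by rewrite onth_swap_lt //; lia.
Qed.

Lemma tau_chain_kill j d y : tau j *: y = 0 -> tau_chain j d.+1 y = 0.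
Proof.
by move=> h; elim: d => [|d IH]; [rewrite /= addn0 | rewrite [LHS]/= -/(tau_chain _ d.+1 _) IH scaler0].
Qed.

(* A weight of a shuffle that does not fix position j has there a letter of [M],
   which is at least a. *)
Lemma clos_step j nu v : (j < a)%N ->
  (forall mu y, small mu j.+1 -> clos j.+1 y -> tau j *: (E mu *: y) = 0) ->
  small nu j -> clos j v -> clos j.+1 (E nu *: v).
Proof.
move=> ja K sn /(clos_zspan ja) [d]; move: v; apply: zspan_act.
  by split; [apply: Clos0 | move=> *; apply: ClosD].
move=> [|d'] y _ cy; first exact: ClosE.
have [jN|Nj] := ltnP j.+1 N; last first.
  by rewrite tau_chain_kill ?scaler0; [apply: Clos0 | apply: (tau_out HM)].
have [sz|/eqP sz] := eqVneq (size nu) N; last first.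
  rewrite (E_out HM); first exact: Clos0.
  by apply/eqP => e; apply: sz; rewrite -e height_content.
rewrite tau_chainE tau_chain_kill; first exact: Clos0.
by apply: K => //; rewrite /small onth_swap_chain // sz.
Qed.

(** Downward induction on [j]. A small letter at j + 1 means that this position too still holds its
    row letter, and tau kills neighbouring letters of a row; for j + 1 = a there is no such
    weight. *)
Lemma clos_small_tau j nu y : (j < a)%N -> small nu j.+1 -> clos j.+1 y ->
  tau j *: (E nu *: y) = 0.
Proof.
have [m] := ubnP (a - j)%N; elim: m j nu y => // m IH j nu y hm ja sn cy.
have [e|ne] := eqVneq j.+1 a.
  by rewrite Y0_small ?scaler0 -?e //; apply: clos_base; rewrite -e.
have ja' : (j.+1 < a)%N by lia.
apply: (@clos_tau0 j.+2); first by lia.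
by apply: clos_step sn cy => // mu z; apply: IH => //; lia.
Qed.

Lemma clos_small j nu v : (j < a)%N -> small nu j -> clos j v -> clos j.+1 (E nu *: v).
Proof. by move=> ja; apply: clos_step => // mu y; apply: clos_small_tau. Qed.

Lemma clos_full nu v : (forall j, (j < a)%N -> small nu j) -> clos 0 v -> Y0 (E nu *: v).
Proof.
move=> sn c0; apply: clos_base.
suff H j : (j <= a)%N -> clos j (E nu *: v) by apply: H.
elim: j => [|j IH] ja; first exact: ClosE.
have -> : E nu *: v = E nu *: (E nu *: v) by rewrite (EE HM) eqxx.
by apply: clos_small => //; [apply: sn | apply: IH; apply: ltnW].
Qed.

(** The tau_q with q >= 1 do not touch the first letter, so it is a first letter of [Y0]. *)
Lemma clos_head nu v : (forall mu u, onth mu 0 = onth nu 0 -> Y0 u -> E mu *: u = 0) ->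
  clos 1 v -> E nu *: v = 0.
Proof.
move=> h c; have {h c} : forall mu, onth mu 0 = onth nu 0 -> E mu *: v = 0; last exact.
elim: c => {v} [v y||u v _ hu _ hv|c v _ hv|mu' v _ hv|m v _ hv|q v q1 _ hv] mu e.
- exact: h.
- by rewrite scaler0.
- by rewrite scalerDr hu // hv // addr0.
- by rewrite -(rep_scC HM) hv // scaler0.
- by rewrite (EE HM); case: eqP => // <-; apply: hv.
- by rewrite -(XE HM) hv // scaler0.
- rewrite -[mu](swap_adjK q) -(tauE HM) hv ?scaler0 //.
  by rewrite onth_swap_lt.
Qed.

End Tower.
End Closure.

Lemma alg_scaleA (k : fieldType) (L : lalgType k) (M : lmodType L) (c d : k) (v : M) :
  c%:A *: (d%:A *: v) = (c * d)%:A *: v.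
Proof. by rewrite scalerA mulr_algl scalerA. Qed.

(** * The module of one row and its products *)

Section RowModule.
Variables (k : fieldType) (n a : nat).
Hypothesis an : (a <= n)%N.
Local Notation F := (free_alg k (klr_gen n)).
Local Notation E := (@eF k n).
Local Notation X := (xF k n).
Local Notation tau := (tauF k n).
Local Notation lrow := (row_part n a).
Local Notation word := (row_word n a).

Lemma row_partE : parts lrow = if a is 0 then [::] else [:: a].
Proof.
case: a an => [|b] h; rewrite /row_part.
  by rewrite /insubd insubF.
by rewrite val_insubd /is_strict /= h.
Qed.

Lemma row_part_word : rows_word n lrow = word.
Proof. by rewrite row_partE; case: a => // b; rewrite /rows_word /= cats0. Qed.

Lemma size_row_word : size word = a.
Proof. by move: an; elim: a => // b IH h; rewrite (row_wordS h) /= IH // ltnW. Qed.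

Lemma row_content : content lrow = seq_content word.
Proof. by rewrite -row_part_word rows_word_content. Qed.

Lemma row_height : height (content lrow) = a.
Proof. by rewrite row_content height_content size_row_word. Qed.

Lemma row_word_lt : all (fun c : 'I_n => val c < a)%N word.
Proof.
move: an; elim: a => // b IH h; rewrite (row_wordS h) /= leqnn /=.
by apply: sub_all (IH (ltnW h)) => c; apply: leqW.
Qed.

Lemma row_word_head : (0 < a)%N -> exists c s, word = c :: s /\ (val c).+1 = a.
Proof.
by move: an; case: a => // b h _; exists (Ordinal h), (row_word n b); rewrite (row_wordS h).
Qed.

Lemma row_word_adj q : (q.+1 < a)%N -> exists p i j s,
  [/\ word = p ++ [:: i, j & s], size p = q & cartan i j != 0].
Proof.
move: an; elim: a q => // b IH q h qb; rewrite (row_wordS h).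
case: q qb => [|q] qb.
  case: b h qb {IH} => // b h _; rewrite (row_wordS (ltnW h)).
  exists [::], (Ordinal h), (Ordinal (ltnW h)), (row_word n b); split=> //.
  by rewrite /cartan -val_eqE /= eqxx gtn_eqF.
have [p [i [j [s [-> sp c]]]]] := IH q (ltnW h) qb.
by exists (Ordinal h :: p), i, j, s; rewrite /= sp.
Qed.

Lemma tau_row (lam : strict_part n) q mu : (q.+1 < a)%N ->
  tau q *: wvec k lam (word ++ mu) = 0.
Proof.
move=> /row_word_adj [p [i [j [s [-> <- c]]]]].
by rewrite -catA tau_wvec_at (negbTE c).
Qed.

Variable T0 : ST lrow.
Hypothesis eT0 : res_seq (val T0) = word.
Local Notation l := (tvec k T0).

Lemma row_E nu : E nu *: l = if nu == word then l else 0.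
Proof. by rewrite E_tvec eT0. Qed.

Lemma row_tau q : tau q *: l = 0.
Proof.
have [qa|aq] := ltnP q.+1 a.
  by rewrite -wvec_tab eT0 -[word]cats0 tau_row.
by apply: tau_out_specht; rewrite -height_lam row_height.
Qed.

(** Neighbouring residues of a row are adjacent nodes, so every tau kills [l] and the line of [l] is
    a submodule of a simple module. *)
Lemma row_span (u : specht k lrow) : u = (u T0 : k)%:A *: l.
Proof.
have hN : is_submod (fun u => exists c : k, u = c%:A *: l).
  apply: free_submod => [|_ _ [c ->] [d ->]|c _ [d ->]|g _ [c ->]].
  - by exists 0; rewrite !scale0r.
  - by exists (c + d); rewrite !scalerDl.
  - by exists (c * d); exact: alg_scaleA.
  - rewrite scale_algC; case: g => [nu|[m|m]].
    + rewrite -[free_gen k _]/(E nu) row_E; case: ifP => _; first by exists c.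
      by exists 0; rewrite !scale0r scaler0.
    + by exists 0; rewrite -[free_gen k _]/(X m) X_act !scale0r scaler0.
    + by exists 0; rewrite -[free_gen k _]/(tau m) row_tau !scale0r scaler0.
case: (specht_simple k lrow) => _ /(_ _ hN) [h|/(_ u) [c e]].
  have := tvec_neq0 k T0; rewrite (h l) ?eqxx //.
  by exists 1; rewrite !scale1r.
by rewrite -E_res [in RHS]e scale_algC E_tvec eqxx -e.
Qed.

End RowModule.

Section ConvolutionPresentation.
Variables (k : fieldType) (n : nat) (t : 'I_n -> 'I_n -> nat -> nat -> k).
Variables (beta gamma : Qplus n).
Local Notation F := (free_alg k (klr_gen n)).
Variables (M N : lmodType F).
Local Notation rel := (@conv_rel k n t beta gamma M N).
Local Notation D := (conv t beta gamma M N).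

Definition tens u v : D := pim rel << (u, v) >>.

Lemma conv_klr_mod : klr_mod t (beta + gamma) D.
Proof.
move=> r hr v; rewrite -[v]reprmK -(pim_scale rel); apply/pim_eq0.
exact/SubmodIn/ConvKlr/klr_pi_rel.
Qed.

Lemma tensDl u u' v : tens (u + u') v = tens u v + tens u' v.
Proof.
by rewrite /tens -(pimD rel); apply: pim_eq; rewrite opprD addrA; exact: ConvDl.
Qed.

Lemma tensDr u v v' : tens u (v + v') = tens u v + tens u v'.
Proof.
by rewrite /tens -(pimD rel); apply: pim_eq; rewrite opprD addrA; exact: ConvDr.
Qed.

Lemma tensL f u v : conv_left beta gamma f *: tens u v = tens (f *: u) v.
Proof. by rewrite /tens -(pim_scale rel); apply: pim_eq; apply: ConvL. Qed.

Lemma tensR f u v : conv_right beta gamma f *: tens u v = tens u (f *: v).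
Proof. by rewrite /tens -(pim_scale rel); apply: pim_eq; apply: ConvR. Qed.

Lemma tens0l v : tens 0 v = 0.
Proof. by apply: (additive0 (f := fun u => tens u v)) => u u'; apply: tensDl. Qed.

Lemma tens0r u : tens u 0 = 0.
Proof. by apply: (additive0 (f := tens u)) => v v'; apply: tensDr. Qed.

Lemma tensZl (c : k) u v : tens (c%:A *: u) v = c%:A *: tens u v.
Proof. by rewrite -tensL /conv_left free_mapZ free_map1. Qed.

Lemma tensZr (c : k) u v : tens u (c%:A *: v) = c%:A *: tens u v.
Proof. by rewrite -tensR /conv_right free_mapZ free_map1. Qed.

Lemma tens_gen (P : D -> Prop) : is_submod P -> (forall u v, P (tens u v)) -> forall x, P x.
Proof. by move=> hP h; apply: presented_gen => // -[u v]; apply: h. Qed.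

End ConvolutionPresentation.

Section WeightLemmas.
Variables (k : fieldType) (n : nat) (beta : Qplus n) (A : pzRingType).
Variables (E : seq 'I_n -> A) (X tau : nat -> A) (sc : k -> A).
Variables (M : lmodType A) (HM : klr_rep beta E X tau sc M).

Lemma wv_intro nu (v : M) : (forall mu, mu != nu -> E mu *: v = 0) -> wv E nu v.
Proof.
move=> h; apply/eqP; rewrite -subr_eq0; apply/eqP.
rewrite (E_sum HM (_ - _)) big1 // => mu _; rewrite scalerBr (EE HM).
by case: eqP => [->|/eqP /h ->]; rewrite ?subrr.
Qed.

Lemma weight_eq (V : zmodType) (f g : M -> V) :
  {morph f : u v / u + v} -> {morph g : u v / u + v} ->
  (forall mu v, wv E mu v -> f v = g v) -> f =1 g.
Proof.
move=> fD gD h v; rewrite (E_sum HM v) (big_morph f fD (additive0 fD)).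
rewrite (big_morph g gD (additive0 gD)); apply: eq_bigr => mu _.
exact: (h mu) (wvE HM _ _).
Qed.

Lemma E_wv_sum (J : finType) (P : pred J) (f : J -> seq 'I_n) kap (v : M) :
  (forall j, P j -> f j != kap) -> E kap *: ((\sum_(j | P j) E (f j)) *: v) = 0.
Proof.
move=> h; rewrite scaler_suml scaler_sumr big1 // => j Pj.
by rewrite (EE HM) eq_sym (negbTE (h j Pj)).
Qed.

End WeightLemmas.

Section RowTensor.
Variables (k : fieldType) (n : nat).
Variables (t : 'I_n -> 'I_n -> nat -> nat -> k) (t_ok : klr_datum t).
Variables (a : nat) (an : (a <= n)%N) (gamma : Qplus n).
Local Notation F := (free_alg k (klr_gen n)).
Local Notation E := (@eF k n).
Local Notation X := (xF k n).
Local Notation tau := (tauF k n).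
Local Notation word := (row_word n a).
Local Notation L := (specht k (row_part n a)).
Variables (M : lmodType F) (HM : klr_mod t gamma M).
Variable T0 : ST (row_part n a).
Hypothesis eT0 : res_seq (val T0) = word.
Local Notation l := (tvec k T0).
Local Notation beta := (content (row_part n a)).
Local Notation D := (conv t beta gamma L M).
Local Notation tens := (@tens k n t beta gamma L M).

Let R := klr_mod_rep t_ok HM.
Let RD := klr_mod_rep t_ok (@conv_klr_mod k n t beta gamma L M).
Let ha : height beta = a := row_height an.

Let El : E word *: l = l.
Proof. by rewrite (row_E k eT0) eqxx. Qed.

(** The idempotent of the row, moved across the tensor sign, fixes the first [a] letters of the
    weight; the one of [mu] fixes the others. *)
Lemma tens_wv mu x : wv E mu x -> wv E (word ++ mu) (tens l x).
Proof.
move=> h; apply: (wv_intro RD) => kap ne.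
have el : tens l x = conv_left beta gamma (E word) *: tens l x.
  by rewrite tensL El.
have er : tens l x = conv_right beta gamma (E mu) *: tens l x by rewrite tensR h.
have [ek|nk] := eqVneq (take a kap) word; last first.
  rewrite el /conv_left free_map_gen; apply: (E_wv_sum RD) => nu _.
  by apply: contraNneq nk => <-; rewrite take_size_cat // size_row_word.
rewrite er /conv_right free_map_gen; apply: (E_wv_sum RD) => nu _.
apply: contraNneq ne => e; move: ek; rewrite -e take_size_cat ?size_tuple //.
by move=> ->.
Qed.

Lemma tens_E nu x :
  E nu *: tens l x = if take a nu == word then tens l (E (drop a nu) *: x) else 0.
Proof.
move: x; apply: (weight_eq R) => [u v|u v|mu x h].
- by rewrite tensDr scalerDr.
- by case: eqP => _; rewrite ?addr0 // scalerDr tensDr.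
rewrite (E_wv RD _ (tens_wv h)) (E_wv R _ h).
have -> : (nu == word ++ mu) = (take a nu == word) && (drop a nu == mu).
  have [sa|/ltnW sa] := leqP a (size nu).
    by rewrite -{1}[nu](cat_take_drop a) eqseq_cat // size_takel // size_row_word.
  apply/eqP/andP => [->|[/eqP e /eqP <-]]; last by rewrite -e cat_take_drop.
  by rewrite take_size_cat ?drop_size_cat ?size_row_word.
by case: (take a nu == word) => //; case: eqP => //; rewrite tens0r.
Qed.

Lemma tens_X m x : X m *: tens l x = if (m < a)%N then 0 else tens l (X (m - a) *: x).
Proof.
have [ma|am] := ltnP m a.
  have := tensL t beta gamma (X m) l x.
  by rewrite /conv_left free_map_gen ha ma X_act tens0l.
have := tensR t beta gamma (X (m - a)) l x.
by rewrite /conv_right free_map_gen ha subnKC.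
Qed.

Lemma tens_tau0 q x : (q.+1 < a)%N -> tau q *: tens l x = 0.
Proof.
move=> qa; have := tensL t beta gamma (tau q) l x.
by rewrite /conv_left free_map_gen ha qa (row_tau k an eT0) tens0l.
Qed.

Lemma tens_tau q x : (a <= q)%N -> tau q *: tens l x = tens l (tau (q - a) *: x).
Proof.
move=> aq; have := tensR t beta gamma (tau (q - a)) l x.
by rewrite /conv_right free_map_gen ha subnKC.
Qed.

(** The set [Y0] of the tower: the part of the product where nothing is shuffled. *)
Definition tens_row (v : D) : Prop := exists x, v = tens l x.

Lemma tens_row_X : X_closed E X (fun c : k => c%:A) tens_row.
Proof.
split.
- split; first by exists 0; rewrite tens0r.
  by move=> _ _ [x ->] [y ->]; exists (x + y); rewrite tensDr.
- by move=> c _ [x ->]; exists (c%:A *: x); rewrite tensZr.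
- move=> nu _ [x ->]; rewrite tens_E; case: ifP => _; first by exists (E (drop a nu) *: x).
  by exists 0; rewrite tens0r.
- move=> m _ [x ->]; rewrite tens_X; case: ifP => _; last by exists (X (m - a) *: x).
  by exists 0; rewrite tens0r.
Qed.

Lemma clos_all (w : D) : clos E X tau (fun c : k => c%:A) tens_row 0 w.
Proof.
move: w; apply: tens_gen => [|u x].
  apply: free_submod => [|u v hu hv|c v hv|g v hv].
  - exact: Clos0.
  - exact: ClosD.
  - exact: ClosZ.
  - by case: g => [nu|[m|q]]; [apply: ClosE | apply: ClosX | apply: ClosT].
rewrite (row_span an eT0 u) tensZl; apply: ClosZ; apply: ClosIn; by exists x.
Qed.

Hypothesis Ma : forall nu (x : M), small a nu 0 -> E nu *: x = 0.

Lemma tens_row_small nu v : small a nu a -> tens_row v -> E nu *: v = 0.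
Proof.
move=> sn [x ->]; rewrite tens_E; case: eqP => // e; rewrite Ma ?tens0r //.
suff on : onth nu a = onth (drop a nu) 0 by move: sn; rewrite /small on.
by rewrite -{1}[nu](cat_take_drop a) e onth_cat size_row_word // ltnn subnn.
Qed.

Lemma row_small nu j : (j < a)%N -> small a (word ++ nu) j.
Proof.
move=> ja; rewrite /small onth_cat size_row_word // ja.
case e: (onth word j) => [c|] /=.
  by apply: (allP (row_word_lt an)); apply/onthP; exists j.
by have := onthTE word j; rewrite e size_row_word // ja.
Qed.

Lemma tens_row_tau q v : (a <= q)%N -> tens_row v -> tens_row (tau q *: v).
Proof. by move=> aq [x ->]; exists (tau (q - a) *: x); apply: tens_tau. Qed.

Lemma tens_row_X0 q v : (q < a)%N -> tens_row v -> X q *: v = 0.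
Proof. by move=> qa [x ->]; rewrite tens_X qa. Qed.

Lemma tens_row_tau0 q v : (q.+1 < a)%N -> tens_row v -> tau q *: v = 0.
Proof. by move=> qa [x ->]; apply: tens_tau0. Qed.

Lemma tens_full nu (w : D) : exists x, E (word ++ nu) *: w = tens l (E nu *: x).
Proof.
have [x e] := clos_full RD tens_row_X tens_row_tau tens_row_X0 tens_row_tau0
  tens_row_small (row_small nu) (clos_all w).
exists x; have h : E (word ++ nu) *: (E (word ++ nu) *: w) = E (word ++ nu) *: w.
  exact: (wvE RD).
rewrite -h e; apply: etrans (tens_E _ _) _.
have sa := size_row_word an.
rewrite (take_size_cat nu sa) (drop_size_cat nu sa) eqxx; exact: erefl.
Qed.

(** A first letter below [a] comes from the row, and the row starts with a - 1. This bound is what a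
    further, shorter row needs. *)
Lemma tens_head nu (w : D) : (0 < a)%N ->
  oapp (fun c : 'I_n => (val c).+1 < a)%N false (onth nu 0) -> E nu *: w = 0.
Proof.
move=> a0 hn; have sn : small a nu 0 by rewrite /small; case: (onth nu 0) hn => //= c; apply: ltnW.
have h : E nu *: (E nu *: w) = E nu *: w by exact: (wvE RD).
rewrite -h; apply: (clos_head RD (Y0 := tens_row)).
  move=> mu _ e [x ->]; rewrite tens_E; case: eqP => [em|_]; last exact: erefl.
  have [c [s [ew ca]]] := row_word_head an a0.
  move: hn; rewrite -e -[mu](cat_take_drop a) em ew /= ca ltnn; exact: id.
exact: (clos_small RD tens_row_X tens_row_tau tens_row_X0 tens_row_tau0 tens_row_small
  a0 sn (clos_all w)).
Qed.

End RowTensor.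

Lemma cat_injr (T : eqType) (s1 s2 t1 t2 : seq T) : size s2 = size t2 ->
  s1 ++ s2 = t1 ++ t2 -> s1 = t1 /\ s2 = t2.
Proof.
move=> sz e; have := congr1 size e; rewrite !size_cat sz => /addIn s1t1.
by move/eqP: e; rewrite eqseq_cat // => /andP[/eqP -> /eqP ->].
Qed.

Lemma lext_scal (k : fieldType) (n : nat) (lam : strict_part n)
    (M : lmodType (free_alg k (klr_gen n))) (a : free_alg k (klr_gen n)) (c : k)
    (f : ST lam -> M) u :
  (forall T, a *: f T = c%:A *: f T) -> a *: lext f u = c%:A *: lext f u.
Proof.
move=> h; rewrite [LHS]scaler_sumr [RHS]scaler_sumr; apply: eq_bigr => T _.
apply: etrans (scale_algC _ _ _) _; rewrite h; exact/esym/scale_algC.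
Qed.

Lemma specht_valZ (k : fieldType) (n : nat) (lam : strict_part n) (c : k)
    (u : specht k lam) T : (c%:A *: u) T = c * u T :> k.
Proof. by rewrite genmodZ ffunE. Qed.

Section FreeMapAction.
Variables (k : fieldType) (G H : choiceType) (h : G -> free_alg k G).
Variable M : lmodType (free_alg k G).
Implicit Types (f g : free_alg k G) (v : M).

Lemma free_map_act1 v : free_map h 1 *: v = v.
Proof. by rewrite free_map1 scale1r. Qed.

Lemma free_map_actM f g v : free_map h (f * g) *: v = free_map h f *: (free_map h g *: v).
Proof. exact: scale_mul (free_mapM h f g). Qed.

Lemma free_map_actD f g v : free_map h (f + g) *: v = free_map h f *: v + free_map h g *: v.
Proof. by rewrite free_mapD scalerDl. Qed.

Lemma free_map_actZ c f v : free_map h (c *: f) *: v = c%:A *: (free_map h f *: v).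
Proof. by rewrite free_mapZ; apply: free_scale_act. Qed.

End FreeMapAction.

Section RowMap.
Variables (k : fieldType) (n : nat).
Variables (t : 'I_n -> 'I_n -> nat -> nat -> k) (t_ok : klr_datum t).
Variables (a : nat) (an : (a <= n)%N) (lam lam' : strict_part n).
Local Notation F := (free_alg k (klr_gen n)).
Local Notation E := (@eF k n).
Local Notation X := (xF k n).
Local Notation tau := (tauF k n).
Local Notation word := (row_word n a).
Local Notation L := (specht k (row_part n a)).
Local Notation S := (specht k lam).
Local Notation S' := (specht k lam').
Hypothesis lamE : content lam' = seq_content word + content lam.
Variable T0 : ST (row_part n a).
Hypothesis eT0 : res_seq (val T0) = word.
Local Notation l := (tvec k T0).
Local Notation beta := (content (row_part n a)).
Local Notation gamma := (content lam).
Local Notation iota := (@iota_pre k n lam lam' word).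

Let ha : height beta = a := row_height an.

Lemma l_val : l T0 = 1 :> k.
Proof. by rewrite ffunE eqxx. Qed.

(** The row module is a line, so its algebra acts on it by scalars, given by the coefficient at
    [T0]; the same scalars must appear on the image of [iota]. *)
Lemma iota_left_gen g (w : S) : conv_left beta gamma (free_gen k g) *: iota w =
  ((free_gen k g *: l) T0 : k)%:A *: iota w.
Proof.
apply: lext_scal => T; rewrite /conv_left free_map_gen; case: g => [nu|[m|m]].
- rewrite -[free_gen k _]/(E nu) (row_E k eT0).
  have sT : size (res_seq (val T)) == height gamma by rewrite size_res height_lam.
  case: eqP => [->|ne].
    rewrite l_val !scale1r.
    apply: (sum_act (f := fun nu' : (height gamma).-tuple 'I_n => word ++ nu')
      (mu := word ++ res_seq (val T)) (j := Tuple sT)) => [x y /eqP|//||nu'].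
    + by rewrite eqseq_cat // eqxx => /eqP/val_inj.
    + by rewrite /in_Ibeta /= res_seq_content.
    + exact: E_wvec.
  rewrite ffunE !scale0r; apply: sum_act0 => nu' _; rewrite E_wvec; case: eqP => [e|_]; last exact: erefl.
  by case: ne; have [] := cat_injr (etrans (size_tuple nu') (esym (eqP sT))) e.
- rewrite -[free_gen k _]/(X m) X_act ffunE scale0r scale0r.
  by case: ifP => _; [apply: X_act | apply: scale0r].
- rewrite -[free_gen k _]/(tau m) (row_tau k an eT0) ffunE scale0r scale0r ha.
  by case: ifP => ma; [apply: tau_row | apply: scale0r].
Qed.

Lemma iota_left f (u : L) (w : S) :
  conv_left beta gamma f *: ((u T0 : k)%:A *: iota w) = ((f *: u) T0 : k)%:A *: iota w.
Proof.
elim/free_ind: f u => [|g f IH|f h IHf IHh|c f IH] u.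
- by rewrite [LHS]free_map_act1 scale1r.
- have key : ((free_gen k g * f) *: u) T0 = (f *: u) T0 * (free_gen k g *: l) T0 :> k.
    by rewrite -scalerA [f *: u in LHS](row_span an eT0) scale_algC specht_valZ.
  apply: etrans (free_map_actM _ _ _ _) _; apply: etrans (congr1 _ (IH u)) _.
  apply: etrans (scale_algC _ _ _) _; apply: etrans (congr1 _ (iota_left_gen g w)) _.
  rewrite key.
  exact: alg_scaleA.
- apply: etrans (free_map_actD _ _ _ _) _; rewrite [X in X + _]IHf [X in _ + X]IHh.
  have -> : ((f + h) *: u) T0 = (f *: u) T0 + (h *: u) T0 :> k by rewrite scalerDl ffunE.
  by rewrite scalerDl scalerDl.
- have key : ((c *: f) *: u) T0 = c * (f *: u) T0 :> k.
    by rewrite (free_scale_act c f u) specht_valZ.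
  apply: etrans (free_map_actZ _ _ _ _) _; apply: etrans (congr1 _ (IH u)) _.
  rewrite key.
  exact: alg_scaleA.
Qed.

Lemma iota_right f (w : S) : conv_right beta gamma f *: iota w = iota (f *: w).
Proof.
elim/free_ind: f w => [|g f IH|f h IHf IHh|c f IH] w.
- by rewrite [LHS]free_map_act1 scale1r.
- apply: etrans (free_map_actM _ _ _ _) _; apply: etrans (congr1 _ (IH w)) _.
  rewrite free_map_gen -scalerA; apply/esym; move: (f *: w) => {}w; apply: lext_hom => T.
  case: g => [nu|[m|m]].
  + have sw : size word == height beta by rewrite size_row_word // ha.
    rewrite -[free_gen k _]/(E nu) E_tvec; case: eqP => [->|ne].
      have inj : injective (fun nu' : (height beta).-tuple 'I_n => nu' ++ res_seq (val T)).
        by move=> x y /cat_injr [] // /val_inj.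
      rewrite lext_tvec; apply/esym.
      apply: (sum_act (mu := word ++ res_seq (val T)) (j := Tuple sw) inj) => [//||nu'].
        by apply/eqP/esym/row_content.
      exact: E_wvec.
    rewrite lext0; apply/esym/sum_act0 => nu' _; rewrite E_wvec; case: eqP => [e|_]; last exact: erefl.
    case: ne; move/eqP: e; rewrite eqseq_cat ?size_tuple ?(eqP sw) // => /andP[_ /eqP //].
  + by rewrite -[free_gen k _]/(X m) !X_act lext0.
  + rewrite -[free_gen k _]/(tau m) ha -{2}(size_row_word an).
    rewrite -/(iota_pre lam' word (tau m *: tvec k T)) (iota_tau lamE).
    by rewrite [iota_pre _ _ _]lext_tvec.
- apply: etrans (free_map_actD _ _ _ _) _; rewrite [X in X + _]IHf [X in _ + X]IHh.
  by rewrite scalerDl iota_preD.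
- apply: etrans (free_map_actZ _ _ _ _) _; apply: etrans (congr1 _ (IH w)) _.
  rewrite (free_scale_act c f w).
  exact/esym/iota_preZ.
Qed.

Lemma iota_pair w : e_pair k beta gamma *: iota w = iota w.
Proof.
apply: lext_fix => T; apply: (e_pair_id (a := word) (b := res_seq (val T))).
- by apply/esym/row_content.
- exact: res_seq_content.
- by move=> mu; apply: E_wvec.
Qed.

End RowMap.

Lemma sub_add_eq0 (V : zmodType) (a b c : V) : a = b + c -> a - b - c = 0.
Proof. by move=> ->; rewrite addrAC addrK subrr. Qed.

(** * The head of the product of all rows *)

Section RowStep.
Variables (k : fieldType) (n : nat).
Variables (t : 'I_n -> 'I_n -> nat -> nat -> k) (t_ok : klr_datum t).
Local Notation F := (free_alg k (klr_gen n)).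
Local Notation E := (@eF k n).
Local Notation X := (xF k n).
Local Notation tau := (tauF k n).

Lemma conv_to_specht (a : nat) (an : (a <= n)%N) (lam lam' : strict_part n)
    (lamE : content lam' = seq_content (row_word n a) + content lam)
    (T0 : ST (row_part n a)) (eT0 : res_seq (val T0) = row_word n a)
    (M : lmodType F) (phi : {linear M -> specht k lam}) :
  exists f : {linear conv t (content (row_part n a)) (content lam) (specht k (row_part n a)) M
                      -> specht k lam'},
    forall u v, f (tens t _ _ u v) =
      (u T0 : k)%:A *: iota_pre lam' (row_word n a) (phi v).
Proof.
have [|f fE] := @presented_lift k _ _ (@conv_rel k n t (content (row_part n a)) (content lam)
   (specht k (row_part n a)) M) (specht k lam')
   (fun uv => (uv.1 T0 : k)%:A *: iota_pre lam' (row_word n a) (phi uv.2)); last first.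
  by exists f => u v; apply: (fE (u, v)).
move=> g gE.
have gT u v : g (tens2 u v) = (u T0 : k)%:A *: iota_pre lam' (row_word n a) (phi v).
  exact: (gE (u, v)).
have gB x y : g (x - y) = g x - g y by exact: raddfB.
have gZ a' x : g (a' *: x) = a' *: g x by exact: linearZZ.
have gB2 x y z : g (x - y - z) = g x - g y - g z by rewrite (gB (x - y) z) (gB x y).
move=> x; case=> [r y r0|u u' v|u v v'|u v|f u v|f u v].
- rewrite linearZZ; apply: (klr_pi_eq0 (specht_cyc_mod t_ok lam').1).
  by rewrite lamE -(row_content an).
- apply: etrans (gB2 (tens2 (u + u') v) (tens2 u v) (tens2 u' v)) _; apply: sub_add_eq0.
  apply: etrans (gT _ _) (etrans _ (esym (congr2 +%R (gT u v) (gT u' v)))).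
  have -> : (u + u') T0 = u T0 + u' T0 :> k by rewrite ffunE.
  by rewrite scalerDl; apply: scalerDl.
- apply: etrans (gB2 (tens2 u (v + v')) (tens2 u v) (tens2 u v')) _; apply: sub_add_eq0.
  apply: etrans (gT _ _) (etrans _ (esym (congr2 +%R (gT u v) (gT u v')))).
  by rewrite linearD iota_preD; apply: scalerDr.
- apply: etrans (gB (_ *: tens2 u v) (tens2 u v)) _; apply/eqP; rewrite subr_eq0; apply/eqP.
  apply: etrans (gZ _ (tens2 u v)) _.
  apply: etrans (congr1 _ (gT u v)) _.
  apply: etrans _ (esym (gT u v)).
  apply: etrans (scale_algC _ _ _) _.
  by rewrite (iota_pair an).
- apply: etrans (gB (_ *: tens2 u v) (tens2 (f *: u) v)) _; apply/eqP; rewrite subr_eq0; apply/eqP.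
  apply: etrans (gZ _ (tens2 u v)) _.
  apply: etrans (congr1 _ (gT u v)) _.
  apply: etrans _ (esym (gT (f *: u) v)).
  exact: iota_left.
- apply: etrans (gB (_ *: tens2 u v) (tens2 u (f *: v))) _; apply/eqP; rewrite subr_eq0; apply/eqP.
  apply: etrans (gZ _ (tens2 u v)) _.
  apply: etrans (congr1 _ (gT u v)) _.
  apply: etrans _ (esym (gT u (f *: v))).
  apply: etrans (scale_algC _ _ _) _.
  by rewrite (iota_right an lamE) linearZZ.
Qed.

(** What the induction on the rows carries along: a generator [v] whose weight space is its line and
    whose image in S(lam) is a tableau vector. [cd_head] bounds the first letters, so that the next
    row can be treated. *)
Record conv_data (lam : strict_part n) (D : {beta : Qplus n & lmodType F}) : Prop := ConvData {
  cd_content : projT1 D = content lam;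
  cd_klr : klr_mod t (content lam) (projT2 D);
  cd_head : forall nu (x : projT2 D),
    oapp (fun c : 'I_n => (val c).+1 < last 0 lam)%N false (onth nu 0) -> E nu *: x = 0;
  cd_cyclic : exists (v : projT2 D) (phi : {linear projT2 D -> specht k lam}),
    [/\ phi v = wvec k lam (rows_word n lam), wv E (rows_word n lam) v,
        forall w, submod_gen (fun x => x = v) w &
        forall w, exists c : k, E (rows_word n lam) *: w = c%:A *: v] }.

Lemma row_word_not_small p : (p <= n)%N ->
  oapp (fun c : 'I_n => (val c).+1 < last 0 (row_part n p))%N false (onth (row_word n p) 0) = false.
Proof.
move=> pn; rewrite (row_partE pn); have [->|p0] := posnP p; first by case: (onth _ 0).
have [c [s [-> cp]]] := row_word_head pn p0.
by case: p cp {pn p0} => //= p ->; rewrite ltnn.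
Qed.

Lemma conv_data_row p : (p <= n)%N -> conv_data (row_part n p) (row_mod k n p).
Proof.
move=> pn; have [T eT] := rows_tableau (row_part n p).
have eT0 := etrans eT (row_part_word pn).
split; [exact: erefl | exact: (specht_cyc_mod t_ok _).1 | |].
  move=> nu x h; rewrite (row_span pn eT0 x) scale_algC (row_E k eT0).
  case: eqP => [e|_]; last exact: scaler0.
  by rewrite e (row_word_not_small pn) in h.
exists (tvec k T), idfun; rewrite -eT wvec_tab; split=> //.
- by rewrite /wv E_tvec eqxx.
- move=> w; case: (specht_simple k (row_part n p)) => _ /(_ _ (is_submod_gen (fun x => x = tvec k T))).
  case=> [h|]; last exact.
  have := tvec_neq0 k T; rewrite (h (tvec k T)) ?eqxx //; exact: SubmodIn.
- by move=> w; exists (w T); rewrite E_res.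
Qed.

Lemma conv_data_step (lam lam' : strict_part n) (a : nat) D :
  conv_data lam D -> parts lam' = rcons (parts lam) a -> (a < last 0 lam)%N ->
  conv_data lam' (conv_tagged t (row_mod k n a) D).
Proof.
case: D => gamma M [/= eg HM Mhead [v [phi [phiv wv_v gen_v span_v]]]] el al.
move: eg; move=> ->.
have /andP[a0 an] : (0 < a <= n)%N by apply: (@lam_bound _ lam'); rewrite el mem_rcons inE eqxx.
have [T0 eT] := rows_tableau (row_part n a); have eT0 := etrans eT (row_part_word an).
have wE : rows_word n lam' = row_word n a ++ rows_word n lam by rewrite el rows_word_rcons.
have lamE : content lam' = seq_content (row_word n a) + content lam.
  by rewrite -rows_word_content wE seq_content_cat rows_word_content.
have Ma nu (x : M) : small a nu 0 -> E nu *: x = 0.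
  (* Nonzero weights of [M] start with a letter at least [last 0 lam] - 1, hence at least [a]. *)
  move=> sn; apply: Mhead; case: nu sn => //= c s ca; exact: leq_ltn_trans ca al.
have [f fE] := conv_to_specht an lamE eT0 phi.
split.
- by rewrite [LHS]/= lamE (row_content an).
- by rewrite lamE -(row_content an); apply: conv_klr_mod.
- move=> nu x; rewrite el last_rcons => h; exact: (tens_head t_ok an HM eT0 Ma).
exists (tens t _ _ (tvec k T0) v), f; split.
- by rewrite fE phiv l_val scale1r scale1r (iota_wvec _ lamE) wE.
- by rewrite wE; apply: tens_wv.
- have [s0 sD sZ] := is_submod_gen (fun x => x = tens t (content (row_part n a)) (content lam) (tvec k T0) v).
  apply: tens_gen => // u x; rewrite (row_span an eT0 u) tensZl; apply: (sZ _ _).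
  elim: (gen_v x) => {x} [x ->||x y _ hx _ hy|b x _ hx].
  + exact: SubmodIn.
  + by rewrite tens0r.
  + by rewrite tensDr; apply: sD.
  + by rewrite -tensR; apply: sZ.
- move=> w; rewrite wE; have [x ->] := tens_full t_ok an HM eT0 Ma (rows_word n lam) w.
  by have [c ->] := span_v x; exists c; rewrite tensZr.
Qed.

Lemma conv_foldl_data p s (h : is_strict n (p :: s)) :
  conv_data (StrictPart h)
    (foldl (fun M q => conv_tagged t (row_mod k n q) M) (row_mod k n p) s).
Proof.
elim/last_ind: s h => [|s a IH] h.
  have pn : (p <= n)%N by case/andP: (h) => _ /= /andP[/andP[]].
  rewrite (_ : StrictPart h = row_part n p); first exact: conv_data_row.
  by apply: val_inj; rewrite /= row_partE //; case: p h pn.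
have [h' al] : is_strict n (p :: s) /\ (a < last p s)%N.
  move: h; rewrite /is_strict /= rcons_path all_rcons.
  by case/andP=> /andP[-> al] /and3P[-> _ ->].
rewrite foldl_rcons; apply: conv_data_step (IH h') _ al.
by [].
Qed.

Lemma conv_rows_data (lam : strict_part n) :
  exists2 D, conv_data lam D & conv_rows t lam = projT2 D.
Proof.
case: lam => [[|p s] h].
  exists (row_mod k n 0) => //; rewrite (_ : StrictPart h = row_part n 0).
    exact: conv_data_row.
  by apply: val_inj; rewrite /= row_partE.
by eexists; first exact: (conv_foldl_data h).
Qed.

Lemma conv_rows_head (lam : strict_part n) : lmod_iso (specht k lam) (mod_head (conv_rows t lam)).
Proof.
have [D [_ HD _ [v [phi [phiv wv_v gen_v span_v]]]] ->] := conv_rows_data lam.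
have [T eT] := rows_tableau lam.
have pT : phi v = tvec k T by rewrite phiv -eT wvec_tab.
have pv : phi v != 0 by rewrite pT tvec_neq0.
apply: (head_iso (specht_simple k lam) pv gen_v) => N [N0 ND NZ] [u [Nu phiu]].
have [c e] := span_v u.
have := NZ (E (rows_word n lam)) u Nu; rewrite e => Ncv.
(* The idempotent of the reading word sends [u] to c v while keeping its image phi v, so c = 1 and
   the submodule contains [v]. *)
have e1 : c%:A *: phi v = phi v.
  by rewrite -linearZZ -e linearZZ phiu -linearZZ wv_v.
suff c1 : c = 1 by move: Ncv; rewrite c1 !scale1r.
have := congr1 (fun u : specht k lam => u T : k) e1.
by rewrite pT specht_valZ ffunE eqxx mulr1.
Qed.

End RowStep.

(** * Homogeneity *)

Section Grading.
Variables (k : fieldType) (n : nat) (lam : strict_part n).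
Local Notation F := (free_alg k (klr_gen n)).
Local Notation gr := (specht_grading (k := k) (lam := lam)).

(** The x act by 0, and tau acts nontrivially only at orthogonal letters, where its degree is 0. *)
Lemma klr_deg_act d (f : F) : klr_deg (content lam) d f ->
  d = 0 \/ forall v : specht k lam, f *: v = 0.
Proof.
elim=> {d f} [d|d f g _ [->|hf] _ [|hg]|d c f _ [->|hf]|d d' f g _ hf _ hg|nu _|l nu i _ _|l nu i j _ hi hj].
- by right=> v; rewrite scale0r.
- by left.
- by left.
- by left.
- by right=> v; rewrite scalerDl hf hg addr0.
- by left.
- by right=> v; rewrite (free_scale_act c f v) hf scaler0.
- case: hf => [->|hf]; last by right=> v; rewrite -scalerA hf.
  case: hg => [->|hg]; first by left; rewrite addr0.
  by right=> v; rewrite -scalerA hg scaler0.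
- by left.
- by right=> v; rewrite -scalerA X_act.
have [c0|c0] := eqVneq (cartan i j) 0.
  by left; apply/eqP; rewrite oppr_eq0 root_form_eq0 c0.
right; apply: specht_act0 => T; rewrite -scalerA E_tvec.
case: eqP => [e|_]; last exact: scaler0.
case/onth_split: hi => pi [s [es sp]].
have [s' es'] : exists s', s = j :: s'.
  move: hj; rewrite es -sp -addn1 onth_catS; case: s {es} => // x s' [->].
  by exists s'.
by rewrite -wvec_tab -e es es' -sp tau_wvec_at (negbTE c0).
Qed.

Lemma specht_graded : graded_mod (content lam) gr.
Proof.
split.
- by move=> d; right.
- move=> d u v [->|->]; first by left.
  by case=> [->|->]; [left | right; rewrite addr0].
- by move=> d c v [->|->]; [left | right; rewrite scaler0].
- move=> v; exists [:: 0], (fun d => if d == 0 then v else 0); split.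
    by move=> d; case: eqP => [->|_]; [left | right].
  by rewrite big_seq1 eqxx.
- move=> ds vs uds hvs s0 d dds; case: (hvs d) => // d0.
  move: s0; rewrite (bigD1_seq d) //= big1 ?addr0 // => d' dd'.
  by case: (hvs d') => // d'0; rewrite d'0 d0 eqxx in dd'.
- move=> d d' f v /klr_deg_act [->|h] => [[->|->]|_]; first by left.
    by right; rewrite scaler0.
  by right; apply: h.
Qed.

Lemma specht_homogeneous : homogeneous_gr gr.
Proof. by exists 0 => d d0 v [e|//]; rewrite e eqxx in d0. Qed.

End Grading.

Theorem theorem3p4 (k : fieldType) (n : nat) (n_gt1 : (1 < n)%N)
    (t : 'I_n -> 'I_n -> nat -> nat -> k) (t_ok : klr_datum t)
    (b : weight n) (b_crystal : weyl_orbit (Lambda1 n) b)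
    (beta : Qplus n) (betaE : Lambda1 n - Qroot beta = b) :
  let lam := lambda_of b in
  let S (c : weight n) := specht k (lambda_of c) in
  [/\ (* (1) *)
      [/\ is_cyclo_mod t (Lambda1 n) beta (S b),
          graded_mod beta (specht_grading (k:=k) (lam:=lam)),
          homogeneous_gr (specht_grading (k:=k) (lam:=lam))
        & simple_mod (S b)],
      (* (2) *)
      lmod_iso (S b) (mod_head (conv_rows t lam)),
      (* (3) *)
      lmod_iso (Ind t (Lambda1 n) beta (S b))
        (dsum (fun i : {i : 'I_n | ftilde i b != None} =>
                 S (odflt b (ftilde (val i) b)))) /\
      lmod_iso (Res beta (S b))
        (dsum (fun i : {i : 'I_n | etilde i b != None} =>
                 S (odflt b (etilde (val i) b))))
    & (* (4) *)
      (forall (T U : ST lam) (ks ks' : seq nat),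
         reduced_expr (tab_perm T U) ks -> reduced_expr (tab_perm T U) ks' ->
         c_elt t beta (Lambda1 n) T U ks = c_elt t beta (Lambda1 n) T U ks') /\
      (forall ks : ST lam -> ST lam -> seq nat,
         (forall T U, reduced_expr (tab_perm T U) (ks T U)) ->
         cyclo_basis (fun TU : ST lam * ST lam =>
           c_elt t beta (Lambda1 n) TU.1 TU.2 (ks TU.1 TU.2)))].
Proof.
(* Since the simple roots are independent ([Qroot_inj]), [beta] must be the content of the partition
   of [b]. *)
move=> lam S; have eb := esym (content_lambda_of b_crystal betaE).
rewrite -/lam in eb; subst beta.
have wb : wt lam = b := wt_lambda_of b_crystal.
split.
- split; [exact/is_cyclo_modP/specht_cyc_mod | exact: specht_graded |
    exact: specht_homogeneous | exact: specht_simple].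
- exact: conv_rows_head.
- split.
    apply: (dsum_iso (P := fun i => ftilde i b != None)) => [[i Pi]|i nP].
      rewrite /=; move: Pi; rewrite /ftilde; case: (b i =P 1) => // bi _.
      have wi : wt lam i = 1 by rewrite wb.
      exact: (induction_iso t_ok (content_ftilde b_crystal bi) wi).
    apply: (induction_triv t_ok); rewrite wb; move: nP; rewrite /ftilde.
    by case: (b i =P 1).
  apply: (dsum_iso (P := fun i => etilde i b != None)) => [[i Pi]|i nP].
    rewrite /=; move: Pi; rewrite /etilde; case: (b i =P -1) => // bi _.
    have ob : weyl_orbit (Lambda1 n) (b + root i).
      by have := orbit_reflection i b_crystal; rewrite /reflection bi mulrNz mulr1z opprK.
    have wi : wt (lambda_of (b + root i)) i = 1.
      by rewrite (wt_lambda_of ob) !ffunE bi cartan_diag.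
    exact: (restriction_iso k (content_etilde b_crystal bi) wi).
  by apply: restriction_triv; rewrite wb; move: nP; rewrite /etilde; case: (b i =P -1).
- split; [exact: c_elt_indep | exact: c_elt_basis].
Qed.
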